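(* Let $m\ge1$ and $n\ge m+2$. The family $$\widetilde\Psi^S(\mathbf S;\mathbf L)=\mathbb E_{\mathbf Z}\,\|\mathbf S+\mathbf L\mathbf Z\|_*,\qquad \mathbf S\in\mathbb R^{m\times n},\ \mathbf L\in\mathbb S_+^m,$$ where $\mathbf Z\in\mathbb R^{m\times n}$ has i.i.d. standard Gaussian entries, is an $(\alpha,\beta)$-admissible smoothing of the nuclear norm with $\alpha=\sqrt m+\sqrt n$ and $\beta=\frac1{\sqrt{n-m-1}}$. As a corollary, let $D>0$, $G>0$, let $\mathbf G_1,\dots,\mathbf G_T\in\mathbb R^{m\times n}$ satisfy $\|\mathbf G_t\|_{\mathrm{op}}\le G$ for all $t$, let $\mathbf S_t=\sum_{s=1}^t\mathbf G_s$, $\mathbf M_t=\sum_{s=1}^t\mathbf G_s\mathbf G_s^\top$, $\mathbf L_t=\sqrt{G^2\mathbf I+\mathbf M_t}$, $\eta=\sqrt{\alpha/\beta}$, and let $\mathbf X_1=0$ and $$\mathbf X_{t+1}=-D\,\mathbb E_{\mathbf Z}\Bigl[\operatorname*{arg\,max}_{\|\mathbf X\|_{\mathrm{op}}\le1}\bigl\langle\mathbf S_t+\tfrac1\eta\mathbf L_t\mathbf Z,\mathbf X\bigr\rangle\Bigr],\qquad t\ge1.$$ Then $\mathrm{Reg}_T=\sum_{t=1}^T\langle\mathbf G_t,\mathbf X_t\rangle-\min_{\|\mathbf X\|_{\mathrm{op}}\le D}\sum_{t=1}^T\langle\mathbf G_t,\mathbf X\rangle$ satisfies $$\mathrm{Reg}_T\le2\sqrt2\,D\Bigl(\frac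 n{n-m-1}\Bigr)^{1/4}\Bigl(\mathrm{Tr}\bigl[\mathbf M_T^{1/2}\bigr]+mG\Bigr).$$
   Context: $\langle\mathbf A,\mathbf B\rangle=\mathrm{Tr}(\mathbf A^\top\mathbf B)$; $\|\cdot\|_{\mathrm{op}}$ is the operator (spectral) norm and $\|\cdot\|_*$ the nuclear norm. $\mathbb S_+^m$ is the set of symmetric positive semidefinite $m\times m$ matrices, $\preceq$ the Loewner order, and $\sqrt{\cdot}$ the PSD square root. The argmax in the update is unique for almost every $\mathbf Z$. For a differentiable function $f$, the Bregman divergence is $\mathcal B_f(\mathbf U\|\mathbf V)=f(\mathbf U)-f(\mathbf V)-\langle\nabla f(\mathbf V),\mathbf U-\mathbf V\rangle$. Admissible smoothing: a family of functions $\{\widetilde\Psi(\cdot;\mathbf L):\mathbb R^{m\times n}\to\mathbb R\}_{\mathbf L\in\mathbb S_+^m}$ is an $(\alpha,\beta)$-admissible smoothing of $\|\cdot\|_*$ if: (a) (Feasibility) for all $\mathbf L\in\mathbb S_+^m$ and all $\mathbf X\in\mathbb R^{m\times n}$ at which $\widetilde\Psi(\cdot;\mathbf L)$ is differentiable, $\|\nabla_{\mathbf X}\widetilde\Psi(\mathbf X;\mathbf L)\|_{\mathrm{op}}\le 1$; (b) (Dominance) for all $\mathbf L\in\mathbb S_+^m$ and $\mathbf X\in\mathbb R^{m\times n}$, $\widetilde\Psi(\mathbf X;\mathbf L)\ge\|\mathbf X\|_*$, and $\widetilde\Psi(\mathbf X;0)=\|\mathbf X\|_*$; (c) (Upper stability)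 for all $\mathbf L_1\preceq\mathbf L_2$ in $\mathbb S_+^m$, $\sup_{\mathbf X}\bigl(\widetilde\Psi(\mathbf X;\mathbf L_2)-\widetilde\Psi(\mathbf X;\mathbf L_1)\bigr)\le\alpha(\mathrm{Tr}(\mathbf L_2)-\mathrm{Tr}(\mathbf L_1))$; (d) (Smoothness) for every $\mathbf L\succ0$, $\widetilde\Psi(\cdot;\mathbf L)$ is continuously differentiable and $\mathcal B_{\widetilde\Psi(\cdot;\mathbf L)}(\mathbf Y\|\mathbf X)\le\frac\beta2\mathrm{Tr}\bigl((\mathbf X-\mathbf Y)^\top\mathbf L^{-1}(\mathbf X-\mathbf Y)\bigr)$ for all $\mathbf X,\mathbf Y\in\mathbb R^{m\times n}$. *)

(* Defs.v *)
From HB Require Import structures.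
From mathcomp Require Import all_boot all_order all_algebra.
From mathcomp Require Import all_classical all_reals all_analysis.

Set Implicit Arguments.
Unset Strict Implicit.
Unset Printing Implicit Defensive.

Import Order.TTheory GRing.Theory Num.Theory.
Import numFieldNormedType.Exports.
Local Open Scope classical_set_scope.
Local Open Scope ring_scope.

Section Matrices.
Context {R : realType}.

Definition frob {m n : nat} (A B : 'M[R]_(m, n)) : R := \tr (A^T *m B).

Definition l2norm {n : nat} (v : 'cV[R]_n) : R :=
  Num.sqrt (\sum_(i < n) v i 0 ^+ 2).

(* The library norm `|A| on matrices is the entrywise maximum, not this one. *)
Definition opnorm {m n : nat} (A : 'M[R]_(m, n)) : R :=
  sup [set l2norm (A *m v) | v in [set v : 'cV[R]_n | l2norm v <= 1]].

Definition psd {m : nat} (A : 'M[R]_m) : Prop :=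
  A^T = A /\ forall v : 'cV[R]_m, 0 <= \tr (v^T *m A *m v).

Definition posdef {m : nat} (A : 'M[R]_m) : Prop :=
  A^T = A /\ forall v : 'cV[R]_m, v != 0 -> 0 < \tr (v^T *m A *m v).

Definition loewner_le {m : nat} (A B : 'M[R]_m) : Prop := psd (B - A).

(* On PSD input the set below is a singleton; on other input the value may be
   the default 0, and is never used. *)
Definition psd_sqrt {m : nat} (A : 'M[R]_m) : 'M[R]_m :=
  xget 0 [set B : 'M[R]_m | psd B /\ B *m B = A].

(* Sum of the singular values of A, i.e. of the eigenvalues of (A^T A)^(1/2). *)
Definition nuclear_norm {m n : nat} (A : 'M[R]_(m, n)) : R :=
  \tr (psd_sqrt (A^T *m A)).

Definition gradient {m n : nat} (f : 'M[R]_(m, n) -> R) (X : 'M[R]_(m, n)) :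
    'M[R]_(m, n) :=
  \matrix_(i < m, j < n) 'D_(delta_mx i j) f X.

Definition bregman {m n : nat} (f : 'M[R]_(m, n) -> R) (U V : 'M[R]_(m, n)) : R :=
  f U - f V - frob (gradient f V) (U - V).

Definition continuously_differentiable {m n : nat} (f : 'M[R]_(m, n) -> R) : Prop :=
  (forall X, differentiable f X) /\ continuous (gradient f).

(* Psi L X stands for Psi(X; L); only its values at PSD L are constrained. *)
Record admissible_smoothing {m n : nat} (alpha beta : R)
    (Psi : 'M[R]_m -> 'M[R]_(m, n) -> R) : Prop := AdmissibleSmoothing {
  feasibility : forall L X, psd L -> differentiable (Psi L) X ->
    opnorm (gradient (Psi L) X) <= 1;
  dominance : forall L X, psd L -> nuclear_norm X <= Psi L X;
  dominance0 : forall X, Psi 0 X = nuclear_norm X;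
  upper_stability : forall L1 L2, psd L1 -> psd L2 -> loewner_le L1 L2 ->
    (ereal_sup (range (fun X => (Psi L2 X - Psi L1 X)%:E))
       <= (alpha * (\tr L2 - \tr L1))%:E)%E;
  smoothness : forall L, posdef L ->
    continuously_differentiable (Psi L) /\
    forall X Y, bregman (Psi L) Y X
      <= beta / 2 * \tr ((X - Y)^T *m invmx L *m (X - Y)) }.

(* Some maximiser of <A, .> over the operator-norm unit ball. By compactness
   one exists; which one is returned when there are several is unspecified. *)
Definition op_argmax {m n : nat} (A : 'M[R]_(m, n)) : 'M[R]_(m, n) :=
  xget 0 [set X : 'M[R]_(m, n) | opnorm X <= 1 /\
    forall Y : 'M[R]_(m, n), opnorm Y <= 1 -> frob A Y <= frob A X].

End Matrices.

Section GaussianMatrices.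
Context {R : realType} {d : measure_display} {T : measurableType d}.
Variable P : probability T R.

(* Entries are mutually independent and N(0,1). Since some of the B i j may be
   the whole line, the product rule below covers all subfamilies. *)
Definition std_gaussian_matrix {m n : nat} (Z : 'I_m -> 'I_n -> {RV P >-> R}) : Prop :=
  (forall i j B, measurable B -> distribution P (Z i j) B = normal_prob 0 1 B) /\
  (forall B : 'I_m -> 'I_n -> set R, (forall i j, measurable (B i j)) ->
    P [set w | forall i j, B i j (Z i j w)] =
    (\prod_(i < m) \prod_(j < n) P (Z i j @^-1` B i j))%E).

Definition rmatrix {m n : nat} (Z : 'I_m -> 'I_n -> {RV P >-> R}) (w : T) :
    'M[R]_(m, n) :=
  \matrix_(i < m, j < n) Z i j w.

Definition expectation_mx {m n : nat} (A : T -> 'M[R]_(m, n)) : 'M[R]_(m, n) :=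
  \matrix_(i < m, j < n) fine ('E_P[fun w => A w i j])%E.

Definition gaussian_smoothing {m n : nat} (Z : 'I_m -> 'I_n -> {RV P >-> R})
    (L : 'M[R]_m) (S : 'M[R]_(m, n)) : R :=
  fine ('E_P[fun w => nuclear_norm (S + L *m rmatrix Z w)])%E.

End GaussianMatrices.

Section OnlineLearning.
Context {R : realType} {m n : nat}.
Implicit Types Gs Xs : nat -> 'M[R]_(m, n).

Definition grad_sum Gs (t : nat) : 'M[R]_(m, n) := \sum_(1 <= s < t.+1) Gs s.

Definition gram_sum Gs (t : nat) : 'M[R]_m :=
  \sum_(1 <= s < t.+1) Gs s *m (Gs s)^T.

(* inf is attained (the ball is compact), so it is the minimum. *)
Definition regret (D : R) Gs Xs (T : nat) : R :=
  \sum_(1 <= t < T.+1) frob (Gs t) (Xs t)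
  - inf [set \sum_(1 <= t < T.+1) frob (Gs t) U
          | U in [set U : 'M[R]_(m, n) | opnorm U <= D]].

End OnlineLearning.

(* Main.v *)
From HB Require Import structures.
Require Import Defs.
From mathcomp Require Import all_boot all_order all_algebra.
From mathcomp Require Import all_classical all_reals all_analysis.
From mathcomp Require Import measurable_realfun.
From mathcomp Require Import ring lra.
Set Implicit Arguments.
Unset Strict Implicit.
Unset Printing Implicit Defensive.
Import Order.TTheory GRing.Theory Num.Theory.
Import numFieldNormedType.Exports.
Local Open Scope classical_set_scope.
Local Open Scope ring_scope.

(** The smoothing is an average of nuclear norms, Psi (S; L) = E |S + L Z|_nuc
    with Z a Gaussian matrix, so most of the admissibility conditions are
    inherited from the nuclear norm. Psi is 1-Lipschitz for the nuclear norm,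
    whose dual norm is the operator norm; this bounds the gradients
    (lipschitz_gradient). Pairing S + L Z with a dual matrix of S and using
    E Z = 0 gives dominance. By the triangle inequality, stability reduces to
    E |D Z|_nuc <= sqrt n * tr D for psd D, which follows from the inequality
    2 |D Z|_nuc <= c <Z, D Z> + tr D / c at c = 1 / sqrt n (nuclear_amgm).

    Smoothness is where the dimension gap n - m - 1 enters. Almost surely
    X = S + L Z has full row rank (gaussian_full_rank); there the nuclear norm has
    the tangent U = N X, with N = (X X^T)^(-1/2), and it lies below that tangent
    plus <H, N H> / 2 (nuclear_subgradient, nuclear_bregman: both come from
    2 |Y|_nuc <= tr W + tr (W^-1 Y Y^T), an equality for Y = X at
    W = (X X^T)^(1/2)). Averaging these two bounds gives bounds of Psi by affine
    and quadratic functions, which force Psi to be C^1 with gradient E U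
    (quadratic_bound_C1) and bound its Bregman divergence by <H, (E N) H> / 2. It
    remains to see that E N <= beta L^-1 (expected_polar_inv_le). Since (E N)^2 <=
    E N^2 and the square root is operator monotone, this reduces to the estimate
    u^T E[(W W^T)^-1] u <= |u|^2 / (n - m - 1) for W = S' + Z with any shift S'
    (inv_gram_moment).

    By rotation invariance u may be taken to be a basis vector e_p. Then the
    quantity is 1 / |w Pi|^2, where w is row p of W and Pi is the orthogonal
    projection, of rank n - m + 1 and independent of w, off the other rows
    (inv_gram_pivot). Conditionally on Pi this is the inverse second moment of a
    shifted Gaussian vector in dimension k = n - m + 1, and Stein's identity for
    w Pi / (eps + |w Pi|^2) bounds it by 1 / (k - 2), with equality for shift 0
    and eps = 0 (projection_bound).

    For the regret, X_(t+1) is - D times the gradient of F_t = Psi (.; L_t / eta)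
    at S_t, because the maximiser is almost surely the polar factor U. The minimum
    over the ball is - D |S_T|_nuc >= - D F_T (S_T), so the regret is at most D
    times the sum of the increments F_t (S_t) - F_(t-1) (S_(t-1)) minus their
    linear parts. Each is at most the cost of changing the regulariser plus a
    Bregman divergence, and both are bounded by multiples of trace increments of
    the regularisers (potential_step, trace_increment_lag); the sum telescopes to
    a multiple of tr L_T (potential_bound).

    Expectations are handled through the law of Z on boxes: one entry at a time is
    integrated out against the Gaussian line (resample), and a change of variables
    in that entry (entry_affine) yields translations, reflections and rotations of
    Z. *)

(** * The Frobenius inner product *)

Section Frobenius.
Context {R : realType}.
Implicit Types (m n p : nat).

Lemma frobE m n (A B : 'M[R]_(m, n)) : frob A B = \sum_i \sum_j A i j * B i j.
Proof.
rewrite /frob /mxtrace exchange_big /=; apply: eq_bigr => j _.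
by rewrite mxE; apply: eq_bigr => i _; rewrite mxE.
Qed.

Lemma frobC m n (A B : 'M[R]_(m, n)) : frob A B = frob B A.
Proof. by rewrite /frob -mxtrace_tr trmx_mul trmxK. Qed.

Lemma frobDr m n (A B C : 'M[R]_(m, n)) : frob A (B + C) = frob A B + frob A C.
Proof. by rewrite /frob mulmxDr linearD. Qed.

Lemma frobDl m n (A B C : 'M[R]_(m, n)) : frob (A + B) C = frob A C + frob B C.
Proof. by rewrite frobC frobDr !(frobC C). Qed.

Lemma frobZr m n a (A B : 'M[R]_(m, n)) : frob A (a *: B) = a * frob A B.
Proof. by rewrite /frob -scalemxAr linearZ. Qed.

Lemma frobZl m n a (A B : 'M[R]_(m, n)) : frob (a *: A) B = a * frob A B.
Proof. by rewrite frobC frobZr frobC. Qed.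

Lemma frobNr m n (A B : 'M[R]_(m, n)) : frob A (- B) = - frob A B.
Proof. by rewrite -scaleN1r frobZr mulN1r. Qed.

Lemma frobNl m n (A B : 'M[R]_(m, n)) : frob (- A) B = - frob A B.
Proof. by rewrite frobC frobNr frobC. Qed.

Lemma frobBr m n (A B C : 'M[R]_(m, n)) : frob A (B - C) = frob A B - frob A C.
Proof. by rewrite frobDr frobNr. Qed.

Lemma frobBl m n (A B C : 'M[R]_(m, n)) : frob (A - B) C = frob A C - frob B C.
Proof. by rewrite frobDl frobNl. Qed.

Lemma frob0r m n (A : 'M[R]_(m, n)) : frob A 0 = 0.
Proof. by rewrite /frob mulmx0 mxtrace0. Qed.

Lemma frob0l m n (A : 'M[R]_(m, n)) : frob 0 A = 0.
Proof. by rewrite frobC frob0r. Qed.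

Lemma frob_sumr m n I (r : seq I) (P : pred I) (A : 'M[R]_(m, n)) (F : I -> 'M[R]_(m, n)) :
  frob A (\sum_(i <- r | P i) F i) = \sum_(i <- r | P i) frob A (F i).
Proof. by rewrite /frob mulmx_sumr linear_sum. Qed.

Lemma frob_suml m n I (r : seq I) (P : pred I) (A : 'M[R]_(m, n)) (F : I -> 'M[R]_(m, n)) :
  frob (\sum_(i <- r | P i) F i) A = \sum_(i <- r | P i) frob (F i) A.
Proof. by rewrite frobC frob_sumr; apply: eq_bigr => i _; rewrite frobC. Qed.

Definition frob_lin := (frobDl, frobDr, frobNl, frobNr, frobZl, frobZr).

Lemma frob_tr m n (A B : 'M[R]_(m, n)) : frob A^T B^T = frob A B.
Proof. by rewrite frobC /frob trmxK mxtrace_mulC. Qed.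

Lemma frob_mull m n p (A : 'M[R]_(m, n)) (B : 'M[R]_(n, p)) C :
  frob (A *m B) C = frob B (A^T *m C).
Proof. by rewrite /frob trmx_mul mulmxA. Qed.

Lemma frob_mulr m n p (A : 'M[R]_(m, n)) (B : 'M[R]_(n, p)) C :
  frob (A *m B) C = frob A (C *m B^T).
Proof. by rewrite -frob_tr trmx_mul frob_mull -frob_tr trmx_mul !trmxK. Qed.

Lemma frob_delta m n (A : 'M[R]_(m, n)) i j : frob A (delta_mx i j) = A i j.
Proof.
rewrite frobE (bigD1 i) //= (bigD1 j) //= mxE !eqxx mulr1.
rewrite big1 ?addr0; last by move=> k /negbTE nk; rewrite mxE nk andbF mulr0.
rewrite big1 ?addr0 // => k /negbTE nk; apply: big1 => l _.
by rewrite mxE nk mulr0.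
Qed.

Lemma frob_ge0 m n (A : 'M[R]_(m, n)) : 0 <= frob A A.
Proof. by rewrite frobE; apply: sumr_ge0 => i _; apply: sumr_ge0 => j _; rewrite -expr2 sqr_ge0. Qed.

Lemma frob_coef m n (A : 'M[R]_(m, n)) i j : A i j ^+ 2 <= frob A A.
Proof.
rewrite frobE (bigD1 i) //= (bigD1 j) //= -expr2 -addrA lerDl addr_ge0 //.
  by apply: sumr_ge0 => k _; rewrite -expr2 sqr_ge0.
by apply: sumr_ge0 => k _; apply: sumr_ge0 => l _; rewrite -expr2 sqr_ge0.
Qed.

Lemma frob_eq0 m n (A : 'M[R]_(m, n)) : frob A A <= 0 -> A = 0.
Proof.
move=> A0; apply/matrixP => i j; rewrite mxE; apply/eqP; rewrite -sqrf_eq0.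
by rewrite eq_le sqr_ge0 (le_trans (frob_coef A i j)).
Qed.

(** Expand |c A - B|^2 >= 0. *)
Lemma frob_amgm m n (c : R) (A B : 'M[R]_(m, n)) : 0 < c ->
  frob A B <= (c * frob A A + c^-1 * frob B B) / 2.
Proof.
move=> c0; have := frob_ge0 (c *: A - B); rewrite !frob_lin (frobC B A) => h.
have h2 : 0 <= c^-1 * (c * (c * frob A A) - c * frob A B - (c * frob A B - frob B B)).
  by rewrite mulr_ge0 ?invr_ge0 ?(ltW c0) //; lra.
rewrite ler_pdivlMr //; move: h2; rewrite !mulrBr !mulrA mulVf ?gt_eqF // !mul1r; lra.
Qed.

Lemma frob_cauchy m n (A B : 'M[R]_(m, n)) :
  frob A B ^+ 2 <= frob A A * frob B B.
Proof.
have [->|A0] := eqVneq A 0; first by rewrite !frob0l expr0n mul0r.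
have a0 : 0 < frob A A.
  by rewrite lt0r frob_ge0 andbT; apply: contra_neq A0 => h; apply: frob_eq0; rewrite h.
have := frob_ge0 (frob A A *: B - frob A B *: A).
rewrite !frob_lin (frobC B A) => h.
have : 0 <= frob A A * (frob A A * frob B B - frob A B ^+ 2) by lra.
by rewrite pmulr_rge0 // subr_ge0.
Qed.

Lemma col_mulmx m n p (A : 'M[R]_(m, n)) (B : 'M[R]_(n, p)) j :
  col j (A *m B) = A *m col j B.
Proof. by rewrite !colE mulmxA. Qed.

Lemma frob_col_sum m n (A B : 'M[R]_(m, n)) :
  frob A B = \sum_j frob (col j A) (col j B).
Proof.
rewrite frobE exchange_big /=; apply: eq_bigr => j _; rewrite frobE.
by apply: eq_bigr => i _; rewrite big_ord1 !mxE.
Qed.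

Lemma l2normE n (v : 'cV[R]_n) : l2norm v = Num.sqrt (frob v v).
Proof.
by rewrite /l2norm frobE; congr Num.sqrt; apply: eq_bigr => i _; rewrite big_ord1 expr2.
Qed.

End Frobenius.

(** * The operator norm *)

Section OperatorNorm.
Context {R : realType}.
Implicit Types (m n : nat).

Lemma l2norm_mul_le m n (A : 'M[R]_(m, n)) (v : 'cV_n) :
  frob (A *m v) (A *m v) <= frob A A * frob v v.
Proof.
rewrite [in leLHS]frobE.
rewrite -(frob_tr A) [frob A^T A^T]frob_col_sum mulr_suml ler_sum // => i _.
rewrite big_ord1 -expr2.
have -> : (A *m v) i 0 = frob (col i A^T) v.
  by rewrite mxE frobE; apply: eq_bigr => j _; rewrite big_ord1 !mxE.
exact: frob_cauchy.
Qed.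

Lemma frob_mul_le p q r (B : 'M[R]_(p, q)) (H : 'M[R]_(q, r)) :
  frob (B *m H) (B *m H) <= frob B B * frob H H.
Proof.
rewrite [frob (B *m H) _]frob_col_sum [frob H H]frob_col_sum mulr_sumr; apply: ler_sum => j _.
by rewrite col_mulmx; exact: l2norm_mul_le.
Qed.

Lemma opnorm_set_sup m n (A : 'M[R]_(m, n)) :
  has_sup [set l2norm (A *m v) | v in [set v : 'cV[R]_n | l2norm v <= 1]].
Proof.
split; first by exists (l2norm (A *m 0)), 0 => //=; rewrite l2normE frob0l sqrtr0.
exists (Num.sqrt (frob A A)) => _ [v /= v1 <-]; rewrite l2normE ler_sqrt ?frob_ge0 //.
apply: (le_trans (l2norm_mul_le A v)); rewrite ler_piMr ?frob_ge0 //.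
move: v1; rewrite l2normE => v1.
by rewrite -(sqr_sqrtr (frob_ge0 v)) expr_le1 // sqrtr_ge0.
Qed.

(** A homogeneous inequality between squared norms: it mentions neither a
    supremum nor a square root, and is the only access to the operator norm used
    below. *)
Lemma opnormP m n (A : 'M[R]_(m, n)) (c : R) : 0 <= c ->
  opnorm A <= c <-> forall v : 'cV_n, frob (A *m v) (A *m v) <= c ^+ 2 * frob v v.
Proof.
move=> c0; split=> [Ac v|Ac]; last first.
  apply: sup_le_ub; first by have [] := opnorm_set_sup A.
  move=> _ [v /= v1 <-]; rewrite l2normE -(ger0_norm c0) -sqrtr_sqr ler_sqrt ?sqr_ge0 //.
  apply: (le_trans (Ac v)); rewrite ler_piMr ?sqr_ge0 //.
  move: v1; rewrite l2normE => v1.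
  by rewrite -(sqr_sqrtr (frob_ge0 v)) expr_le1 // sqrtr_ge0.
have [->|v0] := eqVneq v 0; first by rewrite mulmx0 !frob0l mulr0.
have f0 : 0 < frob v v.
  by rewrite lt0r frob_ge0 andbT; apply: contra_neq v0 => h; apply: frob_eq0; rewrite h.
have s0 : Num.sqrt (frob v v) != 0 by rewrite gt_eqF // sqrtr_gt0.
pose w := (Num.sqrt (frob v v))^-1 *: v.
have w1 : frob w w = 1.
  by rewrite /w !frob_lin -{3}(sqr_sqrtr (ltW f0)) expr2 mulrA mulrA -mulrA mulrACA !mulVf // mulr1.
have : l2norm (A *m w) <= c.
  apply: le_trans Ac; apply: sup_upper_bound; first exact: opnorm_set_sup.
  by exists w => //=; rewrite l2normE w1 sqrtr1.
rewrite l2normE => /(lerXn2r 2 (sqrtr_ge0 _) c0); rewrite sqr_sqrtr ?frob_ge0 //.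
rewrite /w -scalemxAr !frob_lin mulrA -expr2 exprVn sqr_sqrtr ?frob_ge0 //.
by rewrite mulrC ler_pdivrMr.
Qed.

Lemma opnorm1P m n (A : 'M[R]_(m, n)) :
  opnorm A <= 1 <-> forall v : 'cV_n, frob (A *m v) (A *m v) <= frob v v.
Proof.
split=> [/(opnormP _ ler01) h v|h]; first by have := h v; rewrite expr1n mul1r.
by apply/(opnormP _ ler01) => v; rewrite expr1n mul1r.
Qed.

(** Cauchy-Schwarz for |A^T v|^2 = <v, A (A^T v)>. *)
Lemma opnorm_tr m n (A : 'M[R]_(m, n)) (c : R) : 0 <= c ->
  opnorm A <= c -> opnorm A^T <= c.
Proof.
move=> c0 /(opnormP _ c0) Ac; apply/(opnormP _ c0) => v.
set w := A^T *m v.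
have [w0|w0] := eqVneq w 0; first by rewrite w0 frob0l mulr_ge0 ?sqr_ge0 ?frob_ge0.
have f0 : 0 < frob w w.
  by rewrite lt0r frob_ge0 andbT; apply: contra_neq w0 => h; apply: frob_eq0; rewrite h.
rewrite -(ler_pM2l f0) -expr2.
have E : frob w w = frob v (A *m w) by rewrite {1}/w frob_mull trmxK.
rewrite {1}E.
apply: (le_trans (frob_cauchy _ _)); rewrite mulrC mulrA ler_wpM2r ?frob_ge0 // [leRHS]mulrC; exact: Ac.
Qed.

Lemma opnorm_frob m n p (A : 'M[R]_(m, n)) (B : 'M[R]_(n, p)) (c : R) : 0 <= c ->
  opnorm A <= c -> frob (A *m B) (A *m B) <= c ^+ 2 * frob B B.
Proof.
move=> c0 /(opnormP _ c0) Ac; rewrite frob_col_sum [leRHS]mulrC frob_col_sum mulr_suml.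
by apply: ler_sum => j _; rewrite !col_mulmx mulrC.
Qed.

Lemma opnorm_rows m n p (A : 'M[R]_(m, n)) (B : 'M[R]_(p, m)) : opnorm A <= 1 ->
  frob (B *m A) (B *m A) <= frob B B.
Proof.
move=> A1; rewrite -frob_tr trmx_mul -[leRHS]frob_tr.
by have := opnorm_frob B^T ler01 (opnorm_tr ler01 A1); rewrite expr1n mul1r.
Qed.

End OperatorNorm.

(** * Positive semidefinite matrices *)

Section Psd.
Context {R : realType}.
Implicit Types (m n : nat).

Lemma psdE n (A : 'M[R]_n) : psd A <-> A^T = A /\ forall v : 'cV_n, 0 <= frob v (A *m v).
Proof. by rewrite /psd /frob; split=> -[? h]; split=> // v; have := h v; rewrite mulmxA. Qed.

Lemma posdefE n (A : 'M[R]_n) :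
  posdef A <-> A^T = A /\ forall v : 'cV_n, v != 0 -> 0 < frob v (A *m v).
Proof. by rewrite /posdef /frob; split=> -[? h]; split=> // v v0; have := h v v0; rewrite mulmxA. Qed.

Lemma psd_sym n (A : 'M[R]_n) : psd A -> A^T = A. Proof. by case. Qed.

Lemma posdef_sym n (A : 'M[R]_n) : posdef A -> A^T = A. Proof. by case. Qed.

Lemma posdef_psd n (A : 'M[R]_n) : posdef A -> psd A.
Proof.
move=> /posdefE[sA A0]; apply/psdE; split=> // v.
by have [->|v0] := eqVneq v 0; [rewrite frob0l|rewrite ltW // A0].
Qed.

Lemma psd_gram m n (A : 'M[R]_(m, n)) : psd (A^T *m A).
Proof.
apply/psdE; split=> [|v]; first by rewrite trmx_mul trmxK.
by rewrite -mulmxA frobC frob_mull trmxK frob_ge0.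
Qed.

Lemma psd_gramr m n (A : 'M[R]_(m, n)) : psd (A *m A^T).
Proof. by have := psd_gram A^T; rewrite trmxK. Qed.

Lemma psdD n (A B : 'M[R]_n) : psd A -> psd B -> psd (A + B).
Proof.
move=> /psdE[sA pA] /psdE[sB pB]; apply/psdE; split=> [|v].
  by rewrite linearD /= sA sB.
by rewrite mulmxDl frobDr addr_ge0.
Qed.

Lemma psdZ n (A : 'M[R]_n) (c : R) : 0 <= c -> psd A -> psd (c *: A).
Proof.
move=> c0 /psdE[sA pA]; apply/psdE; split=> [|v]; first by rewrite linearZ /= sA.
by rewrite -scalemxAl frobZr mulr_ge0.
Qed.

Lemma psd0 n : psd (0 : 'M[R]_n).
Proof. by apply/psdE; split=> [|v]; rewrite ?trmx0 // mul0mx frob0r. Qed.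

Lemma psd_scalar n (c : R) : 0 <= c -> psd (c%:M : 'M[R]_n).
Proof.
move=> c0; apply/psdE; split=> [|v]; first by rewrite tr_scalar_mx.
by rewrite mul_scalar_mx frobZr mulr_ge0 ?frob_ge0.
Qed.

Lemma psd_frob m n (A : 'M[R]_m) (X : 'M[R]_(m, n)) : psd A -> 0 <= frob X (A *m X).
Proof.
move=> /psdE[_ pA]; rewrite frob_col_sum; apply: sumr_ge0 => j _.
by rewrite col_mulmx.
Qed.

Lemma psd_conj m n (A : 'M[R]_m) (X : 'M[R]_(m, n)) : psd A -> psd (X^T *m A *m X).
Proof.
move=> pA; apply/psdE; split=> [|v]; first by rewrite !trmx_mul trmxK (psd_sym pA) mulmxA.
by rewrite -!mulmxA frobC frob_mull trmxK frobC; apply: psd_frob.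
Qed.

Lemma trace_frob n (A : 'M[R]_n) : \tr A = frob 1%:M A.
Proof. by rewrite /frob trmx1 mul1mx. Qed.

Lemma psd_tr_ge0 n (A : 'M[R]_n) : psd A -> 0 <= \tr A.
Proof. by move=> /psd_frob h; have := h _ 1%:M; rewrite mulmx1 trace_frob. Qed.

(** A zero of a nonnegative quadratic form is a minimum, where its derivative 2
    A v vanishes; the form is tested at v + t A v. *)
Lemma psd_kernel n (A : 'M[R]_n) (v : 'cV_n) : psd A -> frob v (A *m v) <= 0 -> A *m v = 0.
Proof.
move=> pA; have /psdE[sA qA] := pA => h.
have v0 : frob v (A *m v) = 0 by apply/eqP; rewrite eq_le h qA.
set w := A *m v; apply: frob_eq0.
have key (t : R) : 0 <= t * frob w w *+ 2 + t ^+ 2 * frob w (A *m w).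
  have := qA (v + t *: w); rewrite mulmxDr -scalemxAr !frob_lin v0.
  have -> : frob v (A *m w) = frob w w by rewrite frobC frob_mull sA frobC.
  by rewrite -/w; lra.
have [q0|q0] := eqVneq (frob w (A *m w)) 0.
  by have := key (-1); rewrite q0; lra.
have q1 : 0 < frob w (A *m w) by rewrite lt0r q0 qA.
set s := frob w w in key *; set q := frob w (A *m w) in key q0 q1 *.
have rq : s / q * q = s by rewrite divfK.
have := key (- (s / q)); rewrite sqrrN expr2 -mulrA rq mulNr => k.
have [//|s0] := lerP s 0.
by have : 0 < s / q * s; [rewrite mulr_gt0 // divr_gt0|move: k; lra].
Qed.

Lemma posdef_unit n (A : 'M[R]_n) : posdef A -> A \in unitmx.
Proof.
move=> /posdefE[sA pA]; rewrite -row_free_unit -kermx_eq0; apply/eqP/row_matrixP => i.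
rewrite row0; set u := row i (kermx A).
have uA : u *m A = 0 by apply/sub_kermxP; apply: row_sub.
apply/eqP; apply: contraT => u0.
have ut0 : u^T != 0 by rewrite -(inj_eq trmx_inj) trmxK trmx0.
by have := pA _ ut0; rewrite -{1}sA -trmx_mul uA trmx0 frob0r ltxx.
Qed.

Lemma psd_unit_posdef n (A : 'M[R]_n) : psd A -> A \in unitmx -> posdef A.
Proof.
move=> pA uA; have /psdE[sA qA] := pA; apply/posdefE; split=> // v v0.
rewrite lt_neqAle qA andbT eq_sym; apply/eqP => h.
have /(congr1 (mulmx (invmx A))) : A *m v = 0 by apply: psd_kernel; rewrite // h.
by rewrite mulKmx // mulmx0 => vz; rewrite vz eqxx in v0.
Qed.

Lemma posdef_inv n (A : 'M[R]_n) : posdef A -> posdef (invmx A).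
Proof.
move=> pA; have uA := posdef_unit pA; have [sA qA] := (posdefE A).1 pA.
have sI : (invmx A)^T = invmx A by rewrite trmx_inv sA.
apply/posdefE; split=> // v v0.
have -> : frob v (invmx A *m v) = frob (invmx A *m v) (A *m (invmx A *m v)).
  by rewrite mulKVmx // frobC.
apply: qA; apply: contra_neq v0 => /(congr1 (mulmx A)); rewrite mulKVmx // mulmx0 //.
Qed.

Lemma posdef_scalar n (c : R) : 0 < c -> posdef (c%:M : 'M[R]_n).
Proof.
move=> c0; apply/posdefE; split=> [|v v0]; first by rewrite tr_scalar_mx.
rewrite mul_scalar_mx frobZr mulr_gt0 // lt0r frob_ge0 andbT.
by apply: contra_neq v0 => h; apply: frob_eq0; rewrite h.
Qed.

Lemma posdefDpsd n (A B : 'M[R]_n) : posdef A -> psd B -> posdef (A + B).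
Proof.
move=> /posdefE[sA pA] /psdE[sB pB]; apply/posdefE; split=> [|v v0].
  by rewrite linearD /= sA sB.
by rewrite mulmxDl frobDr ltr_wpDr // pA.
Qed.

End Psd.

(** * The spectral theorem *)

Section Spectral.
Context {R : realType}.
Implicit Types (m n : nat).

Lemma quadratic_continuous n (A : 'M[R]_n) :
  continuous (fun v : 'rV[R]_n => frob v^T (A *m v^T)).
Proof.
have -> : (fun v : 'rV[R]_n => frob v^T (A *m v^T)) =
    (fun v => \sum_i \sum_j v 0 i * A i j * v 0 j).
  apply/funext => v; rewrite frobE; apply: eq_bigr => i _.
  rewrite big_ord1 !mxE mulr_sumr; apply: eq_bigr => j _.
  by rewrite !mxE mulrA.
apply: continuous_big => [|i _]; first by move=> x; exact: add_continuous.
apply: continuous_big => [|j _]; first by move=> x; exact: add_continuous.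
move=> v.
have C k : {for v, continuous (fun x : 'rV[R]_n => x 0 k)} by exact: coord_continuous.
exact: (continuousM (continuousM (C i) (@cst_continuous _ _ (A i j) v)) (C j)).
Qed.

(** By compactness the quadratic form attains its maximum l on the unit sphere,
    at some v; then v is a zero of the nonnegative form of l - A, hence in its
    kernel. *)
Lemma rayleigh n (A : 'M[R]_n.+1) : A^T = A ->
  exists (v : 'cV_n.+1) (l : R), [/\ frob v v = 1, A *m v = l *: v &
    forall u : 'cV_n.+1, frob u (A *m u) <= l * frob u u].
Proof.
move=> sA.
pose f (v : 'rV[R]_n.+1) := frob v^T (A *m v^T).
pose S : set 'rV[R]_n.+1 := [set v | frob v^T v^T = 1].
have S0 : S !=set0.
  by exists (delta_mx 0 0); rewrite /S /= trmx_delta frob_delta mxE !eqxx.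
have cS : compact S.
  apply: bounded_closed_compact.
    exists 1; split; first exact: num_real.
    move=> x x1 v /= vS; rewrite /= [leLHS]mx_normrE.
    apply/bigmax_leP; split=> [|[i j] _ /=]; first by rewrite ltW // (lt_trans ltr01).
    apply: le_trans (ltW x1).
    rewrite -(@expr_le1 _ 2) ?normr_ge0 // real_normK ?num_real // -vS.
    by have := frob_coef v^T j i; rewrite mxE.
  have -> : S = (fun v : 'rV[R]_n.+1 => frob v^T (1%:M *m v^T)) @^-1` [set x | x = 1].
    by apply/seteqP; split=> v; rewrite /S /= mul1mx.
  apply: preimage_closed; last exact: closed_eq.
  by move=> v _; apply: quadratic_continuous.
have [|w Sw wmax] := compact_EVT_max S0 cS (f := f).
  by apply: continuous_subspaceT; exact: quadratic_continuous.
rewrite inE in Sw.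
set v := w^T; pose l := frob v (A *m v).
have v1 : frob v v = 1 by [].
have qle (u : 'cV_n.+1) : frob u (A *m u) <= l * frob u u.
  have [->|u0] := eqVneq u 0; first by rewrite !frob0l mulr0.
  have f0 : 0 < frob u u.
    by rewrite lt0r frob_ge0 andbT; apply: contra_neq u0 => h; apply: frob_eq0; rewrite h.
  have s0 : Num.sqrt (frob u u) != 0 by rewrite gt_eqF // sqrtr_gt0.
  have := wmax ((Num.sqrt (frob u u))^-1 *: u^T).
  rewrite inE /S /f /= linearZ /= trmxK -scalemxAr !frob_lin -/v -/l.
  have e : (Num.sqrt (frob u u))^-1 * (Num.sqrt (frob u u))^-1 = (frob u u)^-1.
    by rewrite -expr2 exprVn sqr_sqrtr // frob_ge0.
  rewrite !mulrA !e mulVf ?gt_eqF // => /(_ erefl).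
  by rewrite mulrC ler_pdivrMr.
exists v, l; split=> //.
have pB : psd (l%:M - A).
  apply/psdE; split=> [|u]; first by rewrite linearB /= tr_scalar_mx sA.
  by rewrite mulmxBl mul_scalar_mx !frob_lin subr_ge0 qle.
have : (l%:M - A) *m v = 0.
  by apply: (psd_kernel pB); rewrite mulmxBl mul_scalar_mx !frob_lin v1 mulr1 -/l subrr.
by move/eqP; rewrite mulmxBl mul_scalar_mx subr_eq0 => /eqP <-.
Qed.

(** The reflection in the hyperplane orthogonal to v - e. *)
Lemma householder n (v e : 'cV[R]_n) : frob v v = 1 -> frob e e = 1 ->
  exists H : 'M[R]_n, H^T *m H = 1%:M /\ H *m e = v.
Proof.
move=> v1 e1; have [->|ve] := eqVneq v e.
  by exists 1%:M; rewrite trmx1 mulmx1 mul1mx.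
pose h := v - e.
have h0 : frob h h != 0.
  apply: contra_neq ve => h0; apply/eqP; rewrite -subr_eq0; apply/eqP.
  by apply: frob_eq0; rewrite h0.
have hh (u : 'cV[R]_n) : h *m (h^T *m u) = frob h u *: h.
  rewrite [h^T *m u]mx11_scalar mul_mx_scalar; congr (_ *: _).
  by rewrite /frob [in RHS](mx11_scalar (h^T *m u)) mxtrace_scalar.
have he : frob h e = - frob h h / 2.
  by rewrite /h !frob_lin v1 e1 (frobC e v); lra.
pose H := 1%:M - (2 / frob h h) *: (h *m h^T).
have Hu u : H *m u = u - (2 / frob h h * frob h u) *: h.
  by rewrite /H mulmxBl mul1mx -scalemxAl -mulmxA hh scalerA.
have sH : H^T = H by rewrite /H linearB linearZ /= trmx1 trmx_mul trmxK.
exists H; split; last first.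
  rewrite Hu he [_ * (_ / 2)](_ : _ = -1); first by rewrite scaleN1r opprK /h addrC subrK.
  by rewrite mulrA mulrN divfK // mulNr divff.
rewrite sH; apply/trmx_inj/trmx_inj/row_matrixP => i.
suff E (u : 'cV[R]_n) : H *m H *m u = u.
  by rewrite !trmxK !rowE; apply: trmx_inj; rewrite !trmx_mul sH trmx1 mul1mx E.
have lin c : frob h (u - c *: h) = frob h u - c * frob h h by rewrite frobBr frobZr.
rewrite -mulmxA !Hu lin.
have -> : 2 / frob h h * (frob h u - 2 / frob h h * frob h u * frob h h) =
   - (2 / frob h h * frob h u) by field.
by rewrite scaleNr opprK subrK.
Qed.

(** A Householder matrix that sends the first basis vector to a top eigenvector
    splits off a 1 x 1 block; induct on the other one. *)
Lemma sym_spectral n (A : 'M[R]_n) : A^T = A ->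
  exists (Q : 'M[R]_n) (d : 'rV[R]_n), Q *m Q^T = 1%:M /\ A = Q *m diag_mx d *m Q^T.
Proof.
elim: n A => [|n IH] A sA.
  by exists 1%:M, 0; split; apply/matrixP => -[].
have [v [l [v1 Av _]]] := rayleigh sA.
have e1 : frob (delta_mx 0 0 : 'cV[R]_n.+1) (delta_mx 0 0) = 1.
  by rewrite frob_delta mxE !eqxx.
have [H [HH He]] := householder v1 e1.
have HH' := mulmx1C HH.
have [B defB] : exists B : 'M[R]_(1 + n), B = H^T *m A *m H by exists (H^T *m A *m H).
have Be : B *m (delta_mx 0 0 : 'cV[R]_(1 + n)) = l *: delta_mx 0 0.
  by rewrite defB -!mulmxA He Av -scalemxAr -He mulmxA HH mul1mx.
have sB : B^T = B by rewrite defB !trmx_mul trmxK sA mulmxA.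
have Bi i : B i 0 = l * (i == 0)%:R.
  have := congr1 (fun M : 'cV[R]_(1 + n) => M i 0) Be.
  by rewrite -colE !mxE eqxx andbT.
have Bdl : dlsubmx B = 0.
  apply/matrixP => i j; rewrite !mxE ord1.
  have -> : lshift n (0 : 'I_1) = 0 by apply: val_inj.
  by rewrite Bi (_ : rshift 1 i == 0 = false) ?mulr0.
have Bul : ulsubmx B = diag_mx (l%:M : 'rV_1).
  apply/matrixP => i j; rewrite !mxE !ord1.
  have -> : lshift n (0 : 'I_1) = 0 by apply: val_inj.
  by rewrite Bi !eqxx mulr1 mulr1n.
have Bur : ursubmx B = 0.
  by rewrite -[LHS]trmxK trmx_ursub sB Bdl trmx0.
have [|Q [d [QQ Bdr]]] := IH (drsubmx B); first by rewrite trmx_drsub sB.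
pose Q1 : 'M[R]_(1 + n) := block_mx 1%:M 0 0 Q.
have QQ1 : Q1 *m Q1^T = 1%:M.
  rewrite /Q1 tr_block_mx mulmx_block !trmx0 trmx1 !mulmx0 !mul0mx !mulmx1 QQ.
  by rewrite !addr0 !add0r -scalar_mx_block.
have BQ : B = Q1 *m diag_mx (row_mx l%:M d) *m Q1^T.
  rewrite -(submxK B) Bdl Bul Bur Bdr diag_mx_row /Q1 tr_block_mx !mulmx_block.
  by rewrite !trmx0 trmx1 !mulmx0 !mul0mx !mulmx1 !mul1mx !addr0 !add0r mul0mx.
exists (H *m Q1), (row_mx l%:M d); split.
  by rewrite trmx_mul mulmxA -(mulmxA H) QQ1 mulmx1 HH'.
rewrite trmx_mul !mulmxA -2!(mulmxA H) -BQ defB !mulmxA HH' mul1mx -mulmxA.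
by rewrite HH' mulmx1.
Qed.

End Spectral.

(** * Square roots and the Loewner order *)

Section Square_root.
Context {R : realType}.
Implicit Types (m n : nat).

Lemma frob_diag m n (e : 'rV[R]_m) (X : 'M[R]_(m, n)) :
  frob X (diag_mx e *m X) = \sum_i e 0 i * frob (row i X) (row i X).
Proof.
rewrite frobE; apply: eq_bigr => i _; rewrite frobE big_ord1 mulr_sumr.
by apply: eq_bigr => j _; rewrite mul_diag_mx !mxE; ring.
Qed.

Lemma psd_diag n (e : 'rV[R]_n) : (forall i, 0 <= e 0 i) -> psd (diag_mx e).
Proof.
move=> e0; apply/psdE; split=> [|v]; first by rewrite tr_diag_mx.
by rewrite frob_diag; apply: sumr_ge0 => i _; rewrite mulr_ge0 ?frob_ge0.
Qed.

Lemma psd_spectral n (A : 'M[R]_n) : psd A ->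
  exists (Q : 'M[R]_n) (d : 'rV[R]_n),
    [/\ Q *m Q^T = 1%:M, A = Q *m diag_mx d *m Q^T & forall i, 0 <= d 0 i].
Proof.
move=> pA; have [Q [d [QQ Ad]]] := sym_spectral (psd_sym pA).
exists Q, d; split=> // i; have := psd_conj Q pA.
rewrite Ad !mulmxA (mulmx1C QQ) mul1mx -mulmxA (mulmx1C QQ) mulmx1 => /psdE[_ h].
by have := h (delta_mx i 0); rewrite frobC frob_delta -colE !mxE eqxx mulr1n.
Qed.

Lemma psd_sqrt_ex n (A : 'M[R]_n) : psd A -> exists B, psd B /\ B *m B = A.
Proof.
move=> /psd_spectral[Q [d [QQ Ad d0]]].
pose e : 'rV[R]_n := \row_i Num.sqrt (d 0 i).
exists (Q *m diag_mx e *m Q^T); split.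
  have := psd_conj Q^T (@psd_diag _ e _); rewrite trmxK; apply=> i.
  by rewrite mxE sqrtr_ge0.
rewrite !mulmxA -(mulmxA _ Q^T Q) (mulmx1C QQ) mulmx1 -(mulmxA Q) mulmx_diag Ad.
congr (_ *m diag_mx _ *m _); apply/rowP => i; rewrite !mxE -expr2 sqr_sqrtr //.
Qed.

(** If A - B had a positive top eigenvalue l, with unit eigenvector v, then |A
    v|^2 = |l v + B v|^2 >= l^2 + |B v|^2 would contradict A^2 <= B^2. *)
Lemma sqrt_monotone n (A B : 'M[R]_n) : psd A -> psd B ->
  psd (B *m B - A *m A) -> psd (B - A).
Proof.
case: n A B => [|n] A B pA pB pAB.
  by apply/psdE; split=> [|v]; [apply/matrixP => -[]|rewrite frobE big_ord0].
have sA := psd_sym pA; have sB := psd_sym pB.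
have sAB : (A - B)^T = A - B by rewrite linearB /= sA sB.
have [v [l [v1 vl ul]]] := rayleigh sAB.
have [l0|l0] := lerP l 0.
  apply/psdE; split=> [|u]; first by rewrite linearB /= sA sB.
  rewrite -opprB mulNmx frobNr oppr_ge0 (le_trans (ul u)) //.
  by rewrite mulr_le0_ge0 ?frob_ge0.
exfalso; have Av : A *m v = l *: v + B *m v by rewrite -vl mulmxBl subrK.
have sq (C : 'M[R]_n.+1) : C^T = C -> frob v (C *m C *m v) = frob (C *m v) (C *m v).
  by move=> sC; rewrite -mulmxA [RHS]frob_mull sC.
have /psdE[_ /(_ v)] := pAB; rewrite mulmxBl frobBr !sq // Av.
rewrite !frob_lin v1 (frobC (B *m v) v) => h.
have h2 : 0 <= l * frob v (B *m v) by rewrite mulr_ge0 ?(ltW l0) ?psd_frob.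
have h3 : 0 < l * l by rewrite mulr_gt0.
move: h; rewrite mulr1; lra.
Qed.

Lemma psd_sqrtP n (A : 'M[R]_n) : psd A -> psd (psd_sqrt A) /\ psd_sqrt A *m psd_sqrt A = A.
Proof.
move=> /psd_sqrt_ex[B HB].
exact: (@xgetPex _ 0 [set B : 'M[R]_n | psd B /\ B *m B = A] (ex_intro _ B HB)).
Qed.

Lemma psd_sqrt_posdef n (A : 'M[R]_n) : posdef A -> posdef (psd_sqrt A).
Proof.
move=> pA; have [p1 p2] := psd_sqrtP (posdef_psd pA).
apply: psd_unit_posdef => //; move: (posdef_unit pA); rewrite -{1}p2.
by rewrite unitmx_mul => /andP[].
Qed.

(** With a = A^-1 v and x = B^-1 v, add up <x - a, A (x - a)> >= 0 and <x, (B -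
    A) x> >= 0. *)
Lemma posdef_inv_antitone n (A B : 'M[R]_n) : posdef A -> psd (B - A) ->
  psd (invmx A - invmx B).
Proof.
move=> pA pBA; have pB : posdef B by rewrite -(subrK A B) addrC; apply: posdefDpsd.
have uA := posdef_unit pA; have uB := posdef_unit pB.
have sA := posdef_sym pA; have sB := posdef_sym pB.
apply/psdE; split=> [|v]; first by rewrite linearB /= !trmx_inv sA sB.
rewrite mulmxBl frobBr; set a := invmx A *m v; set x := invmx B *m v.
have va : A *m a = v by rewrite mulKVmx.
have vx : B *m x = v by rewrite mulKVmx.
have h1 := psd_frob (x - a) (posdef_psd pA).
have h2 := psd_frob x pBA.
move: h1 h2; rewrite mulmxBr mulmxBl va vx !frob_lin.
have -> : frob a (A *m x) = frob x v by rewrite frobC frob_mull sA va.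
by rewrite (frobC v a) (frobC v x) (frobC a v); lra.
Qed.

End Square_root.

(** * The nuclear norm and the polar decomposition *)

Section Nuclear_norm.
Context {R : realType}.
Implicit Types (m n : nat).

(** The columns of A Q are orthogonal, and their lengths are the singular values
    of A. *)
Lemma nuclear_svd m n (A : 'M[R]_(m, n)) : exists (Q : 'M[R]_n) (d : 'rV[R]_n),
  [/\ Q *m Q^T = 1%:M, (A *m Q)^T *m (A *m Q) = diag_mx (\row_i d 0 i ^+ 2),
      forall i, 0 <= d 0 i & nuclear_norm A = \sum_i d 0 i].
Proof.
have [pH HH] := psd_sqrtP (psd_gram A).
have [Q [d [QQ Hd d0]]] := psd_spectral pH.
exists Q, d; split=> //; last first.
  by rewrite /nuclear_norm Hd -mulmxA mxtrace_mulC -mulmxA (mulmx1C QQ) mulmx1 mxtrace_diag.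
rewrite trmx_mul -mulmxA (mulmxA A^T) -HH Hd !mulmxA (mulmx1C QQ) mul1mx.
rewrite -2!(mulmxA _ Q^T) (mulmx1C QQ) !mulmx1 mulmx_diag.
by congr diag_mx; apply/rowP => i; rewrite !mxE expr2.
Qed.

(** In the basis of right singular vectors this is Cauchy-Schwarz column by
    column. *)
Lemma nuclear_dual_le m n (A U : 'M[R]_(m, n)) : opnorm U <= 1 -> frob A U <= nuclear_norm A.
Proof.
move=> /opnorm1P U1; have [Q [d [QQ AQ d0 ->]]] := nuclear_svd A.
have -> : frob A U = frob (A *m Q) (U *m Q) by rewrite frob_mulr -mulmxA QQ mulmx1.
rewrite frob_col_sum; apply: ler_sum => j _.
apply: (le_trans (ler_norm _)); rewrite -(@ler_sqr _ `|_|) ?nnegrE // real_normK ?num_real //.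
apply: (le_trans (frob_cauchy _ _)).
have -> : frob (col j (A *m Q)) (col j (A *m Q)) = d 0 j ^+ 2.
  rewrite colE frob_mull mulmxA AQ frobC frob_delta -colE !mxE eqxx mulr1n //.
rewrite ler_piMr ?sqr_ge0 // col_mulmx (le_trans (U1 _)) //.
by rewrite colE frob_mull mulmxA (mulmx1C QQ) mul1mx frob_delta mxE !eqxx.
Qed.

(** The witness is the partial isometry of the polar decomposition. Zero
    singular values are sent to 0, which is their inverse by convention, so no
    assumption on the rank is made. *)
Lemma nuclear_dual_ex m n (A : 'M[R]_(m, n)) :
  exists U : 'M[R]_(m, n), opnorm U <= 1 /\ frob A U = nuclear_norm A.
Proof.
have [Q [d [QQ AQ d0 ->]]] := nuclear_svd A.
pose e : 'rV[R]_n := \row_i (d 0 i)^-1.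
exists (A *m Q *m diag_mx e *m Q^T); split; last first.
  rewrite -frob_mulr frobC /frob trmx_mul tr_diag_mx -mulmxA AQ mulmx_diag mxtrace_diag.
  apply: eq_bigr => i _; rewrite !mxE.
  by have [->|di] := eqVneq (d 0 i) 0; [rewrite expr0n mulr0|rewrite expr2 mulrA mulVf ?mul1r].
apply/opnorm1P => v; rewrite -!(mulmxA (A *m Q)) frob_mull mulmxA AQ -mulmxA frob_mull tr_diag_mx.
rewrite !mulmxA !mulmx_diag -[X in frob _ X]mulmxA frob_diag.
have -> : frob v v = frob (Q^T *m v) (Q^T *m v).
  by rewrite frob_mull trmxK mulmxA QQ mul1mx.
rewrite [leRHS]frob_col_sum big_ord1.
have cE : col 0 (Q^T *m v) = Q^T *m v by apply/matrixP => i j; rewrite ord1 [LHS]mxE.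
rewrite cE [leRHS]frobE; apply: ler_sum => i _.
rewrite [X in _ * X]frobE !big_ord1 !mxE.
have [->|di] := eqVneq (d 0 i) 0; first by rewrite invr0 !mul0r -expr2 sqr_ge0.
by rewrite (_ : (d 0 i)^-1 * d 0 i ^+ 2 / d 0 i = 1) ?mul1r //; field.
Qed.

Lemma nuclear_le m n (A : 'M[R]_(m, n)) c :
  (forall U : 'M[R]_(m, n), opnorm U <= 1 -> frob A U <= c) -> nuclear_norm A <= c.
Proof. by move=> h; have [U [U1 <-]] := nuclear_dual_ex A; exact: h. Qed.

Lemma opnorm0 m n : opnorm (0 : 'M[R]_(m, n)) <= 1.
Proof. by apply/opnorm1P => v; rewrite mul0mx frob0l frob_ge0. Qed.

Lemma nuclear_ge0 m n (A : 'M[R]_(m, n)) : 0 <= nuclear_norm A.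
Proof. by rewrite -(frob0r A); apply: nuclear_dual_le; apply: opnorm0. Qed.

Lemma nuclear_triangle m n (A B : 'M[R]_(m, n)) :
  nuclear_norm (A + B) <= nuclear_norm A + nuclear_norm B.
Proof. by apply: nuclear_le => U U1; rewrite frobDl lerD ?nuclear_dual_le. Qed.

Lemma opnorm1_frob m n (U : 'M[R]_(m, n)) : opnorm U <= 1 -> frob U U <= n%:R.
Proof.
move=> U1; have := opnorm_frob 1%:M ler01 U1.
by rewrite mulmx1 expr1n mul1r -trace_frob mxtrace1.
Qed.

Lemma nuclear_sqr_le m n (A : 'M[R]_(m, n)) : nuclear_norm A ^+ 2 <= n%:R * frob A A.
Proof.
have [U [U1 <-]] := nuclear_dual_ex A; apply: (le_trans (frob_cauchy _ _)).
by rewrite mulrC ler_wpM2r ?frob_ge0 ?opnorm1_frob.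
Qed.

(** Split <D Z, U> as <C Z, C U> with C = sqrt D, and use the
    arithmetic-geometric inequality. *)
Lemma nuclear_amgm m n (D : 'M[R]_m) (Z : 'M[R]_(m, n)) (c : R) : psd D -> 0 < c ->
  nuclear_norm (D *m Z) <= (c * frob Z (D *m Z) + c^-1 * \tr D) / 2.
Proof.
move=> pD c0; have [pC CC] := psd_sqrtP pD; set C := psd_sqrt D in pC CC.
have sC := psd_sym pC.
apply: nuclear_le => U U1; rewrite -{1}CC -mulmxA frob_mull sC.
apply: (le_trans (frob_amgm _ _ c0)).
rewrite ler_pM2r ?invr_gt0 // lerD //.
  by rewrite frob_mull sC mulmxA CC.
rewrite ler_wpM2l ?invr_ge0 ?(ltW c0) // (le_trans (opnorm_rows _ U1)) //.
by rewrite -CC /frob sC.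
Qed.

(** Equality holds at W = (Y Y^T)^(1/2) when this is invertible: the right-hand
    side is then a quadratic majorant of the nuclear norm that touches it at
    Y. *)
Lemma nuclear_variational m n (W : 'M[R]_m) (Y : 'M[R]_(m, n)) : posdef W ->
  nuclear_norm Y <= (frob Y (invmx W *m Y) + \tr W) / 2.
Proof.
move=> pW; have uW := posdef_unit pW.
rewrite -{1}(mulKVmx uW Y).
apply: (le_trans (nuclear_amgm _ (posdef_psd pW) ltr01)).
by rewrite invr1 !mul1r mulKVmx // frobC.
Qed.

(** The factor (X X^T)^(-1/2) of the polar decomposition of a matrix of full
    row rank. *)
Definition polar_inv m n (X : 'M[R]_(m, n)) : 'M[R]_m := invmx (psd_sqrt (X *m X^T)).

Section Full_rank.
Variables (m n : nat) (X : 'M[R]_(m, n)).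
Hypothesis pX : posdef (X *m X^T).

Let W := psd_sqrt (X *m X^T).

Let WW : W *m W = X *m X^T.
Proof. by have [] := psd_sqrtP (posdef_psd pX). Qed.

Let pW : posdef W. Proof. exact: psd_sqrt_posdef. Qed.

Let uW := posdef_unit pW.
Let sW := posdef_sym pW.

Lemma polar_inv_posdef : posdef (polar_inv X).
Proof. exact: posdef_inv. Qed.

Lemma polar_inv_sqr : polar_inv X *m polar_inv X = invmx (X *m X^T).
Proof.
have u2 : X *m X^T \in unitmx by apply: posdef_unit.
rewrite -[LHS]mulmx1 -(mulmxV u2) -{1}WW /polar_inv -/W !mulmxA.
by rewrite -(mulmxA (invmx W) (invmx W)) mulVmx // mulmx1 mulVmx // mul1mx.
Qed.

Let U := polar_inv X *m X.

Lemma polar_opnorm : opnorm U <= 1.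
Proof.
rewrite -(trmxK U); apply: opnorm_tr => //; apply/opnorm1P => v.
rewrite frob_mull trmxK /U /polar_inv -/W trmx_mul trmx_inv sW !mulmxA.
by rewrite -(mulmxA _ X) -WW mulKmx // mulmxV // mul1mx.
Qed.

Let WU : W *m U = X. Proof. by rewrite mulKVmx. Qed.

Lemma polar_trace : frob X U = \tr W.
Proof.
by rewrite frobC /U /polar_inv -/W frob_mulr -WW /frob trmx_inv sW mulKmx.
Qed.

Lemma polar_nuclear : nuclear_norm X = frob X U.
Proof.
apply/eqP; rewrite eq_le nuclear_dual_le ?andbT ?polar_opnorm //.
apply: (le_trans (nuclear_variational X pW)); rewrite -/(polar_inv X) -/U.
by rewrite -polar_trace; lra.
Qed.

(** With C^2 = W, where W = (X X^T)^(1/2), a maximiser V satisfies |C (V - U)|^2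
    <= 0. *)
Lemma polar_unique V : opnorm V <= 1 -> frob X V = nuclear_norm X -> V = U.
Proof.
move=> V1 VX; have [pC CC] := psd_sqrtP (posdef_psd pW).
have uC := posdef_unit (psd_sqrt_posdef pW); set C := psd_sqrt W in pC CC uC.
have sC := psd_sym pC.
have CV : frob V (W *m V) <= \tr W.
  rewrite -CC -mulmxA -{1}sC -frob_mull (le_trans (opnorm_rows _ V1)) //.
  by rewrite /frob sC CC.
apply/eqP; rewrite -subr_eq0; apply/eqP.
rewrite -(mulKmx uC (V - U)); rewrite [C *m _]frob_eq0 ?mulmx0 //.
rewrite frob_mull sC mulmxA CC mulmxBr WU !frob_lin.
have -> : frob U (W *m V) = frob X V by rewrite -{1}sW -frob_mull WU.
by rewrite (frobC V X) (frobC U X) VX polar_nuclear polar_trace; move: CV; lra.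
Qed.

Lemma op_argmax_polar : op_argmax X = U.
Proof.
have [V1 Vmax] : [set X' : 'M[R]_(m, n) | opnorm X' <= 1 /\
    forall Y : 'M[R]_(m, n), opnorm Y <= 1 -> frob X Y <= frob X X'] (op_argmax X).
  apply: (xgetPex 0); exists U; split=> [|Y Y1]; first exact: polar_opnorm.
  by rewrite -polar_nuclear nuclear_dual_le.
apply: polar_unique => //; apply/eqP; rewrite eq_le nuclear_dual_le //=.
by rewrite polar_nuclear Vmax // polar_opnorm.
Qed.

Lemma nuclear_subgradient Y : nuclear_norm X + frob U (Y - X) <= nuclear_norm Y.
Proof.
rewrite frobBr (frobC U X) -polar_nuclear addrC subrK frobC.
by rewrite nuclear_dual_le ?polar_opnorm.
Qed.

(** The majorant of nuclear_variational for W = (X X^T)^(1/2) agrees at X to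
    first order with the nuclear norm; the remainder of that quadratic is its
    second-order term. *)
Lemma nuclear_bregman Y : nuclear_norm Y - nuclear_norm X - frob U (Y - X) <=
  frob (Y - X) (polar_inv X *m (Y - X)) / 2.
Proof.
have := nuclear_variational Y pW; rewrite -/(polar_inv X) mulmxBr -/U !frob_lin.
have -> : frob X (polar_inv X *m Y) = frob U Y.
  by rewrite /U frob_mull (posdef_sym polar_inv_posdef).
by rewrite (frobC Y U) (frobC U X) polar_nuclear polar_trace; lra.
Qed.

End Full_rank.
End Nuclear_norm.

(** * Affine substitutions on the Gaussian line *)

Section Gaussian_line.
Context {R : realType}.
Local Open Scope ereal_scope.
Local Notation leb := (@lebesgue_measure R).
Local Notation gauss := (@normal_prob R 0 1).

Lemma affine_measurable (a b : R) :
  measurable_fun [set: measurableTypeR R] (fun x : measurableTypeR R => (a * x + b)%R : measurableTypeR R).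
Proof. by apply: measurable_funD => //; apply: measurable_funM. Qed.

(** Both sides are measures in A that agree on half-open intervals. *)
Lemma lebesgue_affine (a b : R) (A : set R) : a != 0%R -> measurable A ->
  leb A = `|a|%:E * leb ((fun x => (a * x + b)%R) @^-1` A).
Proof.
move=> a0 mA.
pose h : {mfun measurableTypeR R >-> measurableTypeR R} :=
  mfun_Sub (mem_set (affine_measurable a b)).
apply: (@lebesgue_measure_unique R (mscale (NngNum (normr_ge0 a)) (pushforward leb h))) => //= _ [[u v]] _ <-.
rewrite /mscale /= /pushforward /=.
have [a1|a1] := ltrP 0 a.
  have -> : (fun x : R => (a * x + b)%R) @^-1` `]u, v]%classic = `]((u - b) / a)%R, ((v - b) / a)%R]%classic.
    apply/seteqP; split=> x /=; rewrite !in_itv /= ltr_pdivrMr // ler_pdivlMr // ltrBlDr lerBrDr mulrC //.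
  rewrite !lebesgue_measure_itv /= !lte_fin ltr_pM2r ?invr_gt0 // ltrD2r.
  case: ifP => _; rewrite ?mule0 // -!EFinB -EFinM; congr EFin.
  by rewrite gtr0_norm //; field.
have {a1}a1 : (a < 0)%R by rewrite lt_neqAle a0 a1.
have -> : (fun x : R => (a * x + b)%R) @^-1` `]u, v]%classic = `[((v - b) / a)%R, ((u - b) / a)%R[%classic.
  apply/seteqP; split=> x /=; rewrite !in_itv /= ler_ndivrMr // ltr_ndivlMr // ltrBlDr lerBrDr mulrC andbC //.
rewrite !lebesgue_measure_itv /= !lte_fin ltr_nM2r ?invr_lt0 // ltrD2r.
case: ifP => _; rewrite ?mule0 // -!EFinB -EFinM; congr EFin.
by rewrite ltr0_norm //; field.
Qed.

Lemma integral_lebesgue_affine (a b : R) (g : R -> \bar R) : a != 0%R ->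
  measurable_fun [set: R] g -> (forall x, 0 <= g x) ->
  \int[leb]_x g x = `|a|%:E * \int[leb]_x g (a * x + b)%R.
Proof.
move=> a0 mg g0.
pose h : {mfun measurableTypeR R >-> measurableTypeR R} :=
  mfun_Sub (mem_set (affine_measurable a b)).
have ia0 : (0 <= `|a|^-1)%R by rewrite invr_ge0.
have <- : \int[mscale (NngNum ia0) leb]_x g x = \int[leb]_x g (a * x + b)%R.
  rewrite -[RHS](ge0_integral_pushforward (affine_measurable a b) leb measurableT mg) //.
  apply: eq_measure_integral => /= [|mf A mA _]; first exact: affine_measurable.
  rewrite /mscale /= /pushforward (lebesgue_affine b a0 mA) muleA -EFinM.
  by rewrite mulVf ?normr_eq0 // mul1e.
rewrite ge0_integral_mscale //= muleA -EFinM mulfV ?normr_eq0 // mul1e //.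
Qed.

(** The density of the Gaussian law with respect to the Lebesgue measure is its
    Radon-Nikodym derivative almost everywhere. *)
Lemma integral_normal_prob (g : R -> \bar R) : measurable_fun [set: R] g -> (forall x, 0 <= g x) ->
  \int[gauss]_x g x = \int[leb]_x (g x * (normal_pdf 0 1 x)%:E).
Proof.
move=> mg g0; rewrite -(Radon_Nikodym_SigmaFinite.change_of_variables (normal_prob_dominates 0 1)) //.
have mp : measurable_fun [set: R] (fun x : R => (normal_pdf 0 1 x)%:E).
  by apply/measurable_EFinP; exact: measurable_normal_pdf.
have fi := Radon_Nikodym_SigmaFinite.f_integrable (normal_prob_dominates (0:R) 1).
have mf := measurable_int _ fi.
apply: ae_eq_integral => //.
- exact: emeasurable_funM.
- exact: emeasurable_funM.
apply: (filterS (P := fun x => True -> Radon_Nikodym_SigmaFinite.f gauss leb x = (normal_pdf 0 1 x)%:E)).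
  by move=> x h _; rewrite h.
apply: integral_ae_eq => //; first exact: measurableT.
by move=> E _ mE; rewrite -Radon_Nikodym_SigmaFinite.f_integral //; exact: normal_prob_dominates.
Qed.

(** The density, with respect to the standard Gaussian law, of the image of
    that law by x |-> a x + b. *)
Definition affine_density (a b x : R) : R :=
  (`|a|^-1 * expR ((x ^+ 2 - ((x - b) / a) ^+ 2) / 2))%R.

Lemma affine_density_ge0 a b x : (0 <= affine_density a b x)%R.
Proof. by rewrite mulr_ge0 ?invr_ge0 ?expR_ge0. Qed.

Lemma gaussian_affine (a b : R) (g : R -> \bar R) : a != 0%R ->
  measurable_fun [set: R] g -> (forall x, 0 <= g x) ->
  \int[gauss]_x g (a * x + b)%R = \int[gauss]_x (g x * (affine_density a b x)%:E).
Proof.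
move=> a0 mg g0.
have mp : measurable_fun [set: R] (fun x : R => (normal_pdf 0 1 x)%:E).
  by apply/measurable_EFinP; exact: measurable_normal_pdf.
have md : measurable_fun [set: R] (affine_density a b).
  apply: measurable_funM => //; apply: measurableT_comp => //.
  apply: measurable_funM => //; apply: measurable_funB => //.
  apply: measurable_funX => //; apply: measurable_funM => //.
  exact: measurable_funB.
have mgd : measurable_fun [set: R] (fun x => g x * (affine_density a b x)%:E).
  by apply: emeasurable_funM => //; apply/measurable_EFinP.
have mga : measurable_fun [set: R] (fun x => g (a * x + b)%R).
  exact: (measurableT_comp mg (affine_measurable a b)).
rewrite (integral_normal_prob mga) // (integral_normal_prob mgd); last first.
  by move=> x; rewrite mule_ge0 ?lee_fin ?affine_density_ge0.
have mgdp : measurable_fun [set: R] (fun x => g x * (affine_density a b x)%:E * (normal_pdf 0 1 x)%:E).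
  exact: emeasurable_funM.
rewrite [RHS](integral_lebesgue_affine b a0) //; last first.
  by move=> x; rewrite !mule_ge0 ?lee_fin ?affine_density_ge0 ?normal_pdf_ge0.
rewrite -ge0_integralZl //; first last.
- by move=> x _; rewrite !mule_ge0 ?lee_fin ?affine_density_ge0 ?normal_pdf_ge0.
- exact: (measurableT_comp mgdp (affine_measurable a b)).
apply: eq_integral => x _; rewrite muleCA -muleA; congr (_ * _).
rewrite -!EFinM; congr EFin.
rewrite normal_pdfE ?oner_eq0 // /normal_fun /affine_density addrK.
have -> : (a * x / a = x)%R by rewrite mulrAC divff ?mul1r.
have na : `|a|%R != 0%R by rewrite normr_eq0.
set p := normal_peak _; set E1 := expR (_ / 2); set E2 := expR (- (a * x + b - 0) ^+ 2 / _).
have -> : (`|a|^-1 * E1 * (`|a| * (p * E2)) = p * (E1 * E2))%R by field.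
by rewrite -expRD; congr (_ * expR _)%R; rewrite !subr0 expr1n; field.
Qed.

End Gaussian_line.

(** * Laws of random matrices *)

Section Random_matrices.
Context {R : realType}.
Implicit Types (m n : nat).

(** Products of measurable sets, entry by entry; they generate the product
    sigma-algebra of mxspace. *)
Definition mx_boxes m n : set (set 'M[R]_(m, n)) :=
  [set B | exists2 F : 'I_m -> 'I_n -> set R, (forall i j, measurable (F i j)) &
    B = [set A : 'M[R]_(m, n) | forall i j, F i j (A i j)]].

Definition mxspace m n := g_sigma_algebraType (@mx_boxes m n).

Lemma measurable_coord m n (i : 'I_m) (j : 'I_n) :
  measurable_fun [set: mxspace m n] (fun A : mxspace m n => (A : 'M[R]_(m, n)) i j).
Proof.
move=> _ B mB; rewrite setTI; apply: sub_sigma_algebra.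
exists (fun k l => if (k == i) && (l == j) then B else setT) => [k l|]; first by case: ifP.
apply/seteqP; split=> A /= => [AB k l|/(_ i j)]; last by rewrite !eqxx.
by case: ifP => // /andP[/eqP -> /eqP ->].
Qed.

Lemma measurable_mxP m n d (T : measurableType d) (A : T -> 'M[R]_(m, n)) :
  (forall i j, measurable_fun [set: T] (fun w => A w i j)) ->
  measurable_fun [set: T] (A : T -> mxspace m n).
Proof.
move=> mA; apply: (measurability (f := A : T -> mxspace m n) (@mx_boxes m n)) => // _ [B [F mF ->] <-].
rewrite setTI.
have -> : A @^-1` [set M : 'M[R]_(m, n) | forall i j, F i j (M i j)] =
    \big[setI/setT]_(i < m) \big[setI/setT]_(j < n) ((fun w => A w i j) @^-1` F i j).
  apply/seteqP; split=> w /=.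
    move=> h; apply: (big_ind (fun S : set T => S w)) => // i _.
    by apply: (big_ind (fun S : set T => S w)) => // k _; exact: h.
  move=> h i j; move: h; rewrite (bigD1 i) //= => -[+ _].
  by rewrite (bigD1 j) //= => -[].
apply: bigsetI_measurable => i _; apply: bigsetI_measurable => j _.
by rewrite -[X in measurable X]setTI; exact: mA.
Qed.

Lemma mx_boxes_setI m n : setI_closed (@mx_boxes m n).
Proof.
move=> _ _ [F mF ->] [G mG ->]; exists (fun i j => F i j `&` G i j).
  by move=> i j; apply: measurableI.
by apply/seteqP; split=> A /= => [[f g] i j|h]; [split|split=> i j; case: (h i j)].
Qed.

Lemma mx_box_setT m n : @mx_boxes m n setT.
Proof. by exists (fun _ _ => setT) => //; apply/seteqP; split. Qed.

Local Open Scope ereal_scope.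

(** Boxes form a pi-system, so a law on matrices is determined by its values
    on boxes. *)
Lemma mx_law_unique m n d1 d2 (T1 : measurableType d1) (T2 : measurableType d2)
    (P1 : probability T1 R) (P2 : probability T2 R)
    (A1 : T1 -> 'M[R]_(m, n)) (A2 : T2 -> 'M[R]_(m, n)) (f : mxspace m n -> \bar R) :
  (forall i j, measurable_fun [set: T1] (fun w => A1 w i j)) ->
  (forall i j, measurable_fun [set: T2] (fun w => A2 w i j)) ->
  (forall F : 'I_m -> 'I_n -> set R, (forall i j, measurable (F i j)) ->
     P1 [set w | forall i j, F i j (A1 w i j)] = P2 [set w | forall i j, F i j (A2 w i j)]) ->
  measurable_fun [set: mxspace m n] f -> (forall A, 0 <= f A) ->
  \int[P1]_w f (A1 w) = \int[P2]_w f (A2 w).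
Proof.
move=> /measurable_mxP mA1 /measurable_mxP mA2 eqF mf f0.
pose X1 : {mfun T1 >-> mxspace m n} := mfun_Sub (mem_set mA1).
pose X2 : {mfun T2 >-> mxspace m n} := mfun_Sub (mem_set mA2).
transitivity (\int[distribution P1 X1]_A f A).
  by rewrite ge0_integral_distribution.
transitivity (\int[distribution P2 X2]_A f A); last by rewrite ge0_integral_distribution.
apply: eq_measure_integral => /= B mB _.
apply: (@measure_unique _ R (mxspace m n) (@mx_boxes m n) (fun=> setT)) => //.
- exact: mx_boxes_setI.
- by move=> _; exact: mx_box_setT.
- by apply/seteqP; split=> // x _; exists 0%N.
- by move=> _ [F mF ->]; exact: eqF.
- by move=> _; rewrite (@le_lt_trans _ _ 1) ?probability_le1 ?ltry.
Qed.

(** The content of std_gaussian_matrix for a bare matrix-valued map, with the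
    marginal laws substituted into the product rule. *)
Definition gaussian_law m n d (T : measurableType d) (P : probability T R)
    (A : T -> 'M[R]_(m, n)) :=
  (forall i j, measurable_fun [set: T] (fun w => A w i j)) /\
  forall F : 'I_m -> 'I_n -> set R, (forall i j, measurable (F i j)) ->
    P [set w | forall i j, F i j (A w i j)] =
    \prod_(i < m) \prod_(j < n) normal_prob 0 1 (F i j).

Lemma std_gaussian_law m n d (T : measurableType d) (P : probability T R)
  (Z : 'I_m -> 'I_n -> {RV P >-> R}) : std_gaussian_matrix Z -> gaussian_law P (rmatrix Z).
Proof.
move=> [h1 h2]; split=> [i j|F mF].
  have -> : (fun w => rmatrix Z w i j) = Z i j by apply/funext => w; rewrite mxE.
  exact: measurable_funP.
transitivity (P [set w | forall i j, F i j (Z i j w)]).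
  by congr (P _); apply/seteqP; split=> w /= h i j; have := h i j; rewrite mxE.
rewrite h2 //; apply: eq_bigr => i _; apply: eq_bigr => j _.
by rewrite -(h1 i j).
Qed.

Definition mx_set m n (i : 'I_m) (j : 'I_n) (x : R) (A : 'M[R]_(m, n)) : 'M[R]_(m, n) :=
  \matrix_(k, l) if (k == i) && (l == j) then x else A k l.

Section Resample.
Variables (m n : nat) (d : measure_display) (T : measurableType d) (P : probability T R).
Variable A : T -> 'M[R]_(m, n).
Hypothesis gA : gaussian_law P A.
Variables (i : 'I_m) (j : 'I_n).

Lemma measurable_mx_set d' (T' : measurableType d') (x : T' -> R) (B : T' -> 'M[R]_(m, n)) :
  measurable_fun [set: T'] x -> (forall k l, measurable_fun [set: T'] (fun w => B w k l)) ->
  forall k l, measurable_fun [set: T'] (fun w => mx_set i j (x w) (B w) k l).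
Proof.
move=> mx mB k l.
have -> : (fun w => mx_set i j (x w) (B w) k l) =
    if (k == i) && (l == j) then x else fun w => B w k l.
  by apply/funext => w; rewrite mxE; case: ifP.
by case: ifP => _; [exact: mx|exact: mB].
Qed.

(** Integrating out one entry with respect to its own law: the entries being
    independent, it may be replaced by a fresh copy. *)
Lemma resample (f : mxspace m n -> \bar R) :
  measurable_fun [set: mxspace m n] f -> (forall B, 0 <= f B) ->
  \int[P]_w f (A w) = \int[P]_w \int[normal_prob 0 1]_x f (mx_set i j x (A w)).
Proof.
move=> mf f0; have [mA lA] := gA.
pose B (z : T * R) := mx_set i j z.2 (A z.1).
have mB k l : measurable_fun [set: T * R] (fun z => B z k l).
  apply: measurable_mx_set => [|k' l']; first exact: measurable_snd.
  exact: (measurableT_comp (mA k' l') measurable_fst).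
rewrite (@mx_law_unique _ _ _ _ _ _ P (P \x normal_prob 0 1) A B f) //; last first.
  move=> F mF; rewrite lA //.
  have -> : [set w | forall i0 j0, F i0 j0 (B w i0 j0)] =
     [set w | forall k l, (if (k == i) && (l == j) then setT else F k l) (A w k l)] `*` F i j.
    apply/seteqP; split=> -[w x] /=.
      move=> h; split=> [k l|]; last by have := h i j; rewrite /B mxE !eqxx.
      by have := h k l; rewrite /B mxE; case: ifP.
    move=> [h1 h2] k l; have := h1 k l; rewrite /B mxE; case: ifP => // /andP[/eqP -> /eqP ->] //.
  set C := [set w | _].
  have mC : measurable C.
    have h := measurable_mxP mA measurableT.
    have := h [set M : 'M[R]_(m, n) | forall k l,
      (if (k == i) && (l == j) then setT else F k l) (M k l)].
    rewrite setTI; apply; apply: sub_sigma_algebra.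
    by exists (fun k l => if (k == i) && (l == j) then setT else F k l) => // k l; case: ifP.
  have pE := @product_measure1E _ _ _ _ R P (normal_prob 0 1) C (F i j) mC (mF i j).
  transitivity (P C * normal_prob 0 1 (F i j)); last by symmetry; exact pE.
  rewrite (lA (fun k l => if (k == i) && (l == j) then setT else F k l)); last by move=> k l; case: ifP.
  rewrite (bigD1 i) //= (bigD1 j) //= [X in _ = X * _](bigD1 i) //= [X in _ = X * _ * _](bigD1 j) //=.
  rewrite !eqxx /= probability_setT mul1e [RHS]muleC -muleA.
  congr (_ * (_ * _)).
    by apply: eq_bigr => l /negbTE ->.
  by apply: eq_bigr => k /negbTE ->.
apply: fubini_tonelli1 => //.
exact: (measurableT_comp mf (measurable_mxP mB)).
Qed.

End Resample.
End Random_matrices.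

(** * Stein's identity *)

Section Stein.
Context {R : realType}.
Local Notation leb := (@lebesgue_measure R).
Local Notation gauss := (@normal_prob R 0 1).
Local Notation phi := (normal_pdf (0 : R) 1).

Lemma normal_pdf01 : phi = fun x => normal_peak 1 * expR (- (2^-1) * x ^+ 2).
Proof.
apply/funext => x; rewrite normal_pdfE ?oner_eq0 // /normal_fun subr0 expr1n.
by congr (_ * expR _); rewrite -mulr_natr mul1r mulrC mulrN mulNr.
Qed.

Lemma normal_pdf_derive (x : R) : is_derive x 1 phi (- x * phi x).
Proof.
rewrite normal_pdf01.
have -> : (fun x : R => normal_peak 1 * expR (- (2^-1) * x ^+ 2)) =
  (normal_peak 1) \*: (expR \o ((- (2^-1)) \*: (@id R ^+ 2))) by [].
apply: is_derive_eq; rewrite /GRing.scale /= !fctE /= expr1.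
by rewrite [_ *: _](_ : _ = - 2^-1 * x ^+ 2) //; field.
Qed.

(** This O(1 / n) bound, a consequence of 1 + y <= exp y, makes the boundary
    terms of an integration by parts vanish at infinity. *)
Lemma normal_pdf_decay (n : nat) : (1 + n.+1%:R) * phi n.+1%:R <= 4 * normal_peak 1 / n.+1%:R.
Proof.
rewrite normal_pdf01 ler_pdivlMr //; set N : R := n.+1%:R.
have N0 : 0 < N by [].
have e1 : expR (- (2^-1) * N ^+ 2) * (1 + 2^-1 * N ^+ 2) <= 1.
  rewrite mulNr expRN mulrC ler_pdivrMr ?expR_gt0 // mul1r.
  exact: expR_ge1Dx.
have p0 : 0 <= normal_peak (1 : R) by exact: normal_peak_ge0.
set e := expR _ in e1 *; set p := normal_peak _ in p0 *.
have -> : (1 + N) * (p * e) * N = p * (e * (N + N ^+ 2)) by ring.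
rewrite [leRHS]mulrC ler_wpM2l //.
have e0 : 0 <= e by exact: expR_ge0.
have : e * (N + N ^+ 2) <= e * (4 * (1 + 2^-1 * N ^+ 2)).
  by rewrite ler_wpM2l // expr2; have := sqr_ge0 N; rewrite expr2; nra.
move: e1; rewrite expr2; nra.
Qed.

(** The integrand is the derivative of - h phi. *)
Lemma stein_interval (h h' : R -> R) (a : R) : 0 < a ->
  (forall x : R, is_derive x 1 h (h' x)) -> continuous h' ->
  (\int[leb]_(x in `[(- a)%R, a]) ((x * h x - h' x) * phi x)%:E =
   (h (- a) * phi a - h a * phi a)%:E)%E.
Proof.
move=> a0 dh ch'.
pose F : R -> R := fun x => - (h x * phi x).
have dF (x : R) : is_derive x 1 F ((x * h x - h' x) * phi x).
  have -> : F = - (h * phi) by [].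
  have dx := dh x; have dp := normal_pdf_derive x.
  by apply: is_derive_eq; rewrite /GRing.scale /=; ring.
have ch : continuous h.
  by move=> x; apply/differentiable_continuous/derivable1_diffP; exact: ex_derive.
have cp : continuous phi by apply: continuous_normal_pdf; rewrite oner_eq0.
have cF : continuous F.
  by move=> x; apply/differentiable_continuous/derivable1_diffP; exact: ex_derive.
have -> : (h (- a) * phi a - h a * phi a)%:E = ((F a)%:E - (F (- a))%:E)%E.
  rewrite -EFinB /F; congr EFin; rewrite (_ : phi (- a) = phi a); first by ring.
  by rewrite normal_pdf01 sqrrN.
apply: continuous_FTC2.
- by rewrite -subr_gt0 opprK addr_gt0.
- apply: continuous_subspaceT.
  have cu : continuous (fun x : R => (x * h x - h' x) * phi x).
    by move=> x; exact: (continuousM (continuousB (continuousM (@cvg_id _ _) (ch x)) (ch' x)) (cp x)).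
  exact: cu.
- split=> [x _||]; first exact: ex_derive.
  + by apply: cvg_at_right_filter; exact: cF.
  + by apply: cvg_at_left_filter; exact: cF.
- by move=> x _; rewrite derive1E; apply: derive_val.
Qed.

Lemma integral_normal_EFin (g : R -> R) : measurable_fun [set: R] g ->
  (\int[gauss]_x (g x)%:E = \int[leb]_x (g x * phi x)%:E)%E.
Proof.
move=> mg; have mE : measurable_fun [set: R] (fun x => (g x)%:E) by apply/measurable_EFinP.
rewrite integralE [RHS]integralE !integral_normal_prob //.
- congr (_ - _)%E; apply: eq_integral => x _.
    by rewrite !funeposE -!EFin_max -EFinM maxr_pMl ?normal_pdf_ge0 // mul0r.
  by rewrite !funenegE -!EFinN -!EFin_max -EFinM maxr_pMl ?normal_pdf_ge0 // mul0r mulNr.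
- exact: measurable_funeneg.
- exact: measurable_funepos.
Qed.

Let I (n : nat) : set R := `[- n.+1%:R, n.+1%:R]%classic.

Let I_cvg (f : R -> \bar R) x : f \_ (I n) x @[n --> \oo] --> f x.
Proof.
have [N _ HN] : \forall n \near \oo, x \in I n.
  near=> n; rewrite inE /I /= in_itv /= -ler_norml.
  apply: (@le_trans _ _ n%:R); last by rewrite ler_nat.
  by near: n; apply: nbhs_infty_ger.
apply: cvg_near_cst; exists N => // n Nn /=; rewrite patchE HN //.
Unshelve. all: by end_near. Qed.

(** Comes before the identity itself, since the latter is dominated by a
    multiple of 1 + x^2. At h = id the boundary terms of stein_interval are
    nonpositive, and the intervals increase to the line. *)
Lemma gaussian_second_moment_le1 : (\int[gauss]_x (x ^+ 2)%:E <= 1)%E.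
Proof.
have mphi : measurable_fun [set: R] phi by exact: measurable_normal_pdf.
have mx2 : measurable_fun [set: R] (fun x : R => x ^+ 2 * phi x).
  by apply: measurable_funM => //; apply: measurable_funX.
rewrite integral_normal_EFin; last exact: measurable_funX.
pose f (x : R) : \bar R := (x ^+ 2 * phi x)%:E.
have f0 x : (0 <= f x)%E by rewrite lee_fin mulr_ge0 ?sqr_ge0 ?normal_pdf_ge0.
have mf : measurable_fun [set: R] f by apply/measurable_EFinP.
have mI n : measurable (I n) by exact: measurable_itv.
have bound n : (\int[leb]_x (f \_ (I n)) x <= 1)%E.
  rewrite -integral_mkcond.
  have := @stein_interval id (cst 1) n.+1%:R (ltr0Sn _ _) (fun x => is_derive_id x 1) (@cst_continuous _ _ _).
  rewrite -/(I n) => e.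
  have i1 : leb.-integrable (I n) (fun x => ((x * id x - cst 1 x) * phi x)%:E).
    apply: continuous_compact_integrable; first exact: segment_compact.
    apply: continuous_subspaceT.
    have cu : continuous (fun x : R => (x * id x - cst 1 x) * phi x).
      move=> x; have cp := @continuous_normal_pdf R 0 1 (oner_neq0 _) x.
      exact: (continuousM (continuousB (continuousM (@cvg_id _ _) (@cvg_id _ _)) (@cvg_cst _ _ _ _ _)) cp).
    exact: cu.
  have i2 : leb.-integrable (I n) (fun x => (phi x)%:E).
    apply: continuous_compact_integrable; first exact: segment_compact.
    by apply: continuous_subspaceT; apply: continuous_normal_pdf; rewrite oner_eq0.
  have -> : (\int[leb]_(x in I n) f x = \int[leb]_(x in I n) ((x * id x - cst 1 x) * phi x)%:E
      + \int[leb]_(x in I n) (phi x)%:E)%E.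
    rewrite -(integralD _ i1 i2); last exact: measurable_itv.
    by apply: eq_integral => x _; rewrite /f -EFinD; congr EFin; rewrite /=; ring.
  rewrite e /=; apply: (@le_trans _ _ (0 + 1)%E); last by rewrite add0e.
  apply: leeD.
    rewrite lee_fin -mulrBl mulr_le0_ge0 ?normal_pdf_ge0 // -opprD oppr_le0 addr_ge0 //.
  rewrite -(integral_normal_pdf 0 (1 : R)); apply: ge0_subset_integral => //.
  - exact: measurable_itv.
  - exact/measurable_EFinP.
  - by move=> x _; rewrite lee_fin normal_pdf_ge0.
have cv : (\int[leb]_x (f \_ (I n)) x @[n --> \oo] --> \int[leb]_x f x)%E.
  have -> : (\int[leb]_x f x = \int[leb]_x limn (fun n => (f \_ (I n)) x))%E.
    by apply: eq_integral => x _; apply/esym/cvg_lim => //; exact: I_cvg.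
  apply: cvg_monotone_convergence => //.
  - move=> n; apply/(measurable_restrict f (mI n) measurableT).
    by rewrite setTI; apply: measurable_funTS.
  - by move=> n x _; rewrite patchE; case: ifP.
  - move=> x _ a b ab; rewrite !patchE; case: ifPn => xa; last by case: ifP.
    rewrite ifT // inE; move: xa; rewrite inE /I /= !in_itv /= -!ler_norml => /le_trans; apply.
    by rewrite ler_nat.
by apply: (@cvge_to_le _ _ _ _ _ _ _ cv); exact: nearW.
Qed.

(** Let the interval grow in stein_interval: by the growth assumptions the
    integrand is dominated by a multiple of 1 + x^2, and the boundary terms tend
    to 0. *)
Lemma stein (h h' : R -> R) (C : R) :
  (forall x : R, is_derive x 1 h (h' x)) -> continuous h' ->
  (forall x, `|h x| <= C * (1 + `|x|)) -> (forall x, `|h' x| <= C) ->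
  (\int[gauss]_x (x * h x - h' x)%:E = 0)%E.
Proof.
move=> dh ch' hC h'C.
have C0 : 0 <= C by apply: le_trans (h'C 0).
have ch : continuous h.
  by move=> x; apply/differentiable_continuous/derivable1_diffP; exact: ex_derive.
have mphi : measurable_fun [set: R] phi by exact: measurable_normal_pdf.
have mu : measurable_fun [set: R] (fun x : R => x * h x - h' x).
  apply: measurable_funB; last exact: continuous_measurable_fun.
  by apply: measurable_funM => //; exact: continuous_measurable_fun.
rewrite integral_normal_EFin //.
pose f (x : R) : \bar R := ((x * h x - h' x) * phi x)%:E.
have mf : measurable_fun [set: R] f by apply/measurable_EFinP; exact: measurable_funM.
have mI n : measurable (I n) by exact: measurable_itv.
pose g (x : R) : \bar R := (2 * C * (phi x + x ^+ 2 * phi x))%:E.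
have mx2 : measurable_fun [set: R] (fun x : R => x ^+ 2 * phi x).
  by apply: measurable_funM => //; apply: measurable_funX.
have ix2 : leb.-integrable [set: R] (fun x => (x ^+ 2 * phi x)%:E).
  apply/integrableP; split; first exact/measurable_EFinP.
  apply: (@le_lt_trans _ _ 1%E); last exact: ltry.
  apply: le_trans gaussian_second_moment_le1.
  rewrite integral_normal_EFin; last exact: measurable_funX.
  rewrite le_eqVlt; apply/orP; left; apply/eqP; apply: eq_integral => x _.
  by rewrite /= ger0_norm // mulr_ge0 ?sqr_ge0 ?normal_pdf_ge0.
have ig : leb.-integrable [set: R] g.
  have -> : g = (fun x => (2 * C)%:E * ((phi x)%:E + (x ^+ 2 * phi x)%:E))%E.
    by apply/funext => x; rewrite /g EFinM EFinD.
  apply: integrableZl => //; apply: integrableD => //; exact: (@integrable_normal_pdf R 0 1).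
have fg x : (`|f x| <= g x)%E.
  rewrite /f /g /= lee_fin normrM (ger0_norm (normal_pdf_ge0 _ _ _)).
  rewrite -[X in X + _ * _]mul1r -mulrDl mulrA ler_wpM2r ?normal_pdf_ge0 //.
  apply: (le_trans (ler_normB _ _)); rewrite normrM.
  have := h'C x; have := ler_wpM2l (normr_ge0 x) (hC x).
  have x2 : x ^+ 2 = `|x| ^+ 2 by rewrite real_normK ?num_real.
  have : 0 <= C * (1 - `|x|) ^+ 2 by rewrite mulr_ge0 ?sqr_ge0.
  rewrite x2; move: (`|x|) (`|h x|) (`|h' x|) => a b c; rewrite !expr2.
  have : 0 <= C * (a * a) by rewrite mulr_ge0 // -expr2 sqr_ge0.
  by rewrite mulrBr mulr1 !mulrDr; nra.
have cv : (\int[leb]_x (f \_ (I n)) x @[n --> \oo] --> \int[leb]_x f x)%E.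
  apply: (@dominated_cvg _ _ _ leb setT measurableT _ _ g) => //.
  - move=> n; apply/(measurable_restrict f (mI n) measurableT).
    by rewrite setTI; apply: measurable_funTS.
  - move=> n x _; rewrite patchE; case: ifP => // _.
    by rewrite abse0; apply: le_trans (fg x).
have e n : (\int[leb]_x (f \_ (I n)) x = (h (- n.+1%:R) * phi n.+1%:R - h n.+1%:R * phi n.+1%:R)%:E)%E.
  by rewrite -integral_mkcond; apply: stein_interval.
have cv0 : (\int[leb]_x (f \_ (I n)) x @[n --> \oo] --> 0%:E)%E.
  under eq_cvg do rewrite e.
  apply: cvg_EFin; first exact: nearW.
  apply/cvgrPdist_le => eps eps0; near=> n.
  rewrite /= sub0r normrN.
  have b1 : `|h (- n.+1%:R) * phi n.+1%:R - h n.+1%:R * phi n.+1%:R| <=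
      2 * C * ((1 + n.+1%:R) * phi n.+1%:R).
    rewrite -mulrBl normrM (ger0_norm (normal_pdf_ge0 _ _ _)) mulrA ler_wpM2r ?normal_pdf_ge0 //.
    apply: (le_trans (ler_normB _ _)).
    have := hC (- n.+1%:R); have := hC n.+1%:R; rewrite normrN !normr_nat; lra.
  apply: (le_trans b1); apply: (@le_trans _ _ (2 * C * (4 * normal_peak 1 / n.+1%:R))).
    by rewrite ler_wpM2l ?normal_pdf_decay // mulr_ge0.
  rewrite mulrA ler_pdivrMr // -ler_pdivrMl //.
  apply: (@le_trans _ _ n%:R); last by rewrite ler_nat.
  by near: n; apply: nbhs_infty_ger.
exact: (cvg_unique _ cv cv0).
Unshelve. all: by end_near. Qed.

Lemma gaussian_mean0 : (\int[gauss]_x x%:E = 0)%E.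
Proof.
rewrite -(@stein (cst 1) (cst 0) 1) //.
- by apply: eq_integral => x _; rewrite /= mulr1 subr0.
- by move=> x; exact: cvg_cst.
- by move=> x; rewrite /= normr1 mul1r lerDl.
- by move=> x; rewrite /= normr0.
Qed.

Lemma gaussian_sqr_integrable : gauss.-integrable [set: R] (fun x => (x ^+ 2)%:E).
Proof.
apply/integrableP; split; first by apply/measurable_EFinP; apply: measurable_funX.
apply: (@le_lt_trans _ _ 1%E); last exact: ltry.
rewrite (_ : (\int[gauss]_x _ = \int[gauss]_x (x ^+ 2)%:E)%E) ?gaussian_second_moment_le1 //.
by apply: eq_integral => x _; rewrite /= ger0_norm // sqr_ge0.
Qed.

Lemma gaussian_variance1 : (\int[gauss]_x (x ^+ 2)%:E = 1)%E.
Proof.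
have h0 : (\int[gauss]_x (x * x - 1)%:E = 0)%E.
  apply: (@stein id (cst 1) 1) => //.
  - by move=> x; exact: cvg_cst.
  - by move=> x; rewrite mul1r lerDr.
  - by move=> x; rewrite /= normr1.
have i1 : gauss.-integrable [set: R] (cst 1%E) by exact: finite_measure_integrable_cst.
have -> : (\int[gauss]_x (x ^+ 2)%:E = \int[gauss]_x ((x * x - 1)%:E + cst 1%E x))%E.
  by apply: eq_integral => x _; rewrite /= -EFinD subrK expr2.
have i2 : gauss.-integrable [set: R] (fun x => (x * x - 1)%:E).
  have -> : (fun x => (x * x - 1)%:E) = (fun x => (x ^+ 2)%:E - cst 1%E x)%E :> (R -> \bar R).
    by apply/funext => x; rewrite /= -EFinB expr2.
  exact: (integrableB measurableT gaussian_sqr_integrable i1).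
rewrite integralD // h0 add0e integral_cst // mul1e.
exact: probability_setT.
Qed.

End Stein.

(** * Measurability of matrix operations *)

Section Measurable_matrices.
Context {R : realType} {d : measure_display} {T : measurableType d}.
Implicit Types (m n p : nat).
Local Notation mf f := (measurable_fun [set: T] f).

Lemma measurable_invr : measurable_fun [set: R] (fun x : R => x^-1).
Proof.
have -> : (fun x : R => x^-1) = (fun x => if x == 0 then 0 else x^-1).
  by apply/funext => x; case: eqP => // ->; rewrite invr0.
apply: measurable_fun_if => //.
- by apply: measurable_fun_eqr.
- rewrite setTI; apply: open_continuous_measurable_fun.
    have -> : (fun x : R => x == 0) @^-1` [set false] = ~` [set (0 : R)].
      apply/seteqP; split=> x /=; first by move=> /negbT/eqP.
      by move=> /eqP/negbTE.
    by apply: closed_openC; exact: closed_eq.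
  by move=> x; rewrite inE /= => /negbT x0; exact: inv_continuous.
Qed.

Lemma measurable_funV (f : T -> R) : mf f -> mf (fun w => (f w)^-1).
Proof. by move=> h; exact: (measurableT_comp measurable_invr h). Qed.

Definition mx_measurable m n (F : T -> 'M[R]_(m, n)) := forall i j, mf (fun w => F w i j).

Lemma measurable_cstmx m n (A : 'M[R]_(m, n)) : mx_measurable (fun _ => A).
Proof. by move=> i j; exact: measurable_cst. Qed.

Lemma measurable_addmx m n (F G : T -> 'M[R]_(m, n)) : mx_measurable F -> mx_measurable G ->
  mx_measurable (fun w => F w + G w).
Proof.
move=> mF mG i j; under eq_fun do rewrite mxE.
exact: measurable_funD.
Qed.

Lemma measurable_oppmx m n (F : T -> 'M[R]_(m, n)) : mx_measurable F ->
  mx_measurable (fun w => - F w).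
Proof.
move=> mF i j; under eq_fun do rewrite mxE.
exact: measurable_funN.
Qed.

Lemma measurable_scalemx m n (f : T -> R) (F : T -> 'M[R]_(m, n)) : mf f -> mx_measurable F ->
  mx_measurable (fun w => f w *: F w).
Proof.
move=> mf0 mF i j; under eq_fun do rewrite mxE.
exact: measurable_funM.
Qed.

Lemma measurable_trmx m n (F : T -> 'M[R]_(m, n)) : mx_measurable F ->
  mx_measurable (fun w => (F w)^T).
Proof. by move=> mF i j; under eq_fun do rewrite mxE; exact: mF. Qed.

Lemma measurable_mulmx m n p (F : T -> 'M[R]_(m, n)) (G : T -> 'M[R]_(n, p)) :
  mx_measurable F -> mx_measurable G -> mx_measurable (fun w => F w *m G w).
Proof.
move=> mF mG i j; under eq_fun do rewrite mxE.
by apply: measurable_sum => k; exact: measurable_funM.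
Qed.

Lemma measurable_frob m n (F G : T -> 'M[R]_(m, n)) :
  mx_measurable F -> mx_measurable G -> mf (fun w => frob (F w) (G w)).
Proof.
move=> mF mG; under eq_fun do rewrite frobE.
apply: measurable_sum => i; apply: measurable_sum => j; exact: measurable_funM.
Qed.

Lemma measurable_det n (F : T -> 'M[R]_n) : mx_measurable F -> mf (fun w => \det (F w)).
Proof.
move=> mF; apply: measurable_sum => s; apply: measurable_funM => //.
by apply: measurable_prod => i _; exact: mF.
Qed.

(** By Cramer's rule, on either side of the measurable condition that the
    determinant vanishes. *)
Lemma measurable_invmx n (F : T -> 'M[R]_n) : mx_measurable F ->
  mx_measurable (fun w => invmx (F w)).
Proof.
move=> mF i j.
have -> : (fun w => invmx (F w) i j) =
  (fun w => if \det (F w) == 0 then F w i j else (\det (F w))^-1 * cofactor (F w) j i).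
  apply/funext => w; rewrite /invmx unitmxE unitfE; case: eqP => _ //=.
  by rewrite !mxE.
have mdet := measurable_det mF.
apply: measurable_fun_ifT; first exact: measurable_fun_eqr.
  exact: mF.
apply: measurable_funM; first exact: measurable_funV.
apply: measurable_funM => //; apply: measurable_det => k l.
by under eq_fun do rewrite !mxE; exact: mF.
Qed.

End Measurable_matrices.

(** * Substitutions in one entry of a Gaussian matrix *)

Section Gaussian_entries.
Context {R : realType} {d : measure_display} {T : measurableType d} (P : probability T R).
Variables (m n : nat) (A : T -> 'M[R]_(m, n)).
Hypothesis gA : gaussian_law P A.
Local Open Scope ereal_scope.

Lemma measurable_comp_mx d' (T' : measurableType d') d'' (U : measurableType d'')
    (f : mxspace m n -> U) (F : T' -> 'M[R]_(m, n)) :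
  measurable_fun [set: mxspace m n] f -> mx_measurable F ->
  measurable_fun [set: T'] (fun w => f (F w)).
Proof. by move=> h /measurable_mxP mF; exact: (measurableT_comp h mF). Qed.

Lemma gaussian_measurable : mx_measurable A. Proof. by case: gA. Qed.

Lemma coord_measurable : mx_measurable (fun B : mxspace m n => (B : 'M[R]_(m, n))).
Proof. by move=> i j; exact: measurable_coord. Qed.

Section Entry.
Variables (i : 'I_m) (j : 'I_n).

Lemma mx_setK (x y : R) (B : 'M[R]_(m, n)) : mx_set i j x (mx_set i j y B) = mx_set i j x B.
Proof. by apply/matrixP => k l; rewrite !mxE; case: (_ && _). Qed.

Lemma mx_setE (x : R) (B : 'M[R]_(m, n)) : mx_set i j x B i j = x.
Proof. by rewrite mxE !eqxx. Qed.

Lemma measurable_mx_setl (B : 'M[R]_(m, n)) :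
  mx_measurable (fun x : R => mx_set i j x B).
Proof. by apply: measurable_mx_set => // k l; exact: measurable_cst. Qed.

(** Affine substitution in one entry: the coefficient b may depend on all the
    other entries. Taking a = 1, a = -1 or the two factors of a plane
    rotation gives translations, symmetries and rotations of the law. *)
Lemma entry_affine (a : R) (b : mxspace m n -> R) (f : mxspace m n -> \bar R) :
  a != 0%R -> measurable_fun [set: mxspace m n] b ->
  (forall (B : 'M[R]_(m, n)) x, b (mx_set i j x B) = b B) ->
  measurable_fun [set: mxspace m n] f -> (forall B, 0 <= f B) ->
  \int[P]_w f (mx_set i j (a * A w i j + b (A w))%R (A w)) =
  \int[P]_w (f (A w) * (affine_density a (b (A w)) (A w i j))%:E).
Proof.
move=> a0 mb bE mfn f0.
have mc := measurable_coord i j.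
pose g (B : mxspace m n) := f (mx_set i j (a * (B : 'M[R]_(m, n)) i j + b B)%R B).
have mg : measurable_fun [set: mxspace m n] g.
  apply: measurable_comp_mx => //; apply: measurable_mx_set; last exact: coord_measurable.
  by apply: measurable_funD => //; exact: measurable_funM.
pose h (B : mxspace m n) := f B * (affine_density a (b B) ((B : 'M[R]_(m, n)) i j))%:E.
have md : measurable_fun [set: mxspace m n]
    (fun B : mxspace m n => affine_density a (b B) ((B : 'M[R]_(m, n)) i j)).
  apply: measurable_funM => //; apply: measurableT_comp => //.
  apply: measurable_funM => //; apply: measurable_funB; first exact: measurable_funX.
  by apply: measurable_funX; apply: measurable_funM => //; exact: measurable_funB.
have mh : measurable_fun [set: mxspace m n] h.
  by apply: emeasurable_funM => //; exact/measurable_EFinP.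
have h0 B : 0 <= h B by rewrite mule_ge0 // lee_fin affine_density_ge0.
rewrite [LHS](resample gA i j mg (fun B => f0 _)) [RHS](resample gA i j mh h0).
apply: eq_integral => w _.
transitivity (\int[normal_prob 0 1]_x f (mx_set i j (a * x + b (A w))%R (A w))).
  by apply: eq_integral => x _; rewrite /g mx_setK mx_setE bE.
have ms : measurable_fun [set: R] (fun x => f (mx_set i j x (A w))).
  by apply: (measurable_comp_mx mfn); exact: measurable_mx_setl.
rewrite (gaussian_affine (b (A w)) a0 ms (fun x => f0 _)).
by apply: eq_integral => x _; rewrite /h mx_setE bE.
Qed.

(** The decomposition into positive and negative parts reduces Fubini's theorem
    here to the nonnegative case. *)
Lemma resample_integrable (f : mxspace m n -> R) :
  measurable_fun [set: mxspace m n] f ->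
  P.-integrable [set: T] (fun w => (f (A w))%:E) ->
  \int[P]_w (f (A w))%:E = \int[P]_w \int[normal_prob 0 1]_x (f (mx_set i j x (A w)))%:E.
Proof.
move=> mfn fi.
have mE : measurable_fun [set: mxspace m n] (EFin \o f) by exact/measurable_EFinP.
have mA := gaussian_measurable.
pose F (z : T * measurableTypeR R) := (f (mx_set i j z.2 (A z.1)))%:E.
have mF : measurable_fun [set: T * measurableTypeR R] F.
  apply: (measurable_comp_mx mE); apply: measurable_mx_set; first exact: measurable_snd.
  by move=> k l; exact: (measurableT_comp (mA k l) measurable_fst).
have mabs : measurable_fun [set: mxspace m n] (fun B => `|(f B)%:E|).
  exact: (measurableT_comp (@abse_measurable R setT) mE).
have iF : (P \x normal_prob 0 1).-integrable [set: T * measurableTypeR R] F.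
  have [_ iP] := @integrable12ltyP _ _ _ _ R P (normal_prob 0 1) F mF.
  apply: iP.
  move: fi => /integrableP[_]; apply: le_lt_trans.
  by rewrite (resample gA i j mabs (fun B => abse_ge0 _)).
have := integral12_prod_meas1 iF.
rewrite /fubini_F /= => ->.
rewrite integralE [RHS]integralE; congr (_ - _).
- transitivity (\int[P]_w (EFin \o f)^\+ (A w)).
    by apply: eq_integral => w _; rewrite !funeposE.
  rewrite (resample gA i j (measurable_funepos mE) (fun B => funepos_ge0 _ B)).
  rewrite (fubini_tonelli1 _ (measurable_funepos mF) (fun B => funepos_ge0 _ B)).
  apply: eq_integral => w _; rewrite /fubini_F; apply: eq_integral => x _.
  by rewrite !funeposE.
- transitivity (\int[P]_w (EFin \o f)^\- (A w)).
    by apply: eq_integral => w _; rewrite !funenegE.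
  rewrite (resample gA i j (measurable_funeneg mE) (fun B => funeneg_ge0 _ B)).
  rewrite (fubini_tonelli1 _ (measurable_funeneg mF) (fun B => funeneg_ge0 _ B)).
  apply: eq_integral => w _; rewrite /fubini_F; apply: eq_integral => x _.
  by rewrite !funenegE.
Qed.

End Entry.

End Gaussian_entries.

(** * Substitutions in one row and rotation invariance *)

Section Row_set.
Context {R : realType}.
Variables (m n : nat).

Definition row_set (p : 'I_m) (v : 'rV[R]_n) (B : 'M[R]_(m, n)) : 'M[R]_(m, n) :=
  \matrix_(k, l) if k == p then v 0 l else B k l.

Lemma row_setK p u v B : row_set p u (row_set p v B) = row_set p u B.
Proof. by apply/matrixP => k l; rewrite !mxE; case: (k == p). Qed.

Lemma row_setE p v B : row p (row_set p v B) = v.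
Proof. by apply/rowP => l; rewrite !mxE eqxx. Qed.

Lemma row_setN p q v B : p != q -> row q (row_set p v B) = row q B.
Proof. by move=> pq; apply/rowP => l; rewrite !mxE eq_sym (negbTE pq). Qed.

Lemma measurable_row_set d' (T' : measurableType d') (p : 'I_m) (v : T' -> 'rV[R]_n)
    (B : T' -> 'M[R]_(m, n)) :
  mx_measurable v -> mx_measurable B -> mx_measurable (fun w => row_set p (v w) (B w)).
Proof.
move=> mv mB k l.
have -> : (fun w => row_set p (v w) (B w) k l) =
    if k == p then (fun w => v w 0 l) else fun w => B w k l.
  by apply/funext => w; rewrite mxE; case: ifP.
by case: ifP => _; [exact: mv|exact: mB].
Qed.

Lemma measurable_row d' (T' : measurableType d') (p : 'I_m) (B : T' -> 'M[R]_(m, n)) :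
  mx_measurable B -> mx_measurable (fun w => row p (B w)).
Proof.
move=> mB k l; have -> : (fun w => row p (B w) k l) = fun w => B w p l.
  by apply/funext => w; rewrite mxE.
exact: mB.
Qed.

End Row_set.

Section Row_transformations.
Context {R : realType} {d : measure_display} {T : measurableType d} (P : probability T R).
Variables (m n : nat) (A : T -> 'M[R]_(m, n)).
Hypothesis gA : gaussian_law P A.
Local Open Scope ereal_scope.

Section Row.
Variables (p : 'I_m) (a : R) (b : @mxspace R m n -> 'rV[R]_n).
Hypotheses (a0 : a != 0%R) (mb : mx_measurable b)
  (bE : forall (B : 'M[R]_(m, n)) v, b (row_set p v B) = b B).

(* The first k entries of row p are already transformed. *)
Let partial k (B : 'M[R]_(m, n)) : 'M[R]_(m, n) :=
  row_set p (\row_l (if (l < k)%N then (a * B p l + b B 0%R l)%R else B p l)) B.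

Let dens (B : 'M[R]_(m, n)) l : R := affine_density a (b B 0%R l) (B p l).

Let mdens l : measurable_fun [set: @mxspace R m n] (fun B : @mxspace R m n => dens B l).
Proof.
have mc := measurable_coord p l; have mbl := mb 0%R l.
apply: measurable_funM => //; apply: measurableT_comp => //.
apply: measurable_funM => //; apply: measurable_funB; first exact: measurable_funX.
by apply: measurable_funX; apply: measurable_funM => //; exact: measurable_funB.
Qed.

Let mpartial k : mx_measurable (fun B : @mxspace R m n => partial k B).
Proof.
apply: measurable_row_set; last exact: coord_measurable.
move=> i l.
have -> : (fun B : @mxspace R m n => (\row_l if (l < k)%N then (a * (B : 'M[R]_(m, n)) p l + b B 0%R l)%R
     else (B : 'M[R]_(m, n)) p l) i l) =
  if (l < k)%N then (fun B : @mxspace R m n => (a * (B : 'M[R]_(m, n)) p l + b B 0%R l)%R)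
  else fun B : @mxspace R m n => (B : 'M[R]_(m, n)) p l.
  by apply/funext => B; rewrite mxE; case: ifP.
case: ifP => _; last exact: measurable_coord.
apply: measurable_funD; last exact: mb.
by apply: measurable_funM => //; exact: measurable_coord.
Qed.

Let partial_step k (kn : (k < n)%N) (B : 'M[R]_(m, n)) :
  partial k.+1 B = partial k (mx_set p (Ordinal kn) (a * B p (Ordinal kn) + b B 0 (Ordinal kn))%R B).
Proof.
have bs x : b (mx_set p (Ordinal kn) x B) = b B.
  rewrite -(bE (mx_set p (Ordinal kn) x B) (row p B)); congr b.
  by apply/matrixP => i j; rewrite !mxE; case: eqP => // ->.
apply/matrixP => i j; rewrite !mxE bs; case: eqP => //= _.
rewrite eqxx /= ltnS leq_eqVlt -val_eqE /=; case: eqP => [jk|_] /=; last by case: ifP.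
by rewrite jk ltnn (_ : j = Ordinal kn) //; apply: val_inj.
Qed.

(** The entries of the row are substituted one by one, from left to right; each
    step contributes one factor of the density. *)
Lemma row_affine (f : @mxspace R m n -> \bar R) :
  measurable_fun [set: @mxspace R m n] f -> (forall B, 0 <= f B) ->
  \int[P]_w f (row_set p (a *: row p (A w) + b (A w))%R (A w)) =
  \int[P]_w (f (A w) * (\prod_l affine_density a (b (A w) 0%R l) (A w p l))%:E).
Proof.
move=> mf f0.
have step k : (k <= n)%N -> forall f : @mxspace R m n -> \bar R,
    measurable_fun [set: @mxspace R m n] f -> (forall B, 0 <= f B) ->
    \int[P]_w f (partial k (A w)) =
    \int[P]_w (f (A w) * (\prod_(l < n | (l < k)%N) dens (A w) l)%:E).
  elim: k => [|k IH] kn g mg g0.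
    apply: eq_integral => w _; rewrite big_pred0 ?mule1; last by move=> l.
    by congr g; apply/matrixP => i j; rewrite !mxE; case: eqP => // ->.
  pose h (B : @mxspace R m n) := g (partial k B).
  have mh : measurable_fun [set: @mxspace R m n] h by exact: (measurable_comp_mx mg (mpartial k)).
  pose K := Ordinal kn.
  have bs (B : 'M[R]_(m, n)) x : b (mx_set p K x B) 0%R K = b B 0%R K.
    congr (_ 0%R K); rewrite -(bE (mx_set p K x B) (row p B)); congr b.
    by apply/matrixP => i j; rewrite !mxE; case: eqP => // ->.
  have := entry_affine gA a0 (mb 0%R K) bs mh (fun B => g0 _).
  rewrite /h; under eq_integral do rewrite -partial_step.
  move=> ->.
  pose g' (B : @mxspace R m n) := g B * (dens B K)%:E.
  have mg' : measurable_fun [set: @mxspace R m n] g'.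
    by apply: emeasurable_funM => //; apply/measurable_EFinP; exact: mdens.
  have g'0 B : 0 <= g' B by rewrite mule_ge0 // lee_fin affine_density_ge0.
  transitivity (\int[P]_w g' (partial k (A w))).
    apply: eq_integral => w _; rewrite /g' /dens.
    by rewrite bE !mxE eqxx /= ltnn.
  rewrite (IH (ltnW kn) g' mg' g'0); apply: eq_integral => w _.
  rewrite /g' -muleA -EFinM; congr (_ * _%:E).
  rewrite [RHS](bigD1 K) //=; congr (_ * _)%R; apply: eq_bigl => l.
  by rewrite ltnS ltn_neqAle andbC -(inj_eq val_inj).
transitivity (\int[P]_w f (partial n (A w))).
  apply: eq_integral => w _; congr f; apply/matrixP => i j; rewrite !mxE.
  by rewrite ltn_ord.
rewrite (step n (leqnn n) f mf f0); apply: eq_integral => w _; congr (_ * _%:E).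
by apply: eq_bigl => l; rewrite ltn_ord.
Qed.

End Row.

Lemma prod_affine_density_shift (v z : 'rV[R]_n) :
  (\prod_l affine_density 1 (v 0%R l) (z 0%R l) = expR (frob v z - frob v v / 2))%R.
Proof.
have -> : (\prod_l affine_density 1 (v 0%R l) (z 0%R l) =
   \prod_l expR (v 0%R l * z 0%R l - v 0%R l * v 0%R l / 2))%R.
  apply: eq_bigr => l _; rewrite /affine_density normr1 invr1 mul1r; congr expR.
  by rewrite mulr1 !expr2; field.
rewrite -expR_sum; congr expR; rewrite !frobE !big_ord1 mulr_suml -sumrB.
by [].
Qed.

Lemma row_shift (p : 'I_m) (b : @mxspace R m n -> 'rV[R]_n) (f : @mxspace R m n -> \bar R) :
  mx_measurable b -> (forall (B : 'M[R]_(m, n)) v, b (row_set p v B) = b B) ->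
  measurable_fun [set: @mxspace R m n] f -> (forall B, 0 <= f B) ->
  \int[P]_w f (row_set p (row p (A w) + b (A w))%R (A w)) =
  \int[P]_w (f (A w) * (expR (frob (b (A w)) (row p (A w)) - frob (b (A w)) (b (A w)) / 2))%:E).
Proof.
move=> mb bE mf f0; have := row_affine (oner_neq0 _) mb bE mf f0.
under eq_integral do rewrite scale1r.
move=> ->; apply: eq_integral => w _; congr (_ * _%:E).
by rewrite -prod_affine_density_shift; apply: eq_bigr => l _; rewrite mxE.
Qed.

Lemma row_flip (p : 'I_m) (f : @mxspace R m n -> \bar R) :
  measurable_fun [set: @mxspace R m n] f -> (forall B, 0 <= f B) ->
  \int[P]_w f (row_set p (- row p (A w))%R (A w)) = \int[P]_w f (A w).
Proof.
move=> mf f0.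
have a0 : (-1 != 0 :> R)%R by rewrite oppr_eq0 oner_eq0.
have := @row_affine p (-1) (fun=> 0%R) a0 (measurable_cstmx _) (fun _ _ => erefl) f mf f0.
under eq_integral do rewrite scaleN1r addr0.
move=> ->; apply: eq_integral => w _; rewrite big1 ?mule1 // => l _.
rewrite /affine_density normrN1 invr1 mul1r mxE subr0 invrN invr1 mulrN1 sqrrN subrr mul0r.
exact: expR0.
Qed.

Definition rotmx (p k : 'I_m) (c s : R) : 'M[R]_m :=
  (1%:M + (c - 1) *: (delta_mx p p + delta_mx k k) + s *: (delta_mx p k - delta_mx k p))%R.

Lemma delta_mulmx (i j : 'I_m) (B : 'M[R]_(m, n)) :
  (delta_mx i j *m B)%R = \matrix_(a, l) ((a == i)%:R * B j l)%R.
Proof.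
apply/matrixP => a l; rewrite !mxE (bigD1 j) //= mxE eqxx andbT big1 ?addr0 // => q /negbTE qj.
by rewrite mxE qj andbF mul0r.
Qed.

Lemma rotmx_mul p k c s (B : 'M[R]_(m, n)) : p != k ->
  (rotmx p k c s *m B = row_set k (c *: row k B - s *: row p B)
     (row_set p (c *: row p B + s *: row k B) B))%R.
Proof.
move=> pk; apply/matrixP => i j.
rewrite /rotmx !mulmxDl mul1mx -!scalemxAl mulmxDl mulmxBl !delta_mulmx !mxE.
have [->|ik] := eqVneq i k; first by rewrite eq_sym (negbTE pk) /=; ring.
by have [->|ip] := eqVneq i p; rewrite /=; ring.
Qed.

(** For c <> 0 the rotation is an affine substitution in row p followed by one
    in row k. The product of the two densities is 1 because x^2 + y^2 is
    invariant. *)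
Lemma rotation_invariance p k c s (f : @mxspace R m n -> \bar R) : p != k ->
  (c ^+ 2 + s ^+ 2 = 1)%R -> c != 0%R ->
  measurable_fun [set: @mxspace R m n] f -> (forall B, 0 <= f B) ->
  \int[P]_w f (rotmx p k c s *m A w)%R = \int[P]_w f (A w).
Proof.
move=> pk cs c0 mf f0; have kp : k != p by rewrite eq_sym.
have mrow q : mx_measurable (fun B : @mxspace R m n => row q (B : 'M[R]_(m, n))).
  by apply: measurable_row; exact: coord_measurable.
have mscale (x : R) (F : @mxspace R m n -> 'rV[R]_n) : mx_measurable F ->
    mx_measurable (fun B => x *: F B)%R.
  by apply: measurable_scalemx; exact: measurable_cst.
(* the second shear, applied to a matrix whose row p is already rotated *)
pose f2 (B : @mxspace R m n) := f (row_set k (c^-1 *: row k (B : 'M[R]_(m, n)) +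
   (- (s / c)) *: row p (B : 'M[R]_(m, n)))%R B).
have mf2 : measurable_fun [set: @mxspace R m n] f2.
  apply: (measurable_comp_mx mf); apply: measurable_row_set; last exact: coord_measurable.
  by apply: measurable_addmx; exact: mscale.
pose b1 (B : @mxspace R m n) : 'rV[R]_n := (s *: row k (B : 'M[R]_(m, n)))%R.
have b1E (B : 'M[R]_(m, n)) v : b1 (row_set p v B) = b1 B by rewrite /b1 row_setN.
have := row_affine c0 (mscale s _ (mrow k)) b1E mf2 (fun B => f0 _).
have -> : \int[P]_w f2 (row_set p (c *: row p (A w) + b1 (A w))%R (A w)) =
    \int[P]_w f (rotmx p k c s *m A w)%R.
  apply: eq_integral => w _; rewrite /f2 rotmx_mul //; congr f.
  rewrite row_setE row_setN // /b1; congr row_set.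
  apply/rowP => l; rewrite !mxE; set x := A w p l; set y := A w k l.
  have -> : (c^-1 * y + - (s / c) * (c * x + s * y) = (1 - s ^+ 2) / c * y - s * x)%R by field.
  by rewrite -cs addrK; field.
move=> ->.
pose g (B : @mxspace R m n) := f B * (\prod_l affine_density c
    ((s *: (c *: row k (B : 'M[R]_(m, n)) + s *: row p (B : 'M[R]_(m, n)))) 0%R l) ((B : 'M[R]_(m, n)) p l))%:E.
have mg : measurable_fun [set: @mxspace R m n] g.
  apply: emeasurable_funM => //; apply/measurable_EFinP.
  apply: measurable_prod => l _.
  have mc := measurable_coord p l.
  have mbl : measurable_fun [set: @mxspace R m n] (fun B : @mxspace R m n =>
     (s *: (c *: row k (B : 'M[R]_(m, n)) + s *: row p (B : 'M[R]_(m, n)))) 0%R l)%R.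
    apply: (mscale s (fun B : @mxspace R m n => c *: row k (B : 'M[R]_(m, n)) +
      s *: row p (B : 'M[R]_(m, n)))%R _ 0%R l).
    by apply: measurable_addmx; exact: (mscale _ _ (mrow _)).
  apply: measurable_funM => //; apply: measurableT_comp => //.
  apply: measurable_funM => //; apply: measurable_funB; first exact: measurable_funX.
  by apply: measurable_funX; apply: measurable_funM => //; exact: measurable_funB.
have g0 B : 0 <= g B.
  by rewrite mule_ge0 // lee_fin; apply: prodr_ge0 => l _; exact: affine_density_ge0.
pose b2 (B : @mxspace R m n) : 'rV[R]_n := ((- (s / c)) *: row p (B : 'M[R]_(m, n)))%R.
have b2E (B : 'M[R]_(m, n)) v : b2 (row_set k v B) = b2 B by rewrite /b2 row_setN.
have ci0 : c^-1%R != 0%R by rewrite invr_eq0.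
have := row_affine ci0 (mscale (- (s / c))%R _ (mrow p)) b2E mg g0.
have -> : \int[P]_w g (row_set k (c^-1 *: row k (A w) + b2 (A w))%R (A w)) =
   \int[P]_w (f2 (A w) * (\prod_l affine_density c (b1 (A w) 0%R l) (A w p l))%:E).
  apply: eq_integral => w _; rewrite /g /f2; congr (_ * _%:E).
  apply: eq_bigr => l _; rewrite row_setE row_setN // /b1 /b2.
  apply: (f_equal2 (affine_density c)); rewrite !mxE ?(negbTE pk) //; by field.
move=> ->; apply: eq_integral => w _; rewrite /g -muleA -EFinM -big_split /=.
rewrite big1 ?mule1 // => l _; rewrite /affine_density /b2 !mxE.
set x := A w p l; set y := A w k l.
have nc : `|c|%R != 0%R by rewrite normr_eq0.
have hE (E1 E2 : R) : (`|c|^-1 * E1 * (`|c| * E2) = E1 * E2)%R by field.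
rewrite normfV !invrK hE -expRD -[RHS]expR0; congr expR.
have -> : ((x - s * (c * y + s * x)) / c = c * x - s * y)%R.
  by apply: (mulIf c0); rewrite divfK // -[X in (X - _)%R]mul1r -cs; ring.
have -> : ((y - - (s / c) * x) * c = c * y + s * x)%R by field.
have e : (x ^+ 2 - (c * x - s * y) ^+ 2 + (y ^+ 2 - (c * y + s * x) ^+ 2) = 0 :> R)%R.
  have -> : (x ^+ 2 - (c * x - s * y) ^+ 2 + (y ^+ 2 - (c * y + s * x) ^+ 2) =
    (1 - (c ^+ 2 + s ^+ 2)) * (x ^+ 2 + y ^+ 2) :> R)%R by ring.
  by rewrite cs subrr mul0r.
by rewrite -mulrDl e mul0r.
Qed.

End Row_transformations.

(** * Expectations and Gaussian moments *)

Section Mean.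
Context {R : realType} {d : measure_display} {T : measurableType d} (P : probability T R).
Implicit Types f g : T -> R.

Definition has_mean f := P.-integrable [set: T] (EFin \o f).

(** Real-valued, so that ring and linear arithmetic apply; integrability is
    carried separately by has_mean. *)
Definition mean f : R := \int[P]_x f x.

Lemma has_mean_measurable f : has_mean f -> measurable_fun [set: T] f.
Proof. by move=> /measurable_int /measurable_EFinP. Qed.

Lemma meanE f : has_mean f -> (mean f)%:E = (\int[P]_x (f x)%:E)%E.
Proof. by move=> fi; rewrite /mean /Rintegral fineK // integrable_fin_num. Qed.

Lemma has_mean_cst c : has_mean (fun=> c).
Proof. exact: finite_measure_integrable_cst. Qed.

Lemma has_meanD f g : has_mean f -> has_mean g -> has_mean (fun x => f x + g x).
Proof. by move=> fi gi; exact: (integrableD measurableT fi gi). Qed.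

Lemma has_meanZ c f : has_mean f -> has_mean (fun x => c * f x).
Proof. by move=> fi; exact: (integrableZl measurableT c fi). Qed.

Lemma has_meanB f g : has_mean f -> has_mean g -> has_mean (fun x => f x - g x).
Proof. by move=> fi gi; exact: (integrableB measurableT fi gi). Qed.

Lemma has_mean_sum I (r : seq I) (Q : pred I) (F : I -> T -> R) :
  (forall i, has_mean (F i)) -> has_mean (fun x => \sum_(i <- r | Q i) F i x).
Proof.
move=> Fi; elim: r => [|i r IH].
  by under eq_fun do rewrite big_nil; exact: has_mean_cst.
have -> : (fun w => \sum_(j <- i :: r | Q j) F j w) =
  (fun w => (if Q i then F i w else 0) + \sum_(j <- r | Q j) F j w).
  by apply/funext => w; rewrite big_cons; case: ifP => // _; rewrite add0r.
by apply: has_meanD => //; case: (Q i) => //; exact: has_mean_cst.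
Qed.

Lemma has_mean_le f g : measurable_fun [set: T] f -> (forall x, `|f x| <= g x) ->
  has_mean g -> has_mean f.
Proof.
move=> mf fg gi; apply: (le_integrable measurableT _ _ gi); first exact/measurable_EFinP.
by move=> x _ /=; rewrite lee_fin (le_trans (fg x)) // ler_norm.
Qed.

Lemma has_mean_bounded f c : measurable_fun [set: T] f -> (forall x, `|f x| <= c) -> has_mean f.
Proof. by move=> mf fc; apply: (has_mean_le mf fc); exact: has_mean_cst. Qed.

Lemma has_mean_ge0 f c : measurable_fun [set: T] f -> (forall x, 0 <= f x) ->
  (\int[P]_x (f x)%:E <= c%:E)%E -> has_mean f /\ mean f <= c.
Proof.
move=> mf f0 fc; have fi : has_mean f.
  apply/integrableP; split; first exact/measurable_EFinP.
  under eq_integral do rewrite /= ger0_norm //.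
  by apply: le_lt_trans fc _; exact: ltry.
by split=> //; rewrite -lee_fin meanE.
Qed.

Lemma mean_cst c : mean (fun=> c) = c.
Proof.
have PT : P [set: T] = 1%E := probability_setT P.
by rewrite /mean /Rintegral integral_cst // [X in (_ * X)%E](_ : _ = 1%E) ?mule1.
Qed.

Lemma meanD f g : has_mean f -> has_mean g -> mean (fun x => f x + g x) = mean f + mean g.
Proof. by move=> fi gi; exact: RintegralD. Qed.

Lemma meanB f g : has_mean f -> has_mean g -> mean (fun x => f x - g x) = mean f - mean g.
Proof. by move=> fi gi; exact: RintegralB. Qed.

Lemma meanZ c f : has_mean f -> mean (fun x => c * f x) = c * mean f.
Proof. by move=> fi; exact: RintegralZl. Qed.

Lemma mean_sum I (r : seq I) (Q : pred I) (F : I -> T -> R) :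
  (forall i, has_mean (F i)) ->
  mean (fun x => \sum_(i <- r | Q i) F i x) = \sum_(i <- r | Q i) mean (F i).
Proof.
move=> Fi; elim: r => [|i r IH].
  by under [X in mean X]eq_fun do rewrite big_nil; rewrite big_nil mean_cst.
rewrite big_cons; case: ifP => Qi.
  under [X in mean X]eq_fun do rewrite big_cons Qi.
  by rewrite meanD // ?IH //; exact: has_mean_sum.
by under [X in mean X]eq_fun do rewrite big_cons Qi.
Qed.

Lemma mean_le f g : has_mean f -> has_mean g -> (forall x, f x <= g x) -> mean f <= mean g.
Proof. by move=> fi gi fg; apply: le_Rintegral => // x _; exact: fg. Qed.

Lemma mean_ge0 f : (forall x, 0 <= f x) -> 0 <= mean f.
Proof. by move=> f0; apply: Rintegral_ge0 => x _; exact: f0. Qed.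

End Mean.

Section Stein_rational.
Context {R : realType}.

(** The function below is half the logarithmic derivative of the positive
    quadratic al + 2 be x + c x^2. The lower bound assumed on that quadratic is
    what makes the function grow at most linearly and its derivative bounded. *)
Lemma stein_rational (al be c eps : R) : 0 < eps -> 0 <= c ->
  (forall x, eps + (be + c * x) ^+ 2 <= al + 2 * be * x + c * x ^+ 2) ->
  (\int[normal_prob 0 1]_x (x * ((be + c * x) / (al + 2 * be * x + c * x ^+ 2)) -
     (c / (al + 2 * be * x + c * x ^+ 2) -
      2 * ((be + c * x) / (al + 2 * be * x + c * x ^+ 2)) ^+ 2))%:E = 0)%E.
Proof.
move=> e0 c0 hq; pose q x := al + 2 * be * x + c * x ^+ 2; pose l x := be + c * x.
have qe x : eps <= q x by apply: le_trans (hq x); rewrite lerDl sqr_ge0.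
have q0 x : 0 < q x by exact: lt_le_trans (qe x).
have ql x : l x ^+ 2 <= q x by apply: le_trans (hq x); rewrite lerDr ltW.
pose h x := l x / q x; pose h' x := c / q x - 2 * (l x / q x) ^+ 2.
have cl : continuous l.
  by move=> x; apply: cvgD; [exact: cvg_cst|apply: cvgM; [exact: cvg_cst|exact: cvg_id]].
have cq : continuous q.
  move=> x; apply: cvgD.
    by apply: cvgD; [exact: cvg_cst|apply: cvgM; [exact: cvg_cst|exact: cvg_id]].
  by apply: cvgM; [exact: cvg_cst|apply: sqr_continuous].
have cqi : continuous (fun x => (q x)^-1).
  by move=> x; apply: continuousV; [rewrite gt_eqF|exact: cq].
have dq (x : R) : is_derive x 1 (q : R -> R) (2 * l x).
  have -> : q = (fun=> al) + ((2 * be) \*: (@id R)) + (c \*: (@id R ^+ 2)) :> (R -> R) by [].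
  by apply: is_derive_eq; rewrite /GRing.scale /= /l expr1; ring.
have dl (x : R) : is_derive x 1 (l : R -> R) c.
  have -> : l = (fun=> be) + (c \*: (@id R)) :> (R -> R) by [].
  by apply: is_derive_eq; rewrite /GRing.scale /=; ring.
apply: (@stein R h h' (1 + (3 + c) / eps)).
- move=> x; have qx : q x != 0 by rewrite gt_eqF.
  have -> : h = l * (fun y => (q y)^-1) :> (R -> R) by [].
  have dqi := @is_deriveV R q x (2 * l x) 1 qx (dq x).
  have dlx := dl x.
  by apply: is_derive_eq; rewrite /GRing.scale /= /h'; field.
- move=> x; apply: cvgB; first by apply: cvgM; [exact: cvg_cst|exact: cqi].
  apply: cvgM; first exact: cvg_cst.
  apply: (cvg_comp (fun x => l x / q x) (fun y => y ^+ 2)); last exact: sqr_continuous.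
  by apply: cvgM; [exact: cl|exact: cqi].
- move=> x; rewrite /h normrM normfV (gtr0_norm (q0 x)) ler_pdivrMr //.
  have h1 : `|l x| <= 1 + l x ^+ 2.
    have -> : l x ^+ 2 = `|l x| ^+ 2 by rewrite real_normK ?num_real.
    by have := sqr_ge0 (1 - `|l x|); rewrite !expr2; have := normr_ge0 (l x); nra.
  apply: (le_trans h1); apply: (@le_trans _ _ ((1 + (3 + c) / eps) * q x)).
    rewrite mulrDl mul1r addrC lerD // mulrAC ler_pdivlMr // mul1r.
    by apply: (le_trans (qe x)); rewrite ler_peMl ?ltW // -ltrBlDr; lra.
  apply: ler_wpM2r; first exact: ltW.
  apply: ler_peMr; last by rewrite lerDl.
  by rewrite addr_ge0 // divr_ge0 ?addr_ge0 // ltW.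
- move=> x; rewrite /h'; apply: (le_trans (ler_normB _ _)).
  have n1 : `|c / q x| = c / q x by rewrite ger0_norm // divr_ge0 // ltW.
  have n2 : `|2 * (l x / q x) ^+ 2| = 2 * (l x / q x) ^+ 2.
    by rewrite ger0_norm // mulr_ge0 // sqr_ge0.
  rewrite n1 n2.
  have i1 : (q x)^-1 <= eps^-1 by rewrite lef_pV2 ?posrE.
  have i2 : 2 * (l x / q x) ^+ 2 <= 2 * eps^-1.
    rewrite ler_wpM2l // expr_div_n expr2 [q x ^+ 2]expr2 invfM mulrA (le_trans (y := (q x)^-1)) //.
    apply: ler_piMl; first by rewrite invr_ge0 ltW.
    by rewrite ler_pdivrMr ?mul1r // -expr2.
  have i3 : c / q x <= c / eps by rewrite ler_wpM2l.
  have : 0 <= eps^-1 by rewrite invr_ge0 ltW.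
  rewrite mulrDl; lra.
Qed.

End Stein_rational.

Lemma gaussian_has_mean {R : realType} : has_mean (normal_prob (0 : R) 1) id.
Proof.
have s2 : has_mean (normal_prob (0 : R) 1) (fun x => x ^+ 2) by exact: gaussian_sqr_integrable.
apply: (has_mean_le _ _ (has_meanD (has_mean_cst _ 1) s2)) => // x.
rewrite -(real_normK (num_real x)).
by have := sqr_ge0 (1 - `|x|); have := normr_ge0 x; rewrite !expr2; nra.
Qed.

Section Moments.
Context {R : realType} {d : measure_display} {T : measurableType d} (P : probability T R).
Variables (m n : nat) (A : T -> 'M[R]_(m, n)).
Hypothesis gA : gaussian_law P A.

Let mA := gaussian_measurable gA.

Lemma entry_second_moment i j :
  has_mean P (fun w => A w i j ^+ 2) /\ mean P (fun w => A w i j ^+ 2) = 1.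
Proof.
have ms : measurable_fun [set: @mxspace R m n]
    (fun B : @mxspace R m n => (((B : 'M[R]_(m, n)) i j) ^+ 2)%:E).
  by apply/measurable_EFinP; apply: measurable_funX; exact: measurable_coord.
have e : (\int[P]_w (A w i j ^+ 2)%:E = 1)%E.
  have h0 (B : @mxspace R m n) : (0 <= (((B : 'M[R]_(m, n)) i j) ^+ 2)%:E)%E by rewrite lee_fin sqr_ge0.
  rewrite (resample gA i j ms h0).
  under eq_integral do under eq_integral do rewrite mx_setE.
  rewrite gaussian_variance1 integral_cst // mul1e; exact: probability_setT.
have si : has_mean P (fun w => A w i j ^+ 2).
  have [] // := @has_mean_ge0 _ _ _ P (fun w => A w i j ^+ 2) 1.
  - by apply: measurable_funX; exact: mA.
  - by move=> w; exact: sqr_ge0.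
  - by rewrite e.
by split=> //; apply: EFin_inj; rewrite meanE.
Qed.

Lemma has_mean_mul_entries i j k l : has_mean P (fun w => A w i j * A w k l).
Proof.
have [s1 _] := entry_second_moment i j; have [s2 _] := entry_second_moment k l.
apply: (has_mean_le _ _ (has_meanD s1 s2)).
  by apply: measurable_funM; exact: mA.
move=> w; rewrite normrM -(real_normK (num_real (A w i j))) -(real_normK (num_real (A w k l))).
move: (`|A w i j|) (`|A w k l|) (normr_ge0 (A w i j)) (normr_ge0 (A w k l)) => a b a0 b0.
have := sqr_ge0 (a - b); rewrite !expr2; nra.
Qed.

Lemma has_mean_entry i j : has_mean P (fun w => A w i j).
Proof.
have [s1 _] := entry_second_moment i j.
apply: (has_mean_le _ _ (has_meanD (has_mean_cst P 1) s1)); first exact: mA.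
move=> w; rewrite -(real_normK (num_real (A w i j))).
by have := sqr_ge0 (1 - `|A w i j|); have := normr_ge0 (A w i j); rewrite !expr2; nra.
Qed.

Lemma entry_mean0 i j : mean P (fun w => A w i j) = 0.
Proof.
apply: EFin_inj; rewrite meanE; last exact: has_mean_entry.
have := @resample_integrable _ _ _ _ _ _ _ gA i j (fun B => (B : 'M[R]_(m, n)) i j)
  (measurable_coord i j) (has_mean_entry i j).
move=> ->; under eq_integral do under eq_integral do rewrite mx_setE.
by rewrite gaussian_mean0 integral0.
Qed.

Lemma entry_covariance i j k l :
  mean P (fun w => A w i j * A w k l) = ((i == k) && (j == l))%:R.
Proof.
have [/andP[/eqP <- /eqP <-]|ne] := boolP ((i == k) && (j == l)).
  by have [_ <-] := entry_second_moment i j; congr mean; apply/funext => w; rewrite expr2.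
apply: EFin_inj; rewrite meanE; last exact: has_mean_mul_entries.
have mB : measurable_fun [set: @mxspace R m n]
   (fun B : @mxspace R m n => (B : 'M[R]_(m, n)) i j * (B : 'M[R]_(m, n)) k l).
  by apply: measurable_funM; exact: measurable_coord.
rewrite (@resample_integrable _ _ _ _ _ _ _ gA i j _ mB (has_mean_mul_entries i j k l)).
have E w : (\int[normal_prob 0 1]_x (mx_set i j x (A w) i j * mx_set i j x (A w) k l)%:E = 0)%E.
  transitivity (\int[normal_prob (0 : R) 1]_x ((A w k l)%:E * x%:E))%E.
    apply: eq_integral => x _; rewrite mx_setE mxE [k == i]eq_sym [l == j]eq_sym (negbTE ne).
    by rewrite -EFinM mulrC.
  by rewrite (integralZl measurableT gaussian_has_mean) gaussian_mean0 mule0.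
by under eq_integral do rewrite E; rewrite integral0.
Qed.

End Moments.

(** * Inverse second moment of a projected Gaussian row *)

Section Projection.
Context {R : realType} {d : measure_display} {T : measurableType d} (P : probability T R).
Variables (m n : nat) (A : T -> 'M[R]_(m, n)).
Hypothesis gA : gaussian_law P A.
Variables (p : 'I_m) (s : 'rV[R]_n) (Pi : @mxspace R m n -> 'M[R]_n) (k eps : R).
Hypotheses (mPi : mx_measurable Pi) (PiE : forall (B : 'M[R]_(m, n)) v, Pi (row_set p v B) = Pi B)
  (PiT : forall B, (Pi B)^T = Pi B) (PiP : forall B, Pi B *m Pi B = Pi B)
  (Pik : forall B, k <= \tr (Pi B)) (k2 : 2 < k) (eps0 : 0 < eps).

Let z (B : @mxspace R m n) : 'rV[R]_n := row p (B : 'M[R]_(m, n)).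
Let v B := s + z B.
Let l B := v B *m Pi B.
Let q B := eps + frob (l B) (v B).
Let t B := frob s (l B).

Let frob_proj B (x y : 'rV[R]_n) : frob (x *m Pi B) y = frob (x *m Pi B) (y *m Pi B).
Proof. by rewrite -[in LHS](PiP B) mulmxA frob_mulr PiT. Qed.

Let ql B : q B = eps + frob (l B) (l B).
Proof. by rewrite /q /l frob_proj. Qed.

Let q_ge B : eps <= q B. Proof. by rewrite ql lerDl frob_ge0. Qed.

Let q_gt0 B : 0 < q B. Proof. exact: lt_le_trans (q_ge B). Qed.

Let qV B : (q B)^-1 <= eps^-1. Proof. by rewrite lef_pV2 ?posrE. Qed.

Let mz : mx_measurable z. Proof. by apply: measurable_row; exact: coord_measurable. Qed.

Let mv : mx_measurable v.
Proof. by apply: measurable_addmx => //; exact: measurable_cstmx. Qed.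

Let ml : mx_measurable l. Proof. exact: measurable_mulmx. Qed.

Let mq : measurable_fun [set: @mxspace R m n] q.
Proof. by apply: measurable_funD => //; exact: measurable_frob. Qed.

Let mqV : measurable_fun [set: @mxspace R m n] (fun B => (q B)^-1).
Proof. exact: measurable_funV. Qed.

Let mt : measurable_fun [set: @mxspace R m n] t.
Proof. by apply: measurable_frob => //; exact: measurable_cstmx. Qed.

Let has_mean_bounded_mx (f : @mxspace R m n -> R) c :
  measurable_fun [set: @mxspace R m n] f -> (forall B, `|f B| <= c) ->
  has_mean P (fun w => f (A w)).
Proof.
move=> mf fc; apply: (@has_mean_bounded _ _ _ _ _ c) => // .
exact: (measurable_comp_mx mf (gaussian_measurable gA)).
Qed.

Let Pi_diag B j : 0 <= Pi B j j <= 1.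
Proof.
have e : Pi B j j = frob (col j (Pi B)) (col j (Pi B)).
  rewrite -[in LHS](PiP B) mxE frobE; apply: eq_bigr => i _; rewrite big_ord1 !mxE.
  by rewrite -[in X in X * _](PiT B) mxE.
have h := frob_coef (col j (Pi B)) j 0; rewrite mxE -e in h.
have h0 : 0 <= Pi B j j by rewrite e frob_ge0.
by rewrite h0 /=; move: h; rewrite expr2; nra.
Qed.

Let l_coef B j : `|l B 0 j / q B| <= eps^-1 + 1.
Proof.
rewrite normrM normfV (gtr0_norm (q_gt0 B)).
have h1 : `|l B 0 j| <= 1 + l B 0 j ^+ 2.
  have -> : l B 0 j ^+ 2 = `|l B 0 j| ^+ 2 by rewrite real_normK ?num_real.
  by have := sqr_ge0 (1 - `|l B 0 j|); have := normr_ge0 (l B 0 j); rewrite !expr2; nra.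
have h2 : l B 0 j ^+ 2 <= q B.
  by rewrite ql (le_trans (frob_coef (l B) 0 j)) // lerDr ltW.
have qV0 : 0 < (q B)^-1 by rewrite invr_gt0.
apply: (@le_trans _ _ ((1 + q B) / q B)).
  by rewrite ler_pM2r // (le_trans h1) // lerD2l.
by rewrite mulrDl mul1r divff ?gt_eqF // lerD2r.
Qed.

(* The integrand of Stein's identity in entry (p, j), for coordinate j of l / q. *)
Let F j (B : @mxspace R m n) : R :=
  (B : 'M[R]_(m, n)) p j * (l B 0 j / q B) - (Pi B j j / q B - 2 * (l B 0 j / q B) ^+ 2).

Let mF j : measurable_fun [set: @mxspace R m n] (F j).
Proof.
have mlj := ml 0 j; have mPj := mPi j j; have mpj := @measurable_coord R m n p j.
have mr : measurable_fun [set: @mxspace R m n] (fun B => l B 0 j / q B) by exact: measurable_funM.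
apply: measurable_funB; first exact: measurable_funM.
apply: measurable_funB; first exact: measurable_funM.
by apply: measurable_funM; [exact: measurable_cst|exact: measurable_funX].
Qed.

Let sF j : has_mean P (fun w => F j (A w)).
Proof.
have e1 : 0 < eps^-1 by rewrite invr_gt0.
have sz := has_mean_entry gA p j.
have sn : has_mean P (fun w => `|A w p j|) by exact: (integrable_norm sz).
apply: (has_mean_le _ _ (has_meanD (has_mean_cst P (eps^-1 + 2 * (eps^-1 + 1) ^+ 2))
   (has_meanZ (eps^-1 + 1) sn))).
  exact: (measurable_comp_mx (mF j) (gaussian_measurable gA)).
move=> w; rewrite /F; set B := A w; apply: (le_trans (ler_normB _ _)).
rewrite [leRHS]addrC; apply: lerD.
  by rewrite normrM mulrC ler_wpM2r.
apply: (le_trans (ler_normB _ _)); apply: lerD.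
  have /andP[p0 p1] := Pi_diag B j.
  rewrite normrM (ger0_norm p0) normfV (gtr0_norm (q_gt0 B)) (le_trans _ (qV B)) //.
  by rewrite ler_piMl // invr_ge0 ltW.
rewrite normrM ger0_norm // ler_wpM2l // normrX lerXn2r ?nnegrE ?normr_ge0 //.
by rewrite addr_ge0 // ltW.
Qed.

Let meanF j : mean P (fun w => F j (A w)) = 0.
Proof.
apply: EFin_inj; rewrite meanE //.
rewrite (@resample_integrable _ _ _ _ _ _ _ gA p j _ (mF j) (sF j)).
under eq_integral => w _.
  rewrite (_ : (\int[normal_prob 0 1]_x (F j (mx_set p j x (A w)))%:E = 0)%E).
    over.
  pose B0 : @mxspace R m n := mx_set p j 0 (A w).
  have rs x : mx_set p j x (A w) = row_set p (row p (mx_set p j x (A w))) (A w).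
    by apply/matrixP => a b; rewrite !mxE eqxx; have [->|_] := eqVneq a p.
  have PE x : Pi (mx_set p j x (A w)) = Pi B0.
    by rewrite rs PiE /B0 rs PiE.
  have vE x : v (mx_set p j x (A w)) = v B0 + x *: delta_mx 0 j.
    rewrite /v -addrA; congr (_ + _); apply/rowP => b; rewrite /z !mxE !eqxx /=.
    by case: eqP => _; rewrite ?mulr1 ?mulr0 ?add0r ?addr0.
  have lE x : l (mx_set p j x (A w)) = l B0 + x *: row j (Pi B0).
    by rewrite /l PE vE mulmxDl -scalemxAl -rowE.
  have ljE x : l (mx_set p j x (A w)) 0 j = l B0 0 j + Pi B0 j j * x.
    by rewrite lE !mxE mulrC.
  have rj : frob (row j (Pi B0)) (v B0) = l B0 0 j.
    rewrite frobE big_ord1 /l mxE; apply: eq_bigr => i _.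
    by rewrite [row _ _ _ _]mxE mulrC -[in LHS](PiT B0) [_^T _ _]mxE.
  have qE x : q (mx_set p j x (A w)) =
      eps + frob (l B0) (v B0) + 2 * l B0 0 j * x + Pi B0 j j * x ^+ 2.
    rewrite /q lE vE; move: (v B0) (l B0) rj => v0 l0 rj; rewrite !frob_lin rj frob_delta [frob (row j _) _]frob_delta mxE.
    by rewrite expr2; ring.
  have /andP[c0 _] := Pi_diag B0 j.
  rewrite -[RHS](@stein_rational R (eps + frob (l B0) (v B0)) (l B0 0 j) (Pi B0 j j) eps eps0 c0).
    by apply: eq_integral => x _; rewrite /F ljE qE PE mx_setE.
  move=> x; rewrite -ljE -qE ql lerD2l; exact: frob_coef.
by rewrite integral0.
Qed.

(* As a function of row p, t / q is a0 after the translation by s Pi; so its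
   mean is that of the odd function a0 against the likelihood ratio w0 of the
   translation. The reflection of row p pairs the points where a0 is positive
   with those where it is negative, and w0 is larger at the former. *)
Let mean_t : 0 <= mean P (fun w => t (A w) / q (A w)).
Proof.
pose a B := t B / q B.
pose t0 B := frob s (z B *m Pi B).
pose q0 B := eps + frob (z B *m Pi B) (z B).
pose a0 B := t0 B / q0 B.
pose sg B := s *m Pi B.
have ma : measurable_fun [set: @mxspace R m n] a by exact: measurable_funM.
have msg : mx_measurable sg by apply: measurable_mulmx => //; exact: measurable_cstmx.
have mt0 : measurable_fun [set: @mxspace R m n] t0.
  by apply: measurable_frob; [exact: measurable_cstmx|exact: measurable_mulmx].
have ma0 : measurable_fun [set: @mxspace R m n] a0.
  apply: measurable_funM => //; apply: measurable_funV; apply: measurable_funD => //.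
  by apply: measurable_frob => //; exact: measurable_mulmx.
have sgE (B : 'M[R]_(m, n)) u : sg (row_set p u B) = sg B by rewrite /sg PiE.
have aE (B : 'M[R]_(m, n)) : a B = a0 (row_set p (row p B + sg B) B).
  rewrite /a /a0 /t /t0 /q /q0 /z row_setE PiE.
  have e : (row p B + sg B) *m Pi B = l B.
    by rewrite /l /v /sg !mulmxDl -mulmxA PiP addrC.
  rewrite e; congr (_ / (_ + _)).
  by rewrite /l frob_proj [RHS]frob_proj e.
pose w0 B := expR (frob (sg B) (z B) - frob (sg B) (sg B) / 2).
have mw0 : measurable_fun [set: @mxspace R m n] w0.
  apply: measurableT_comp => //; apply: measurable_funB; first exact: measurable_frob.
  by apply: measurable_funM => //; exact: measurable_frob.
have shift (f : R -> R) : measurable_fun [set: R] f -> (forall x, 0 <= f x) ->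
    (\int[P]_w (f (a (A w)))%:E = \int[P]_w (f (a0 (A w)) * w0 (A w))%:E)%E.
  move=> mf f0.
  have mfa : measurable_fun [set: @mxspace R m n] (fun B => (f (a0 B))%:E).
    by apply/measurable_EFinP; exact: (measurableT_comp mf ma0).
  have h0 (B : @mxspace R m n) : (0 <= (f (a0 B))%:E)%E by rewrite lee_fin.
  have := row_shift gA msg sgE mfa h0.
  by under eq_integral do rewrite -aE.
have mp : measurable_fun [set: R] (fun x : R => Num.max x 0) by apply: measurable_maxr.
have mn : measurable_fun [set: R] (fun x : R => Num.max (- x) 0).
  by apply: measurable_maxr => //; exact: measurable_funN.
have ge0max (x : R) : 0 <= Num.max x 0 by rewrite le_max lexx orbT.
have abnd B : `|a B| <= (frob s s / eps + 1) / 2.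
  have t1 : `|t B| <= (frob s s + frob (l B) (l B)) / 2.
    have h1 := frob_amgm s (l B) ltr01.
    have h2 := frob_amgm (- s) (l B) ltr01.
    by move: h1 h2; rewrite !frob_lin invr1 !mul1r opprK /t ler_norml => h1 h2; apply/andP; split; lra.
  rewrite /a normrM normfV (gtr0_norm (q_gt0 B)).
  rewrite ler_pdivrMr // (le_trans t1) // mulrAC ler_pM2r ?invr_gt0 // mulrDl mul1r lerD //.
    rewrite mulrAC -mulrA ler_peMr ?frob_ge0 // ler_pdivlMr // mul1r; exact: q_ge.
  by rewrite ql lerDr ltW.
have sp : has_mean P (fun w => Num.max (a (A w)) 0).
  apply: (@has_mean_bounded_mx (fun B => Num.max (a B) 0) ((frob s s / eps + 1) / 2)); first exact: (measurableT_comp mp ma).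
  by move=> B; rewrite ger0_norm ?ge0max // (le_trans _ (abnd B)) // ge_max ler_norm normr_ge0.
have sn : has_mean P (fun w => Num.max (- a (A w)) 0).
  apply: (@has_mean_bounded_mx (fun B => Num.max (- a B) 0) ((frob s s / eps + 1) / 2)); first exact: (measurableT_comp mn ma).
  by move=> B; rewrite ger0_norm ?ge0max // (le_trans _ (abnd B)) // ge_max normr_ge0 -normrN ler_norm.
have -> : mean P (fun w => t (A w) / q (A w)) =
   mean P (fun w => Num.max (a (A w)) 0 - Num.max (- a (A w)) 0).
  congr mean; apply/funext => w; rewrite -/(a (A w)).
  by case: (lerP (a (A w)) 0) => h; case: (lerP (- a (A w)) 0) => h'; lra.
rewrite meanB // subr_ge0 -lee_fin !meanE //.
rewrite (shift _ mp (fun x => ge0max x)) (shift _ mn (fun x => ge0max (- x))).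
pose g (B : @mxspace R m n) : \bar R := (Num.max (- a0 B) 0 * w0 B)%:E.
have mg : measurable_fun [set: @mxspace R m n] g.
  by apply/measurable_EFinP; apply: measurable_funM => //; exact: (measurableT_comp mn ma0).
have g0 B : (0 <= g B)%E by rewrite lee_fin mulr_ge0 ?expR_ge0.
rewrite -/(g _) -(row_flip gA p mg g0).
apply: ge0_le_integral => //.
- have mfl : mx_measurable (fun w => row_set p (- row p (A w)) (A w)).
    apply: measurable_row_set; last exact: (gaussian_measurable gA).
    by apply: measurable_oppmx; apply: measurable_row; exact: (gaussian_measurable gA).
  exact: (measurable_comp_mx mg mfl).
- apply/measurable_EFinP.
  apply: (measurable_comp_mx (f := fun B => Num.max (a0 B) 0 * w0 B) _ (gaussian_measurable gA)).
  by apply: measurable_funM => //; exact: (measurableT_comp mp ma0).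
move=> w _; rewrite lee_fin; set B := A w.
have zN : z (row_set p (- row p B) B) = - z B by rewrite /z row_setE.
have aN : a0 (row_set p (- row p B) B) = - a0 B.
  by rewrite /a0 /t0 /q0 zN PiE !mulNmx !frob_lin opprK mulNr.
have wN : w0 (row_set p (- row p B) B) = expR (- frob (sg B) (z B) - frob (sg B) (sg B) / 2).
  by rewrite /w0 zN sgE frobNr.
rewrite aN wN opprK.
have [h|h] := lerP (a0 B) 0; first by rewrite !mul0r.
apply: ler_wpM2l; first exact: ltW.
rewrite ler_expR lerD2r.
have : 0 < t0 B.
  move: h; rewrite /a0 pmulr_lgt0 // invr_gt0 /q0 frob_proj.
  by rewrite ltr_wpDr ?frob_ge0.
have -> : frob (sg B) (z B) = t0 B.
  by rewrite /t0 /sg frob_mulr PiT.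
lra.
Qed.

(** Write l = (s + z) Pi and q = eps + |l|^2, with z the Gaussian row. The sum
    over the coordinates of Stein's identities for l / q is E[<z, l> / q] = E[tr
    Pi / q - 2 |l|^2 / q^2]. Here <z, l> = |l|^2 - <s, l> <= q - <s, l> and
    |l|^2 <= q, whence (k - 2) E[1 / q] <= 1 - E[<s, l> / q], and the last mean
    is nonnegative. *)
Lemma projection_bound :
  mean P (fun w => (eps + frob ((s + row p (A w)) *m Pi (A w)) (s + row p (A w)))^-1) <= (k - 2)^-1.
Proof.
have k20 : 0 < k - 2 by rewrite subr_gt0.
rewrite -[leRHS]mul1r ler_pdivlMr //.
have sq : has_mean P (fun w => (q (A w))^-1).
  apply: (@has_mean_bounded_mx (fun B => (q B)^-1) eps^-1) => // B.
  by rewrite ger0_norm ?invr_ge0 // ltW.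
have st : has_mean P (fun w => t (A w) / q (A w)).
  apply: (@has_mean_bounded_mx (fun B => t B / q B) (\sum_j `|s 0 j| * (eps^-1 + 1))).
    exact: measurable_funM.
  move=> B; rewrite /t frobE big_ord1 mulr_suml (le_trans (ler_norm_sum _ _ _)) //.
  by apply: ler_sum => j _; rewrite -mulrA normrM ler_wpM2l.
have sum0 : mean P (fun w => \sum_j F j (A w)) = 0.
  by rewrite mean_sum //; apply: big1 => j _; exact: meanF.
have : mean P (fun w => \sum_j F j (A w)) <=
    mean P (fun w => 1 - t (A w) / q (A w) - (k - 2) * (q (A w))^-1).
  apply: mean_le.
  - exact: has_mean_sum.
  - by apply: has_meanB; [apply: has_meanB => //; exact: has_mean_cst|exact: has_meanZ].
  move=> w; set B := A w.
  have -> : \sum_j F j B = frob (z B) (l B) / q B - (\tr (Pi B) / q B - 2 * (frob (l B) (l B) / q B / q B)).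
    rewrite /F sumrB sumrB -mulr_sumr; congr (_ - (_ - 2 * _)).
    - rewrite frobE big_ord1 mulr_suml; apply: eq_bigr => j _.
      by rewrite mulrA [z B ord0 j]mxE.
    - by rewrite /mxtrace mulr_suml.
    - rewrite frobE big_ord1 !mulr_suml; apply: eq_bigr => j _.
      by rewrite expr2 mulrACA mulrA.
  have e1 : frob (z B) (l B) = frob (l B) (l B) - t B.
    have -> : z B = v B - s by rewrite /v addrC addKr.
    by rewrite frobBl (frobC (v B)) {1}/l frob_proj.
  have e2 : frob (l B) (l B) = q B - eps by rewrite ql addrAC subrr add0r.
  have qi : 0 < (q B)^-1 by rewrite invr_gt0.
  rewrite e1 e2; have qq : q B * (q B)^-1 = 1 by rewrite divff // gt_eqF.
  have := Pik B; move: qq qi; set iq := (q B)^-1 => qq qi hk.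
  have -> : (q B - eps - t B) * iq = 1 - eps * iq - t B * iq by rewrite !mulrBl qq.
  have -> : (q B - eps) * iq * iq = iq - eps * iq * iq by rewrite mulrBl qq mulrBl mul1r.
  have h1 : 0 <= eps * iq by rewrite mulr_ge0 ?ltW.
  have h2 : 0 <= eps * iq * iq by rewrite mulr_ge0 // ltW.
  have h3 : k * iq <= \tr (Pi B) * iq by rewrite ler_pM2r.
  lra.
have s1 : has_mean P (fun w => 1 - t (A w) / q (A w)).
  by apply: has_meanB => //; exact: has_mean_cst.
have s2 : has_mean P (fun w => (k - 2) * (q (A w))^-1) by exact: has_meanZ.
rewrite sum0 (meanB s1 s2) (meanB (has_mean_cst P 1) st) (meanZ _ sq) mean_cst.
rewrite (mulrC (k - 2)); move: mean_t; lra.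
Qed.

End Projection.

(** * Full rank almost surely *)

Section Zero_indicator.
Context {R : realType} {d : measure_display} {T : measurableType d}.

Lemma eq0_indic (f : T -> R) : (fun w => (f w == 0)%:R : R) = \1_(f @^-1` [set 0]).
Proof.
apply/funext => w; rewrite indicE; congr (nat_of_bool _)%:R; apply/idP/idP.
  by move=> /eqP h; rewrite inE.
by move=> /set_mem /= ->.
Qed.

Lemma measurable_preimage0 (f : T -> R) : measurable_fun [set: T] f ->
  measurable (f @^-1` [set 0]).
Proof. by move=> mf; rewrite -[X in measurable X]setTI; apply: mf => //; exact: measurable_set1. Qed.

Lemma measurable_eq0 (f : T -> R) : measurable_fun [set: T] f ->
  measurable_fun [set: T] (fun w => (f w == 0)%:R : R).
Proof.
move=> mf; rewrite eq0_indic; apply: measurable_indic; exact: measurable_preimage0.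
Qed.

Lemma integral_eq0 (P : probability T R) (f : T -> R) : measurable_fun [set: T] f ->
  (\int[P]_w ((f w == 0)%:R)%:E = P (f @^-1` [set (0 : R)%R]))%E.
Proof.
move=> mf; have /= -> := eq_integral _ _ (fun w _ => congr1 (fun g => (g w)%:E) (eq0_indic f)).
by rewrite integral_indic ?setIT //; exact: measurable_preimage0.
Qed.

End Zero_indicator.

Section Off_null_set.
Context {R : realType} {d : measure_display} {T : measurableType d}.
Import HBNNSimple.
Local Open Scope ereal_scope.

(** The integral of a nonnegative function is a supremum over simple functions
    below it, and a simple function can be truncated to 0 on N; hence neither f
    nor g has to be measurable. *)
Lemma le_integral_off_null (mu : {measure set T -> \bar R}) (N : set T) (f g : T -> \bar R) :
  measurable N -> mu N = 0 -> (forall x, 0 <= f x) -> (forall x, 0 <= g x) ->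
  (forall x, ~ N x -> f x <= g x) -> \int[mu]_x f x <= \int[mu]_x g x.
Proof.
move=> mN N0 f0 g0 fg; rewrite ge0_integralTE //.
apply: ge_ereal_sup => _ [h hf <-].
pose h' := mul_nnsfun h (indic_nnsfun R (measurableC mN)).
have h'E x : h' x = (h x * \1_(~` N) x)%R by [].
have sE (k : {nnsfun T >-> R}) : sintegral mu k = \int[mu]_(x in [set: T] `\` N) (k x)%:E.
  have := integral_nnsfun mu measurableT k; rewrite patch_setT => <-.
  apply: ge0_negligible_integral => //; last by move=> x _; rewrite lee_fin.
  exact/measurable_EFinP.
have -> : sintegral mu h = sintegral mu h'.
  rewrite !sE; apply: eq_integral => x; rewrite inE => -[_ nx].
  by rewrite h'E indicE mem_set // mulr1.
rewrite ge0_integralTE //; apply: ereal_sup_ubound; exists h' => // x.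
rewrite h'E indicE; have [xN|xN] := pselect (N x).
  by rewrite memNset ?mulr0 //=; exact.
by rewrite mem_set // mulr1 (le_trans (hf x)) // fg.
Qed.

End Off_null_set.

Section Full_rank_almost_surely.
Context {R : realType}.

Lemma gaussian_affine_zero (a b : R) :
  (\int[normal_prob 0 1]_x ((a + x * b == 0)%:R)%:E <= ((b == 0)%:R)%:E)%E.
Proof.
have mf : measurable_fun [set: R] (fun x : R => a + x * b).
  by apply: measurable_funD => //; exact: measurable_funM.
have := @integral_eq0 _ _ _ (normal_prob (0 : R) 1) _ mf => ->.
have [b0|b0] := eqVneq b 0.
  by apply: probability_le1; exact: measurable_preimage0.
have -> : (fun x => a + x * b) @^-1` [set 0] = [set - a / b].
  apply/seteqP; split=> x /=.
    move=> h; have -> : - a = x * b by apply/eqP; rewrite eq_sym -addr_eq0 addrC h.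
    by rewrite mulfK.
  by move=> ->; rewrite divfK // subrr.
have /null_content_dominatesP h := @normal_prob_dominates R 0 1.
have e := h [set - a / b] (measurable_set1 _) (lebesgue_measure_set1 _).
by rewrite le_eqVlt; apply/orP; left; apply/eqP; exact: e.
Qed.

Lemma eq_cofactor n (i j : 'I_n) (M N : 'M[R]_n) :
  (forall k l, k != i -> M k l = N k l) -> cofactor M i j = cofactor N i j.
Proof.
move=> h; rewrite /cofactor; congr (_ * \det _); apply/matrixP => a b.
by rewrite !mxE; apply: h; rewrite eq_sym neq_lift.
Qed.

Variables (m n : nat).
Hypothesis mn : (m <= n)%N.

Let io : 'I_m -> 'I_n := widen_ord mn.

(** Interpolates between the identity (k = 0) and the leading square block of
    W (k = m); the determinant at k + 1 is affine in one entry of row k, with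
    the determinant at k as slope. *)
Definition partial_minor (k : nat) (W : 'M[R]_(m, n)) : 'M[R]_m :=
  \matrix_(i, j) if (i < k)%N then W i (io j) else (i == j)%:R.

Lemma partial_minor_affine (k : 'I_m) (S B : 'M[R]_(m, n)) :
  exists a, forall x, \det (partial_minor k.+1 (S + mx_set k (io k) x B)) =
    a + x * \det (partial_minor k (S + B)).
Proof.
have d0 : \det (partial_minor k (S + B)) = cofactor (partial_minor k (S + B)) k k.
  rewrite (expand_det_row _ k) (bigD1 k) //= big1 ?addr0 => [|j jk]; rewrite mxE ltnn.
    by rewrite eqxx mul1r.
  by rewrite eq_sym (negbTE jk) mul0r.
have cE j x : cofactor (partial_minor k.+1 (S + mx_set k (io k) x B)) k j =
    cofactor (partial_minor k (S + B)) k j.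
  apply: eq_cofactor => i l ik; rewrite !mxE ltnS leq_eqVlt.
  have -> : (i == k :> nat) = false by apply/negbTE; rewrite -val_eqE in ik.
  by rewrite /= (negbTE ik).
pose C := partial_minor k (S + B).
exists (S k (io k) * cofactor C k k + \sum_(j | j != k) (S + B) k (io j) * cofactor C k j) => x.
rewrite (expand_det_row _ k) (bigD1 k) //= cE d0 -/C !mxE leqnn !eqxx /= mulrDl -!addrA.
congr (_ + _); rewrite addrC; congr (_ + _).
apply: eq_bigr => j jk; rewrite cE !mxE leqnn eqxx /=.
by have -> : (io j == io k) = false by apply/negbTE; rewrite -val_eqE.
Qed.

Lemma full_rank_gram (W : 'M[R]_(m, n)) :
  \det (partial_minor m W) != 0 -> \det (W *m W^T) != 0.
Proof.
move=> h; have uB : (partial_minor m W)^T \in unitmx by rewrite unitmx_tr unitmxE unitfE.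
rewrite -unitfE -unitmxE; apply: posdef_unit; apply/posdefE; split.
  by rewrite trmx_mul trmxK.
move=> v v0; rewrite lt_def -mulmxA.
have -> : frob v (W *m (W^T *m v)) = frob (W^T *m v) (W^T *m v) by rewrite frobC frob_mull.
rewrite frob_ge0 andbT; apply: contra v0 => /eqP f0.
have w0 : W^T *m v = 0 by apply: frob_eq0; rewrite f0.
have : (partial_minor m W)^T *m v = 0.
  apply/colP => i; have e : (W^T *m v) (io i) 0 = 0 by rewrite w0 mxE.
  rewrite mxE [RHS]mxE -[RHS]e mxE.
  by apply: eq_bigr => j _; rewrite !mxE ltn_ord.
by move=> /(congr1 (mulmx (invmx (partial_minor m W)^T))); rewrite mulKmx // mulmx0 => ->.
Qed.

Variables (d : measure_display) (T : measurableType d) (P : probability T R).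
Variable A : T -> 'M[R]_(m, n).
Hypothesis gA : gaussian_law P A.

Lemma measurable_partial_minor k d' (T' : measurableType d') (F : T' -> 'M[R]_(m, n)) :
  mx_measurable F -> mx_measurable (fun w => partial_minor k (F w)).
Proof.
move=> mF i j; have -> : (fun w => partial_minor k (F w) i j) =
    if (i < k)%N then (fun w => F w i (io j)) else fun=> (i == j)%:R.
  by apply/funext => w; rewrite mxE; case: ifP.
by case: ifP => _; [exact: mF|exact: measurable_cst].
Qed.

Let measurable_shift S : mx_measurable (fun B : @mxspace R m n => S + (B : 'M[R]_(m, n))).
Proof. by apply: measurable_addmx; [exact: measurable_cstmx|exact: coord_measurable]. Qed.

(** Conditionally on the other entries, the determinant at step k + 1 is an
    affine function of one Gaussian entry; its slope is nonzero by induction,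
    and a nonconstant affine function has a single, hence null, zero. *)
Lemma partial_minor_null S k : (k <= m)%N ->
  (\int[P]_w ((\det (partial_minor k (S + A w)) == 0)%:R)%:E = 0)%E.
Proof.
have mdet l : measurable_fun [set: @mxspace R m n]
    (fun B : @mxspace R m n => ((\det (partial_minor l (S + (B : 'M[R]_(m, n)))) == 0)%:R : R)%:E).
  apply/measurable_EFinP; apply: measurable_eq0; apply: measurable_det.
  exact: measurable_partial_minor (measurable_shift S).
elim: k => [_|k IH km].
  rewrite integral0_eq // => w _.
  have -> : partial_minor 0 (S + A w) = 1%:M by apply/matrixP => i j; rewrite !mxE.
  by rewrite det1 oner_eq0.
have e0 B : (0 <= ((\det (partial_minor k.+1 (S + (B : 'M[R]_(m, n)))) == 0)%:R : R)%:E)%E.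
  by rewrite lee_fin ler0n.
rewrite (resample gA (Ordinal km) (io (Ordinal km)) (mdet k.+1) e0).
apply/eqP; rewrite eq_le; apply/andP; split; last first.
  by apply: integral_ge0 => w _; apply: integral_ge0 => x _; rewrite lee_fin.
rewrite -[leRHS](IH (ltnW km)).
apply: (@le_integral_off_null _ _ _ _ set0) => //.
- by move=> w; apply: integral_ge0 => x _; rewrite lee_fin.
move=> w _; have [a ha] := partial_minor_affine (Ordinal km) S (A w).
rewrite (_ : (fun x => _) = fun x => ((a + x * \det (partial_minor k (S + A w)) == 0)%:R)%:E).
  exact: gaussian_affine_zero.
by apply/funext => x; rewrite -ha.
Qed.

Lemma gaussian_full_rank S : P [set w | \det ((S + A w) *m (S + A w)^T) = 0] = 0%E.
Proof.
have ms : mx_measurable (fun w => S + A w).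
  by apply: measurable_addmx; [exact: measurable_cstmx|exact: (gaussian_measurable gA)].
have mg : measurable_fun [set: T] (fun w => \det ((S + A w) *m (S + A w)^T)).
  by apply: measurable_det; apply: measurable_mulmx => //; exact: measurable_trmx.
have mp : measurable_fun [set: T] (fun w => \det (partial_minor m (S + A w))).
  by apply: measurable_det; exact: measurable_partial_minor.
apply/eqP; rewrite eq_le measure_ge0 andbT.
rewrite -[leRHS](partial_minor_null S (leqnn m)) integral_eq0 //.
apply: le_measure; rewrite ?inE; try exact: measurable_preimage0.
move=> w /= h; apply/eqP; apply: contraT => /full_rank_gram; by rewrite h eqxx.
Qed.

End Full_rank_almost_surely.

(** * The Schur complement of a row *)

Section Pivot_row.
Context {R : realType}.
Variables (m n : nat).
Implicit Types W : 'M[R]_(m, n).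

Lemma gram_posdef W : \det (W *m W^T) != 0 -> posdef (W *m W^T).
Proof. by move=> h; apply: psd_unit_posdef; [exact: psd_gramr|rewrite unitmxE unitfE]. Qed.

(** The value 0 at singular W makes the form nonnegative everywhere. *)
Definition inv_gram_form (u : 'cV[R]_m) W : R :=
  if \det (W *m W^T) == 0 then 0 else frob u (invmx (W *m W^T) *m u).

Lemma inv_gram_form_ge0 u W : 0 <= inv_gram_form u W.
Proof.
rewrite /inv_gram_form; case: ifPn => // /gram_posdef /posdef_inv h.
by apply: psd_frob; exact: posdef_psd.
Qed.

Lemma measurable_inv_gram_form d (T : measurableType d) u (F : T -> 'M[R]_(m, n)) :
  mx_measurable F -> measurable_fun [set: T] (fun w => inv_gram_form u (F w)).
Proof.
move=> mF; have mG : mx_measurable (fun w => F w *m (F w)^T).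
  by apply: measurable_mulmx => //; exact: measurable_trmx.
apply: measurable_fun_ifT.
- by apply: measurable_fun_eqr => //; exact: measurable_det.
- exact: measurable_cst.
- apply: measurable_frob; first exact: measurable_cstmx.
  by apply: measurable_mulmx; [exact: measurable_invmx|exact: measurable_cstmx].
Qed.

Variable p : 'I_m.

Definition other_rows W : 'M[R]_(m, n) := row_set p 0 W.

Definition other_gram W : 'M[R]_m := other_rows W *m (other_rows W)^T + delta_mx p p.

(** The orthogonal projection onto the complement of the span of the rows of W
    other than row p; adding delta_mx p p makes the Gram matrix of those rows
    invertible without changing the projection. *)
Definition pivot_proj W : 'M[R]_n :=
  if \det (other_gram W) == 0 then 1%:M
  else 1%:M - (other_rows W)^T *m invmx (other_gram W) *m other_rows W.

Lemma other_rows_row_set v W : other_rows (row_set p v W) = other_rows W.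
Proof. exact: row_setK. Qed.

Lemma pivot_proj_row_set v W : pivot_proj (row_set p v W) = pivot_proj W.
Proof. by rewrite /pivot_proj /other_gram other_rows_row_set. Qed.

Lemma other_gram_sym W : (other_gram W)^T = other_gram W.
Proof. by rewrite /other_gram linearD /= trmx_mul trmxK trmx_delta. Qed.

Lemma delta_other_rows W : delta_mx p p *m other_rows W = 0.
Proof. by rewrite delta_mulmx; apply/matrixP => i j; rewrite !mxE eqxx mulr0. Qed.

Lemma other_gram_delta W : other_gram W *m delta_mx p p = delta_mx p p.
Proof.
have h : (other_rows W)^T *m delta_mx p p = 0.
  by rewrite -[LHS]trmxK trmx_mul trmxK trmx_delta delta_other_rows trmx0.
by rewrite /other_gram mulmxDl -mulmxA h mulmx0 add0r mul_delta_mx.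
Qed.

Section Unit.
Variable W : 'M[R]_(m, n).
Hypothesis uG : other_gram W \in unitmx.

Lemma inv_other_gram_delta : invmx (other_gram W) *m delta_mx p p = delta_mx p p.
Proof. by rewrite -[X in _ *m X](other_gram_delta W) mulKmx. Qed.

Lemma delta_inv_other_gram : delta_mx p p *m invmx (other_gram W) = delta_mx p p.
Proof.
by rewrite -[LHS]trmxK trmx_mul trmx_delta trmx_inv other_gram_sym inv_other_gram_delta trmx_delta.
Qed.

Lemma other_rows_gram : other_rows W *m (other_rows W)^T = other_gram W - delta_mx p p.
Proof. by rewrite addrK. Qed.

Lemma pivot_projE :
  pivot_proj W = 1%:M - (other_rows W)^T *m invmx (other_gram W) *m other_rows W.
Proof. by move: uG; rewrite /pivot_proj unitmxE unitfE => /negbTE ->. Qed.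

Lemma other_rows_proj : other_rows W *m pivot_proj W = 0.
Proof.
rewrite pivot_projE mulmxBr mulmx1 !mulmxA other_rows_gram mulmxBl mulmxV // delta_inv_other_gram.
by rewrite mulmxBl mul1mx delta_other_rows subr0 subrr.
Qed.

End Unit.

Lemma pivot_proj_sym W : (pivot_proj W)^T = pivot_proj W.
Proof.
rewrite /pivot_proj; case: ifP => _; first exact: trmx1.
by rewrite linearB /= trmx1 !trmx_mul trmxK trmx_inv other_gram_sym mulmxA.
Qed.

Lemma pivot_proj_idem W : pivot_proj W *m pivot_proj W = pivot_proj W.
Proof.
have [u|u] := boolP (other_gram W \in unitmx).
  by rewrite [X in X *m _](pivot_projE u) mulmxBl mul1mx -!mulmxA other_rows_proj // !mulmx0 subr0.
by move: u; rewrite unitmxE unitfE negbK /pivot_proj => /eqP ->; rewrite eqxx mulmx1.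
Qed.

(** The trace is n - (m - 1) in the invertible case and n otherwise. *)
Lemma pivot_proj_trace W : n%:R - m%:R + 1 <= \tr (pivot_proj W).
Proof.
have m1 : 1 <= m%:R :> R by rewrite ler1n; case: m p => // -[].
have [u|u] := boolP (other_gram W \in unitmx); last first.
  move: u; rewrite unitmxE unitfE negbK /pivot_proj => /eqP ->; rewrite eqxx mxtrace1; lra.
rewrite (pivot_projE u) linearB /= mxtrace1 -mulmxA mxtrace_mulC -mulmxA other_rows_gram.
rewrite mulmxBr mulVmx // inv_other_gram_delta // linearB /= mxtrace1.
have -> : \tr (delta_mx p p : 'M[R]_m) = 1.
  by rewrite trace_frob frob_delta mxE eqxx.
lra.
Qed.

(** Schur complement: the (p, p) entry of the inverse Gram matrix is the inverse
    of the squared distance of row p to the span of the other rows. *)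
Lemma inv_gram_pivot W : \det (W *m W^T) != 0 ->
  let q := frob (row p W *m pivot_proj W) (row p W) in
  0 < q /\ inv_gram_form (delta_mx p 0) W = q^-1.
Proof.
move=> dW; set r := row p W; set q := frob _ _ => /=.
have pW := gram_posdef dW; have uW := posdef_unit pW.
have WE : W = other_rows W + delta_mx p 0 *m r.
  apply/matrixP => i j; rewrite !mxE big_ord1 !mxE eqxx andbT.
  by have [->|ip] := eqVneq i p; rewrite ?mul1r ?add0r // mul0r addr0.
have WtE (y : 'cV[R]_m) : y p 0 = 0 -> (other_rows W)^T *m y = W^T *m y.
  move=> y0; rewrite [in RHS]WE linearD /= mulmxDl trmx_mul -mulmxA trmx_delta.
  have -> : delta_mx 0 p *m y = 0 :> 'M[R]_1.
    by rewrite -rowE; apply/rowP => j; rewrite !mxE ord1.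
  by rewrite mulmx0 addr0.
have W_inj (y : 'cV[R]_m) : W^T *m y = 0 -> y = 0.
  move=> h; have := congr1 (mulmx W) h; rewrite mulmxA mulmx0 => /(congr1 (mulmx (invmx (W *m W^T)))).
  by rewrite mulKmx // mulmx0.
have uG : other_gram W \in unitmx.
  apply: posdef_unit; apply/posdefE; split; first exact: other_gram_sym.
  move=> y y0; have e : frob y (other_gram W *m y) =
      frob ((other_rows W)^T *m y) ((other_rows W)^T *m y) + y p 0 ^+ 2.
    rewrite /other_gram mulmxDl frobDr -mulmxA [frob y (other_rows W *m _)]frobC frob_mull.
    congr (_ + _); rewrite delta_mulmx frobE (bigD1 p) //= big_ord1 !mxE eqxx mul1r -expr2.
    by rewrite big1 ?addr0 // => i ip; rewrite big_ord1 !mxE (negbTE ip) mul0r mulr0.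
  rewrite e lt_def addr_ge0 ?frob_ge0 ?sqr_ge0 // andbT; apply: contra y0.
  rewrite paddr_eq0 ?frob_ge0 ?sqr_ge0 // => /andP[/eqP f0]; rewrite sqrf_eq0 => /eqP yp0.
  apply/eqP; apply: W_inj; rewrite -(WtE _ yp0); apply: frob_eq0; by rewrite f0.
pose y := invmx (other_gram W) *m (other_rows W *m r^T).
have yp : y p 0 = 0.
  have : delta_mx p p *m y = 0.
    by rewrite /y mulmxA delta_inv_other_gram // mulmxA delta_other_rows mul0mx.
  by move=> /matrixP/(_ p 0); rewrite delta_mulmx !mxE eqxx mul1r.
have xE : pivot_proj W *m r^T = W^T *m (delta_mx p 0 - y).
  rewrite pivot_projE // mulmxBl mul1mx -!mulmxA -/y (WtE _ yp) mulmxBr; congr (_ - _).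
  by rewrite -colE tr_row.
have WP : W *m (pivot_proj W *m r^T) = q *: delta_mx p 0.
  rewrite [X in X *m (_ *m _)]WE mulmxDl !mulmxA other_rows_proj // mul0mx add0r -!mulmxA.
  have -> : r *m (pivot_proj W *m r^T) = q%:M.
    rewrite [LHS]mx11_scalar; congr (_%:M).
    rewrite mulmxA mxE /q frobE big_ord1; apply: eq_bigr => j _; by rewrite [r^T _ _]mxE.
  by rewrite mul_mx_scalar.
have q0 : q != 0.
  apply/eqP => q0; move: WP; rewrite q0 scale0r xE mulmxA.
  move=> /(congr1 (mulmx (invmx (W *m W^T)))); rewrite mulKmx // mulmx0.
  move=> /matrixP/(_ p 0); rewrite mxE [RHS]mxE [delta_mx _ _ _ _]mxE !eqxx mxE yp => /eqP.
  by rewrite subr0 oner_eq0.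
have qge : 0 <= q.
  by rewrite /q -[in X in frob X]pivot_proj_idem mulmxA frob_mulr pivot_proj_sym frob_ge0.
split; first by rewrite lt_def q0.
rewrite /inv_gram_form (negbTE dW).
have -> : invmx (W *m W^T) *m delta_mx p 0 = q^-1 *: (delta_mx p 0 - y).
  have := WP; rewrite xE mulmxA => /(congr1 (mulmx (invmx (W *m W^T)))).
  by rewrite mulKmx // -scalemxAr => ->; rewrite scalerA mulVf // scale1r.
by rewrite frobZr frobC frob_delta mxE [delta_mx _ _ _ _]mxE !eqxx mxE yp subr0 mulr1.
Qed.

End Pivot_row.

(** * The moment of the inverse Gram matrix *)

Section Inverse_gram_moment.
Context {R : realType} {d : measure_display} {T : measurableType d} (P : probability T R).
Variables (m n : nat) (A : T -> 'M[R]_(m, n)).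
Hypothesis gA : gaussian_law P A.
Hypothesis mn : (m + 2 <= n)%N.

Let measurable_shifted (S : 'M[R]_(m, n)) : mx_measurable (fun w => S + A w).
Proof. by apply: measurable_addmx; [exact: measurable_cstmx|exact: (gaussian_measurable gA)]. Qed.

Lemma measurable_pivot_proj d' (T' : measurableType d') p (F : T' -> 'M[R]_(m, n)) :
  mx_measurable F -> mx_measurable (fun w => pivot_proj p (F w)).
Proof.
move=> mF; have mV : mx_measurable (fun w => other_rows p (F w)).
  by apply: measurable_row_set => //; exact: measurable_cstmx.
have mG : mx_measurable (fun w => other_gram p (F w)).
  apply: measurable_addmx; last exact: measurable_cstmx.
  by apply: measurable_mulmx => //; exact: measurable_trmx.
move=> i j; have -> : (fun w => pivot_proj p (F w) i j) =
  (fun w => if \det (other_gram p (F w)) == 0 then (1%:M : 'M[R]_n) i j else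
     (1%:M + - ((other_rows p (F w))^T *m invmx (other_gram p (F w)) *m other_rows p (F w))) i j).
  by apply/funext => w; rewrite /pivot_proj; case: ifP.
apply: measurable_fun_ifT.
- by apply: measurable_fun_eqr => //; exact: measurable_det.
- exact: measurable_cst.
apply: measurable_addmx; first exact: measurable_cstmx.
apply: measurable_oppmx; apply: measurable_mulmx => //; apply: measurable_mulmx.
  exact: measurable_trmx.
exact: measurable_invmx.
Qed.

Let c : R := (n%:R - m%:R - 1)^-1.

Let mn_gt0 : 0 < n%:R - m%:R - 1 :> R.
Proof. have : (m + 2)%:R <= n%:R :> R by rewrite ler_nat. by rewrite natrD; lra. Qed.

(** projection_bound for k = n - m + 1 and eps = 1 / (i + 1); the integrands
    increase to the inverse of the squared distance as i grows. *)
Lemma inv_gram_pivot_moment p S :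
  (\int[P]_w (inv_gram_form (delta_mx p 0) (S + A w))%:E <= c%:E)%E.
Proof.
pose Pi (B : @mxspace R m n) := pivot_proj p (S + (B : 'M[R]_(m, n))).
have mPi : mx_measurable Pi.
  apply: measurable_pivot_proj.
  by apply: measurable_addmx; [exact: measurable_cstmx|exact: coord_measurable].
have PiE (B : 'M[R]_(m, n)) v : Pi (row_set p v B) = Pi B.
  rewrite /Pi -(pivot_proj_row_set p (row p S + v) (S + B)); congr pivot_proj.
  by apply/matrixP => i j; rewrite !mxE; have [->|_] := eqVneq i p.
pose q w := frob ((row p S + row p (A w)) *m Pi (A w)) (row p S + row p (A w)).
have qE w : q w = frob (row p (S + A w) *m pivot_proj p (S + A w)) (row p (S + A w)).
  by rewrite linearD.
have q0 w : 0 <= q w.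
  rewrite qE -[in X in frob X]pivot_proj_idem mulmxA frob_mulr pivot_proj_sym; exact: frob_ge0.
have mq : measurable_fun [set: T] q.
  have mr : mx_measurable (fun w => row p S + row p (A w)).
    apply: measurable_addmx; first exact: measurable_cstmx.
    by apply: measurable_row; exact: (gaussian_measurable gA).
  apply: measurable_frob => //; apply: measurable_mulmx => //.
  apply: measurable_pivot_proj; exact: measurable_shifted.
pose e i : R := harmonic i.
have e0 i : 0 < e i by rewrite /e /= invr_gt0 ltr0n.
have eq0 i w : 0 < e i + q w by rewrite ltr_pwDl.
pose dt w := \det ((S + A w) *m (S + A w)^T).
pose f i w := if dt w == 0 then 0 else (e i + q w)^-1.
have mi i : measurable_fun [set: T] (fun w => (e i + q w)^-1).
  by apply: measurable_funV; exact: measurable_funD.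
have mdt : measurable_fun [set: T] dt.
  apply: measurable_det; apply: measurable_mulmx; first exact: measurable_shifted.
  by apply: measurable_trmx; exact: measurable_shifted.
have mf i : measurable_fun [set: T] (f i).
  by apply: measurable_fun_ifT => //; exact: measurable_fun_eqr.
have f0 i w : 0 <= f i w by rewrite /f; case: ifP => // _; rewrite invr_ge0 ltW.
have fc i : (\int[P]_w (f i w)%:E <= c%:E)%E.
  apply: (@le_trans _ _ (\int[P]_w ((e i + q w)^-1)%:E)%E).
    apply: (@le_integral_off_null _ _ _ _ set0) => //.
    - by move=> w; rewrite lee_fin.
    - by move=> w; rewrite lee_fin invr_ge0 ltW.
    - by move=> w _; rewrite lee_fin /f; case: ifP => // _; rewrite invr_ge0 ltW.
  rewrite -meanE; last first.
    apply: (@has_mean_bounded _ _ _ P _ (e i)^-1) => // w.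
    by rewrite ger0_norm ?invr_ge0 ?(ltW (eq0 _ _)) // lef_pV2 ?posrE // lerDl.
  rewrite lee_fin.
  have k2 : 2 < n%:R - m%:R + 1 :> R by have := mn_gt0; lra.
  have -> : c = (n%:R - m%:R + 1 - 2)^-1 by rewrite /c; congr (_^-1); ring.
  have PiT B : (Pi B)^T = Pi B by exact: pivot_proj_sym.
  have PiP B : Pi B *m Pi B = Pi B by exact: pivot_proj_idem.
  have Pik B : n%:R - m%:R + 1 <= \tr (Pi B) by exact: pivot_proj_trace.
  exact: (projection_bound gA (row p S) mPi PiE PiT PiP Pik k2 (e0 i)).
have fg w : (f i w)%:E @[i --> \oo] --> (inv_gram_form (delta_mx p 0) (S + A w))%:E.
  apply: cvg_EFin; first exact: nearW.
  rewrite (_ : fine \o _ = fun i => f i w) //.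
  have [dw|dw] := eqVneq (dt w) 0.
    have -> : (fun i => f i w) = fun=> 0 by apply/funext => i; rewrite /f dw eqxx.
    by rewrite /inv_gram_form -/(dt w) dw eqxx; exact: cvg_cst.
  have [qw ->] := inv_gram_pivot p dw; rewrite -qE in qw *.
  have -> : (fun i => f i w) = fun i => (e i + q w)^-1.
    by apply/funext => i; rewrite /f (negbTE dw).
  apply: cvgV; first by rewrite gt_eqF.
  rewrite -[X in _ --> X]add0r; apply: cvgD; [exact: cvg_harmonic|exact: cvg_cst].
have nd w : [set: T] w -> {homo (fun i => (f i w)%:E) : i j / (i <= j)%N >-> (i <= j)%E}.
  move=> _ i j ij; rewrite lee_fin /f; case: ifP => // _.
  by rewrite lef_pV2 ?posrE // lerD2r /e /= lef_pV2 ?posrE ?ltr0n // ler_nat.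
have h := @cvg_monotone_convergence _ T R P [set: T] measurableT (fun i w => (f i w)%:E)
  (fun i => (measurable_EFinP _ _).2 (mf i)) (fun i w _ => f0 i w) nd.
have -> : (\int[P]_w (inv_gram_form (delta_mx p 0) (S + A w))%:E =
    \int[P]_w limn (fun i => (f i w)%:E))%E.
  by apply: eq_integral => w _; apply/esym/cvg_lim => //; exact: fg.
by apply: (cvge_to_le h); exact: nearW.
Qed.

Lemma trmx_rotmx (p k : 'I_m) (x y : R) : (rotmx p k x y)^T = rotmx p k x (- y).
Proof.
apply/matrixP => i j; rewrite !mxE [j == i]eq_sym.
by rewrite ![(j == _) && _]andbC; ring.
Qed.

Lemma rotmx_orth (p k : 'I_m) (x y : R) : p != k -> x ^+ 2 + y ^+ 2 = 1 ->
  rotmx p k x y *m (rotmx p k x y)^T = 1%:M.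
Proof.
move=> pk xy; rewrite trmx_rotmx.
rewrite -[rotmx p k x (- y)]mulmx1 !rotmx_mul //; apply/matrixP => i j; rewrite !mxE.
have kp : (k == p) = false by rewrite eq_sym (negbTE pk).
rewrite !eqxx ?kp ?(negbTE pk) /=; move: xy; rewrite !expr2 => xy.
have [->|ik] := eqVneq i k.
  by rewrite -[RHS]mul1r -xy; ring.
by have [->|ip] := eqVneq i p => //; rewrite -[RHS]mul1r -xy; ring.
Qed.

Lemma inv_gram_form_mul (M : 'M[R]_m) u (W : 'M[R]_(m, n)) : M \in unitmx ->
  inv_gram_form u (M *m W) = inv_gram_form (invmx M *m u) W.
Proof.
move=> uM; have e : M *m W *m (M *m W)^T = M *m (W *m W^T) *m M^T by rewrite trmx_mul !mulmxA.
have dM : \det M != 0 by rewrite -unitfE -unitmxE.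
have dE : (\det (M *m W *m (M *m W)^T) == 0) = (\det (W *m W^T) == 0).
  by rewrite e !det_mulmx det_tr !mulf_eq0 (negbTE dM) /= orbF.
rewrite /inv_gram_form dE; case: ifPn => // dW.
have uG : W *m W^T \in unitmx by rewrite unitmxE unitfE.
have MG : M *m (W *m W^T) *m M^T *m ((invmx M)^T *m invmx (W *m W^T) *m invmx M) = 1%:M.
  move: (W *m W^T) uG => G uG; rewrite -!mulmxA [M^T *m (_^T *m _)]mulmxA -trmx_mul mulVmx //.
  by rewrite trmx1 mul1mx mulKVmx // mulmxV.
have -> : invmx (M *m W *m (M *m W)^T) = (invmx M)^T *m invmx (W *m W^T) *m invmx M.
  by rewrite e -[LHS]mulmx1 -MG mulKmx //; have [] := mulmx1_unit MG.
by rewrite frob_mull -!mulmxA.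
Qed.

(** A plane rotation fixing the pivot row up to scale clears one coordinate of
    u at a time, until u is a multiple of a basis vector. *)
Lemma inv_gram_moment S u :
  (\int[P]_w (inv_gram_form u (S + A w))%:E <= (c * frob u u)%:E)%E.
Proof.
have [->|u0] := eqVneq u 0.
  rewrite frob0l mulr0 integral0_eq // => w _.
  by rewrite /inv_gram_form frob0l if_same.
have [p up] : exists p, u p 0 != 0.
  apply/existsP; rewrite -negb_forall; apply: contra u0 => /forallP h.
  by apply/eqP/colP => i; rewrite mxE; apply/eqP; exact: h.
have : (#|[pred k | (k != p) && (u k 0%R != 0%R)]| <= #|[pred k | (k != p) && (u k 0%R != 0%R)]|)%N by [].
move: {2}(#|_|) => N; elim: N => [|N IH] in S u u0 up *.
  rewrite leqn0 => /eqP/card0_eq h.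
  have uE : u = u p 0 *: delta_mx p 0.
    apply/colP => i; rewrite !mxE eqxx andbT; have [->|ip] := eqVneq i p; first by rewrite mulr1.
    rewrite mulr0; apply/eqP; apply: contraT => ui.
    by have := h i; rewrite !inE ip ui.
  have fE W : inv_gram_form u W = u p 0 ^+ 2 * inv_gram_form (delta_mx p 0) W.
    rewrite /inv_gram_form; case: ifP => _; first by rewrite mulr0.
    by rewrite uE !mxE !eqxx mulr1 -scalemxAr frobZl frobZr mulrA.
  under eq_integral do rewrite fE EFinM.
  rewrite ge0_integralZl_EFin ?sqr_ge0 //; last 2 first.
  - by move=> w _; rewrite lee_fin inv_gram_form_ge0.
  - by apply/measurable_EFinP; apply: measurable_inv_gram_form; exact: measurable_shifted.
  have -> : frob u u = u p 0 ^+ 2.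
    by rewrite uE frobZl frobZr frob_delta !mxE !eqxx !mulr1.
  by rewrite [c * _]mulrC [(u p 0 ^+ 2 * c)%:E]EFinM lee_wpmul2l ?lee_fin ?sqr_ge0 //; exact: inv_gram_pivot_moment.
case: (pickP [pred k | (k != p) && (u k 0%R != 0%R)]) => [k /andP[kp uk] cN|h0]; last first.
  by move=> _; apply: IH => //; rewrite eq_card0.
have pk : p != k by rewrite eq_sym.
pose rho := Num.sqrt (u p 0 ^+ 2 + u k 0 ^+ 2).
have rho2 : rho ^+ 2 = u p 0 ^+ 2 + u k 0 ^+ 2 by rewrite sqr_sqrtr // addr_ge0 ?sqr_ge0.
have rho0 : 0 < rho by rewrite sqrtr_gt0 ltr_pwDl ?sqr_ge0 // lt_def sqr_ge0 sqrf_eq0 up.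
have rhon : rho != 0 by rewrite gt_eqF.
pose x := u p 0 / rho; pose y := - (u k 0 / rho).
have xy : x ^+ 2 + y ^+ 2 = 1.
  by rewrite /x /y sqrrN !expr_div_n -mulrDl -rho2 divff // expf_neq0.
have x0 : x != 0 by rewrite mulf_neq0 // invr_eq0.
pose Q := rotmx p k x y.
have QQ : Q *m Q^T = 1%:M by exact: rotmx_orth.
pose u' := Q^T *m u.
have u'E i : u' i 0 = if i == k then 0 else if i == p then rho else u i 0.
  rewrite /u' trmx_rotmx.
  rewrite rotmx_mul // !mxE; case: eqVneq => [_|ik].
    by rewrite /x /y opprK; ring.
  case: eqVneq => [_|ip] //; rewrite /x /y opprK.
  by rewrite mulrAC -expr2 [X in _ + X]mulrAC -expr2 -mulrDl -rho2 expr2 mulfK.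
have fu : frob u' u' = frob u u.
  by rewrite /u' frob_mull trmxK mulmxA QQ mul1mx.
have rot : (\int[P]_w (inv_gram_form u (S + A w))%:E =
    \int[P]_w (inv_gram_form u' (Q^T *m S + A w))%:E)%E.
  pose g (B : @mxspace R m n) := (inv_gram_form u (S + (B : 'M[R]_(m, n))))%:E.
  have mg : measurable_fun [set: @mxspace R m n] g.
    apply/measurable_EFinP; apply: measurable_inv_gram_form.
    by apply: measurable_addmx; [exact: measurable_cstmx|exact: coord_measurable].
  have g0 B : (0 <= g B)%E by rewrite lee_fin inv_gram_form_ge0.
  rewrite -(rotation_invariance gA pk xy x0 mg g0); apply: eq_integral => w _.
  have uQ : Q \in unitmx by have [] := mulmx1_unit QQ.
  have iQ : invmx Q = Q^T by rewrite -[LHS]mulmx1 -QQ mulKmx.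
  rewrite /g; have -> : S + Q *m A w = Q *m (Q^T *m S + A w).
    by rewrite mulmxDr mulmxA QQ mul1mx.
  by rewrite inv_gram_form_mul // iQ.
rewrite rot -fu; apply: IH.
- by apply/eqP => /colP/(_ p); rewrite u'E (negbTE pk) eqxx mxE => /eqP; rewrite (negbTE rhon).
- by rewrite u'E (negbTE pk) eqxx.
rewrite -ltnS; apply: leq_trans cN; apply: proper_card; apply/properP; split.
  apply/fintype.subsetP => i; rewrite !inE u'E => /andP[ip]; rewrite (negbTE ip) /=.
  by case: (i == k) => //; rewrite eqxx.
by exists k; rewrite !inE ?kp ?uk // u'E !eqxx andbF.
Qed.

End Inverse_gram_moment.

(** * Continuity and measurability of the matrix square root *)

Section Entrywise_continuity.
Context {R : realType}.

(** The tolerance is on entries because that is what rounding controls. *)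
Definition entry_continuous m n (f : 'M[R]_(m, n) -> R) :=
  forall (A : 'M[R]_(m, n)) (e : R), 0 < e -> exists2 dl : R, 0 < dl &
    forall B : 'M[R]_(m, n), (forall i j, `|A i j - B i j| <= dl) -> `|f A - f B| <= e.

Variables (m n : nat).

Let round (k : nat) (A : 'M[R]_(m, n)) : 'M[int]_(m, n) :=
  \matrix_(i, j) Num.floor (k.+1%:R * A i j).

Let unround (k : nat) (N : 'M[int]_(m, n)) : 'M[R]_(m, n) :=
  \matrix_(i, j) ((N i j)%:~R / k.+1%:R).

Let unroundK k (A : 'M[R]_(m, n)) i j : `|A i j - unround k (round k A) i j| <= k.+1%:R^-1.
Proof.
have k0 : 0 < k.+1%:R :> R by rewrite ltr0n.
rewrite !mxE; set y := k.+1%:R * A i j.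
have -> : A i j = y / k.+1%:R by rewrite /y mulrAC divff ?mul1r // gt_eqF.
have h1 := floor_le y; have h2 := floorD1_gt y.
rewrite -mulrBl ger0_norm; last by rewrite mulr_ge0 ?subr_ge0 // invr_ge0 ltW.
rewrite ler_pdivrMr // mulVf ?gt_eqF //.
by move: h2; rewrite intrD; lra.
Qed.

(** Rounding the entries to multiples of 1 / (k + 1) makes f take countably many
    values, each on a box; f is the pointwise limit of these step functions. *)
Lemma measurable_entry_continuous (f : 'M[R]_(m, n) -> R) : entry_continuous f ->
  measurable_fun [set: @mxspace R m n] (fun B : @mxspace R m n => f B).
Proof.
move=> cf.
pose h k (B : @mxspace R m n) := f (unround k (round k (B : 'M[R]_(m, n)))).
apply: (@measurable_fun_cvg _ _ _ _ h) => [k|B _].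
  move=> _ Y mY; rewrite setTI.
  have -> : h k @^-1` Y = \bigcup_(N : 'M[int]_(m, n))
      ([set B : @mxspace R m n | forall i j,
         ((N i j)%:~R <= k.+1%:R * (B : 'M[R]_(m, n)) i j < (N i j + 1)%:~R)] `&`
       [set B | Y (f (unround k N))]).
    apply/seteqP; split=> B /=.
      move=> YB; exists (round k B) => //; split=> // i j /=.
      by rewrite mxE floor_le floorD1_gt.
    move=> [N _ [hN]] /= YN; rewrite /h; suff -> : round k B = N by [].
    by apply/matrixP => i j; rewrite mxE; apply: floor_def.
  apply: countable_bigcupT_measurable; first exact: countableP.
  move=> N; apply: measurableI; last first.
    by have [y|y] := pselect (Y (f (unround k N)));
      [rewrite (_ : mkset _ = setT) //; apply/seteqP; split
      |rewrite (_ : mkset _ = set0) //; apply/seteqP; split].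
  apply: sub_gen_smallest; exists (fun i j => [set x : R | (N i j)%:~R <= k.+1%:R * x < (N i j + 1)%:~R]) => //.
  move=> i j.
  have -> : [set x : R | (N i j)%:~R <= k.+1%:R * x < (N i j + 1)%:~R] =
     (fun x => k.+1%:R * x) @^-1` `[(N i j)%:~R, (N i j + 1)%:~R[.
    by apply/seteqP; split=> x /=; rewrite in_itv.
  rewrite -[X in measurable X]setTI.
  have : measurable_fun [set: R] (fun x : R => k.+1%:R * x) by exact: measurable_funM.
  by apply => //; exact: measurable_itv.
apply/cvgrPdist_le => e e0; have [dl dl0 hdl] := cf B e e0.
have := @cvg_harmonic R => /cvgrPdist_le/(_ _ dl0); apply: filterS => k.
rewrite sub0r normrN ger0_norm ?invr_ge0 // => hk.
by apply: hdl => i j; apply: le_trans hk; exact: unroundK.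
Qed.

End Entrywise_continuity.

Section Square_root_continuity.
Context {R : realType}.

(** B^2 <= A^2 + dl^2 <= (A + dl)^2, and the square root is operator monotone.
    So the square root is Hoelder continuous of exponent 1/2. *)
Lemma psd_sqrt_close n (A B : 'M[R]_n) dl : psd A -> psd B -> 0 <= dl ->
  psd (A *m A - B *m B + (dl ^+ 2)%:M) -> psd (A - B + dl%:M).
Proof.
move=> pA pB d0 h; rewrite addrAC; apply: sqrt_monotone => //.
  by apply: psdD => //; exact: psd_scalar.
rewrite mulmxDl !mulmxDr mul_scalar_mx mul_mx_scalar mul_scalar_mx.
rewrite scale_scalar_mx -expr2.
have -> : A *m A + dl *: A + (dl *: A + (dl ^+ 2)%:M) - B *m B =
  A *m A - B *m B + (dl ^+ 2)%:M + (2 * dl) *: A.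
  by apply/matrixP => i j; rewrite !mxE; ring.
by apply: psdD => //; apply: psdZ => //; rewrite mulr_ge0.
Qed.

Lemma sym_form_bound n (M : 'M[R]_n) c : M^T = M -> 0 <= c -> frob M M <= c ^+ 2 ->
  psd (M + c%:M).
Proof.
move=> sM c0 hM; apply/psdE; split; first by rewrite linearD /= sM tr_scalar_mx.
move=> v; rewrite mulmxDl frobDr mul_scalar_mx frobZr.
have h1 := l2norm_mul_le M v; have v0 := frob_ge0 v.
have h2 := frob_cauchy v (M *m v).
have : (frob v (M *m v)) ^+ 2 <= (c * frob v v) ^+ 2.
  apply: (le_trans h2); rewrite exprMn [frob v v ^+ 2]expr2 mulrCA ler_wpM2l //.
  by apply: (le_trans h1); rewrite ler_wpM2r.
have cv : 0 <= c * frob v v by exact: mulr_ge0.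
move: (frob v (M *m v)) (c * frob v v) cv => x y y0 xy.
by case: (lerP 0 (x + y)) => // h; move: xy; rewrite !expr2; nra.
Qed.

(** Test the form at e_i + x e_j, for x = 0, 1 and -1. *)
Lemma psd_entry n (M : 'M[R]_n) i j : psd M ->
  0 <= M i i /\ `|M i j| <= (M i i + M j j) / 2.
Proof.
move=> /psdE [sM pM].
have e a b : frob (delta_mx a 0) (M *m delta_mx b 0 : 'cV_n) = M a b.
  by rewrite frobC frob_delta -colE mxE.
have ji : M j i = M i j by rewrite -[in LHS]sM mxE.
have h (x : R) : 0 <= M i i + x * M i j * 2 + x ^+ 2 * M j j.
  have := pM (delta_mx i 0 + x *: delta_mx j 0).
  rewrite mulmxDr -scalemxAr !frob_lin !e ji => h; apply: (le_trans h).
  by rewrite le_eqVlt; apply/orP; left; apply/eqP; ring.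
split; first by have := h 0; rewrite expr2 !mul0r !addr0.
by have := h 1; have := h (-1); rewrite ler_norml sqrrN !expr1n !mul1r => h1 h2; apply/andP; split; lra.
Qed.

Lemma psd_sqrt_entry_close n (A B : 'M[R]_n) dl i j : psd A -> psd B -> 0 <= dl ->
  frob (A - B) (A - B) <= (dl ^+ 2) ^+ 2 ->
  `|psd_sqrt A i j - psd_sqrt B i j| <= 2 * dl.
Proof.
move=> pA pB d0 hAB; have [pa aa] := psd_sqrtP pA; have [pb bb] := psd_sqrtP pB.
have h1 : psd (psd_sqrt A - psd_sqrt B + dl%:M).
  apply: psd_sqrt_close => //; rewrite aa bb; apply: sym_form_bound => //.
  - by rewrite linearB /= !psd_sym.
  - exact: sqr_ge0.
have h2 : psd (psd_sqrt B - psd_sqrt A + dl%:M).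
  apply: psd_sqrt_close => //; rewrite aa bb; apply: sym_form_bound => //.
  - by rewrite linearB /= !psd_sym.
  - exact: sqr_ge0.
  - by rewrite -opprB frobNl frobNr opprK.
have [a0 aij] := psd_entry i j h1; have [b0 bij] := psd_entry i j h2.
have [a0' _] := psd_entry j i h1; have [b0' _] := psd_entry j i h2.
move: a0 aij b0 bij a0' b0'; rewrite !mxE !eqxx !mulr1n => a0 aij b0 bij a0' b0'.
have [ij|ij] := eqVneq i j.
  by subst j; rewrite ler_norml; apply/andP; split; lra.
move: aij bij; rewrite (negbTE ij) !mulr0n !addr0 => aij bij; lra.
Qed.

Lemma gram_close m n (X Y : 'M[R]_(m, n)) t i j : 0 <= t -> t <= 1 ->
  (forall k l, `|X k l - Y k l| <= t) ->
  `|(X *m X^T) i j - (Y *m Y^T) i j| <= t * (n%:R * (2 * (\sum_k \sum_l `|X k l|) + 1)).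
Proof.
move=> t0 t1 h; set c := \sum_k _.
have Xc k l : `|X k l| <= c.
  rewrite /c (bigD1 k) //= (bigD1 l) //= -addrA lerDl addr_ge0 //.
    by apply: sumr_ge0.
  by apply: sumr_ge0 => a _; apply: sumr_ge0.
rewrite !mxE -sumrB (le_trans (ler_norm_sum _ _ _)) //.
apply: (@le_trans _ _ (\sum_(k < n) t * (2 * c + 1))).
  apply: ler_sum => k _; rewrite !mxE.
  have -> : X i k * X j k - Y i k * Y j k = X i k * (X j k - Y j k) + (X i k - Y i k) * Y j k.
    by ring.
  have Yc : `|Y j k| <= c + 1.
    have -> : Y j k = X j k - (X j k - Y j k) by ring.
    by rewrite (le_trans (ler_normB _ _)) // lerD // (le_trans (h _ _)).
  rewrite (le_trans (ler_normD _ _)) // !normrM.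
  have -> : t * (2 * c + 1) = c * t + t * (c + 1) by ring.
  by apply: lerD; apply: ler_pM.
rewrite sumr_const card_ord -mulr_natl le_eqVlt; apply/orP; left; apply/eqP; ring.
Qed.

Lemma sqrt_gram_continuous m n i j :
  entry_continuous (fun X : 'M[R]_(m, n) => psd_sqrt (X *m X^T) i j).
Proof.
move=> X e e0; set c := n%:R * (2 * (\sum_k \sum_l `|X k l|) + 1).
have c0 : 0 <= c.
  rewrite mulr_ge0 // addr_ge0 // mulr_ge0 //.
  by apply: sumr_ge0 => a _; apply: sumr_ge0.
pose dl := e / 2; have dl0 : 0 < dl by rewrite divr_gt0.
pose b := m%:R * c + 1; have b0 : 0 < b by rewrite ltr_wpDl // mulr_ge0.
pose t := Num.min 1 (dl ^+ 2 / b).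
have t0 : 0 < t by rewrite lt_min ltr01 divr_gt0 // exprn_gt0.
have t1 : t <= 1 by rewrite ge_min lexx.
have tb : t * (m%:R * c) <= dl ^+ 2.
  have : t * b <= dl ^+ 2 by rewrite -ler_pdivlMr // ge_min lexx orbT.
  by rewrite /b mulrDr mulr1; lra.
(* psd_sqrt_entry_close loses a factor 2 on the entries. *)
exists t => // Y h; have -> : e = 2 * dl by rewrite mulrC divfK.
apply: psd_sqrt_entry_close; [exact: psd_gramr|exact: psd_gramr|exact: ltW|].
rewrite frobE (@le_trans _ _ (\sum_(k < m) \sum_(l < m) (t * c) ^+ 2)) //.
  apply: ler_sum => k _; apply: ler_sum => l _.
  have -> : (X *m X^T - Y *m Y^T) k l = (X *m X^T) k l - (Y *m Y^T) k l.
    by rewrite mxE [X in _ + X]mxE.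
  rewrite -expr2 -[leLHS]real_normK ?num_real //.
  have gc := gram_close k l (ltW t0) t1 h.
  have tc0 : 0 <= t * c by apply: mulr_ge0 => //; exact: ltW.
  by apply: lerXn2r => //; rewrite nnegrE.
rewrite !sumr_const !card_ord -mulrnA -[leLHS]mulr_natl natrM -expr2 -exprMn.
apply: lerXn2r; rewrite ?nnegrE ?sqr_ge0 //; last by rewrite mulrCA.
by apply: mulr_ge0 => //; apply: mulr_ge0 => //; exact: ltW.
Qed.

End Square_root_continuity.

Section Measurable_square_root.
Context {R : realType} {d : measure_display} {T : measurableType d}.
Variables (m n : nat) (F : T -> 'M[R]_(m, n)).
Hypothesis mF : mx_measurable F.

Lemma measurable_sqrt_gram : mx_measurable (fun w => psd_sqrt (F w *m (F w)^T)).
Proof.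
move=> i j; have h := measurable_entry_continuous (@sqrt_gram_continuous R m n i j).
exact: (measurable_comp_mx h mF).
Qed.

Lemma measurable_polar_inv : mx_measurable (fun w => polar_inv (F w)).
Proof. by apply: measurable_invmx; exact: measurable_sqrt_gram. Qed.

End Measurable_square_root.

Lemma measurable_nuclear_norm {R : realType} {d : measure_display} {T : measurableType d}
    (m n : nat) (F : T -> 'M[R]_(m, n)) :
  mx_measurable F -> measurable_fun [set: T] (fun w => nuclear_norm (F w)).
Proof.
move=> mF; have := measurable_sqrt_gram (measurable_trmx mF) => h.
have -> : (fun w => nuclear_norm (F w)) =
    fun w => \sum_i psd_sqrt ((F w)^T *m ((F w)^T)^T) i i.
  by apply/funext => w; rewrite trmxK.
by apply: measurable_sum => i; exact: h.
Qed.

(** * The expected inverse polar matrix *)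

Section Mean_off_null.
Context {R : realType} {d : measure_display} {T : measurableType d} (P : probability T R).

(** The negative part of g - f vanishes off N, so that its mean is 0. *)
Lemma mean_le_off_null (N : set T) (f g : T -> R) : measurable N -> P N = 0%E ->
  has_mean P f -> has_mean P g -> (forall w, ~ N w -> f w <= g w) -> mean P f <= mean P g.
Proof.
move=> mN N0 hf hg fg; rewrite -subr_ge0 -meanB //.
pose h w := g w - f w; pose k w := Num.max (- h w) 0.
have hh : has_mean P h by exact: has_meanB.
have k0 w : 0 <= k w by rewrite le_max lexx orbT.
have hk : has_mean P k.
  apply: (has_mean_le _ _ (integrable_norm hh)).
    apply: measurable_maxr; last exact: measurable_cst.
    by apply: measurable_funN; exact: has_mean_measurable hh.
  by move=> w /=; rewrite ger0_norm // /k ge_max normr_ge0 -normrN ler_norm.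
have -> : 0 = mean P (fun w => (-1) * k w).
  rewrite meanZ //; suff -> : mean P k = 0 by rewrite mulr0.
  apply/eqP; rewrite eq_le mean_ge0 // andbT -lee_fin meanE //.
  rewrite -[leRHS](integral0 P [set: T]).
  apply: (le_integral_off_null mN) => // w nw.
  by rewrite lee_fin /k ge_max lexx andbT oppr_le0 subr_ge0 fg.
apply: mean_le => //; first exact: has_meanZ.
move=> w; rewrite mulN1r /k; case: (lerP (- h w) 0) => hw; rewrite ?oppr0 ?opprK //.
by rewrite -oppr_le0.
Qed.

End Mean_off_null.

Section Gaussian_forms.
Context {R : realType} {d : measure_display} {T : measurableType d} (P : probability T R).
Variables (m n : nat) (A : T -> 'M[R]_(m, n)).
Hypothesis gA : gaussian_law P A.

Lemma gaussian_linear_mean (B : 'M[R]_(m, n)) :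
  has_mean P (fun w => frob B (A w)) /\ mean P (fun w => frob B (A w)) = 0.
Proof.
have -> : (fun w => frob B (A w)) = fun w => \sum_i \sum_j B i j * A w i j.
  by apply/funext => w; rewrite frobE.
have h i j : has_mean P (fun w => B i j * A w i j) by apply: has_meanZ; exact: has_mean_entry.
have h' i : has_mean P (fun w => \sum_j B i j * A w i j) by exact: has_mean_sum.
split; first exact: has_mean_sum.
rewrite mean_sum //; apply: big1 => i _; rewrite mean_sum //; apply: big1 => j _.
by rewrite meanZ ?entry_mean0 ?mulr0 //; exact: has_mean_entry.
Qed.

Lemma gaussian_quadratic_mean (D : 'M[R]_m) :
  has_mean P (fun w => frob (A w) (D *m A w)) /\
  mean P (fun w => frob (A w) (D *m A w)) = n%:R * \tr D.
Proof.
have -> : (fun w => frob (A w) (D *m A w)) =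
    fun w => \sum_i \sum_j \sum_k D i k * (A w i j * A w k j).
  apply/funext => w; rewrite frobE; apply: eq_bigr => i _; apply: eq_bigr => j _.
  by rewrite mxE mulr_sumr; apply: eq_bigr => k _; rewrite mulrCA.
have h i j k : has_mean P (fun w => D i k * (A w i j * A w k j)).
  by apply: has_meanZ; exact: has_mean_mul_entries.
have h1 i j : has_mean P (fun w => \sum_k D i k * (A w i j * A w k j)) by exact: has_mean_sum.
have h2 i : has_mean P (fun w => \sum_j \sum_k D i k * (A w i j * A w k j)) by exact: has_mean_sum.
split; first exact: has_mean_sum.
rewrite mean_sum // /mxtrace mulr_sumr; apply: eq_bigr => i _.
rewrite mean_sum //; transitivity (\sum_(j < n) D i i).
  apply: eq_bigr => j _; rewrite mean_sum // (bigD1 i) //= big1 => [|k ki].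
    by rewrite meanZ ?(entry_covariance gA) ?eqxx ?mulr1 ?addr0 //; exact: has_mean_mul_entries.
  rewrite meanZ ?(entry_covariance gA); last exact: has_mean_mul_entries.
  by rewrite eq_sym (negbTE ki) /= mulr0.
by rewrite sumr_const card_ord mulr_natl.
Qed.

Lemma measurable_affine_gaussian S (L : 'M[R]_m) : mx_measurable (fun w => S + L *m A w).
Proof.
apply: measurable_addmx; first exact: measurable_cstmx.
by apply: measurable_mulmx; [exact: measurable_cstmx|exact: (gaussian_measurable gA)].
Qed.

Lemma has_mean_nuclear S (L : 'M[R]_m) : has_mean P (fun w => nuclear_norm (S + L *m A w)).
Proof.
have [hq _] := gaussian_quadratic_mean (L^T *m L).
have [hl _] := gaussian_linear_mean (L^T *m S).
have hs := has_meanZ n%:R (has_meanD (has_meanD (has_mean_cst P (frob S S)) (has_meanZ 2 hl)) hq).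
apply: (has_mean_le _ _ (has_meanD (has_mean_cst P 1) hs)).
  by apply: measurable_nuclear_norm; exact: measurable_affine_gaussian.
move=> w; rewrite ger0_norm ?nuclear_ge0 //.
have := nuclear_sqr_le (S + L *m A w); have := nuclear_ge0 (S + L *m A w).
have -> : frob (S + L *m A w) (S + L *m A w) =
    frob S S + 2 * frob (L^T *m S) (A w) + frob (A w) (L^T *m L *m A w).
  rewrite !frob_lin [frob (L *m A w) S]frob_mull [frob (L *m _) (L *m _)]frob_mull mulmxA.
  by rewrite [frob S (L *m A w)]frobC frob_mull [frob (A w) (L^T *m S)]frobC; ring.
move: (nuclear_norm _) (n%:R * _) => x y x0 xy.
by have := sqr_ge0 (1 - x); move: xy; rewrite !expr2; nra.
Qed.

End Gaussian_forms.

Section Expected_polar_inverse.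
Context {R : realType} {d : measure_display} {T : measurableType d} (P : probability T R).
Variables (m n : nat) (A : T -> 'M[R]_(m, n)).
Hypothesis gA : gaussian_law P A.
Hypothesis mn : (m + 2 <= n)%N.
Variable L : 'M[R]_m.
Hypothesis pL : posdef L.

Let X S w := S + L *m A w.

Definition singular_event S := [set w | \det (X S w *m (X S w)^T) = 0].

Let detL : \det L != 0.
Proof. by rewrite -unitfE -unitmxE; exact: posdef_unit. Qed.

Lemma singular_event_measurable S : measurable (singular_event S).
Proof.
apply: (@measurable_preimage0 _ _ _ (fun w => \det (X S w *m (X S w)^T))).
have mX := measurable_affine_gaussian gA S L.
by apply: measurable_det; apply: measurable_mulmx => //; exact: measurable_trmx.
Qed.

Let XE S w : X S w = L *m (invmx L *m S + A w).
Proof. by rewrite mulmxDr mulKVmx // posdef_unit. Qed.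

Lemma singular_event_null S : P (singular_event S) = 0%E.
Proof.
have mn' : (m <= n)%N by apply: leq_trans mn; rewrite leq_addr.
rewrite -[RHS](gaussian_full_rank mn' gA (invmx L *m S)); congr (P _).
apply/seteqP; split=> w /=.
  rewrite /singular_event /= XE trmx_mul !mulmxA -[L *m _ *m _]mulmxA !det_mulmx det_tr => /eqP.
  by rewrite !mulf_eq0 (negbTE detL) /= orbF => /eqP.
move=> h; rewrite /singular_event /= XE trmx_mul !mulmxA -[L *m _ *m _]mulmxA det_mulmx.
by rewrite det_mulmx h mulr0 mul0r.
Qed.

Lemma nonsingular_gram S w : ~ singular_event S w -> posdef (X S w *m (X S w)^T).
Proof. by move=> h; apply: gram_posdef; apply/eqP. Qed.

(** The inverse square root of the Gram matrix, truncated to 0 on the null event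
    so that it is positive semidefinite everywhere. *)
Definition safe_polar_inv S w : 'M[R]_m :=
  if \det (X S w *m (X S w)^T) == 0 then 0 else polar_inv (X S w).

Lemma safe_polar_invE S w : ~ singular_event S w -> safe_polar_inv S w = polar_inv (X S w).
Proof. by rewrite /safe_polar_inv; case: eqP. Qed.

Lemma measurable_safe_polar_inv S : mx_measurable (safe_polar_inv S).
Proof.
have mX := measurable_affine_gaussian gA S L.
move=> i j; have -> : (fun w => safe_polar_inv S w i j) =
   fun w => if \det (X S w *m (X S w)^T) == 0 then (0 : 'M[R]_m) i j else polar_inv (X S w) i j.
  by apply/funext => w; rewrite /safe_polar_inv; case: ifP.
apply: measurable_fun_ifT.
- apply: measurable_fun_eqr => //.
  by apply: measurable_det; apply: measurable_mulmx => //; exact: measurable_trmx.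
- exact: measurable_cst.
- exact: measurable_polar_inv.
Qed.

Lemma safe_polar_inv_psd S w : psd (safe_polar_inv S w).
Proof.
rewrite /safe_polar_inv; case: ifPn => [_|/gram_posdef h]; first exact: psd0.
by apply: posdef_psd; exact: polar_inv_posdef.
Qed.

Lemma safe_polar_inv_sqr S w u :
  frob (safe_polar_inv S w *m u) (safe_polar_inv S w *m u) = inv_gram_form u (X S w).
Proof.
rewrite /safe_polar_inv /inv_gram_form; case: ifPn => [_|/gram_posdef h].
  by rewrite mul0mx frob0l.
by rewrite frob_mull (posdef_sym (polar_inv_posdef h)) mulmxA polar_inv_sqr.
Qed.

Let c : R := (n%:R - m%:R - 1)^-1.

Lemma safe_polar_inv_sqr_mean S (u : 'cV[R]_m) :
  has_mean P (fun w => frob (safe_polar_inv S w *m u) (safe_polar_inv S w *m u)) /\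
  mean P (fun w => frob (safe_polar_inv S w *m u) (safe_polar_inv S w *m u)) <=
    c * frob (invmx L *m u) (invmx L *m u).
Proof.
apply: has_mean_ge0.
- apply: measurable_frob; apply: measurable_mulmx; try exact: measurable_cstmx.
  + exact: measurable_safe_polar_inv.
  + exact: measurable_safe_polar_inv.
- by move=> w; exact: frob_ge0.
under eq_integral do rewrite safe_polar_inv_sqr XE inv_gram_form_mul ?(posdef_unit pL) //.
exact: (inv_gram_moment gA mn).
Qed.

Lemma has_mean_safe_polar_inv S i j : has_mean P (fun w => safe_polar_inv S w i j).
Proof.
have [h _] := safe_polar_inv_sqr_mean S (delta_mx j 0).
apply: (has_mean_le _ _ (has_meanD (has_mean_cst P 1) h)); first exact: measurable_safe_polar_inv.
move=> w; set N := safe_polar_inv S w.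
have h1 := frob_coef (N *m delta_mx j (0 : 'I_1)) i 0.
have Nij : (N *m delta_mx j (0 : 'I_1)) i 0 = N i j by rewrite -colE mxE.
rewrite Nij in h1.
have := sqr_ge0 (1 - `|N i j|); have : N i j ^+ 2 = `|N i j| ^+ 2 by rewrite real_normK ?num_real.
by have := normr_ge0 (N i j); move: h1; rewrite !expr2; nra.
Qed.

Definition expected_polar_inv S : 'M[R]_m := \matrix_(i, j) mean P (fun w => safe_polar_inv S w i j).

Lemma has_mean_polar_form p S (x y : 'M[R]_(m, p)) :
  has_mean P (fun w => frob x (safe_polar_inv S w *m y)) /\
  mean P (fun w => frob x (safe_polar_inv S w *m y)) = frob x (expected_polar_inv S *m y).
Proof.
have E (N : 'M[R]_m) : frob x (N *m y) = \sum_i \sum_j \sum_k (x i j * y k j) * N i k.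
  rewrite frobE; apply: eq_bigr => i _; apply: eq_bigr => j _.
  by rewrite mxE mulr_sumr; apply: eq_bigr => k _; ring.
have -> : (fun w => frob x (safe_polar_inv S w *m y)) =
    fun w => \sum_i \sum_j \sum_k (x i j * y k j) * safe_polar_inv S w i k.
  by apply/funext => w; rewrite E.
have h i j k : has_mean P (fun w => (x i j * y k j) * safe_polar_inv S w i k).
  by apply: has_meanZ; exact: has_mean_safe_polar_inv.
have h1 i j : has_mean P (fun w => \sum_k (x i j * y k j) * safe_polar_inv S w i k).
  exact: has_mean_sum.
have h2 i : has_mean P (fun w => \sum_j \sum_k (x i j * y k j) * safe_polar_inv S w i k).
  exact: has_mean_sum.
split; first exact: has_mean_sum.
rewrite E mean_sum //; apply: eq_bigr => i _; rewrite mean_sum //; apply: eq_bigr => j _.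
rewrite mean_sum //; apply: eq_bigr => k _; rewrite meanZ ?[expected_polar_inv _ _ _]mxE //.
exact: has_mean_safe_polar_inv.
Qed.

Lemma expected_polar_inv_psd S : psd (expected_polar_inv S).
Proof.
apply/psdE; split.
  apply/matrixP => i j; rewrite !mxE; congr mean; apply/funext => w.
  by rewrite -[in LHS](psd_sym (safe_polar_inv_psd S w)) mxE.
move=> v; have [_ <-] := has_mean_polar_form S v v.
by apply: mean_ge0 => w; apply: psd_frob; exact: safe_polar_inv_psd.
Qed.

(** Jensen's inequality gives (E N)^2 <= E N^2, and the moment of the inverse
    Gram matrix bounds E N^2 by the square of beta L^-1; the square root is
    operator monotone. *)
Lemma expected_polar_inv_le S : psd (Num.sqrt c *: invmx L - expected_polar_inv S).
Proof.
have c0 : 0 <= c.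
  have : (m + 2)%:R <= n%:R :> R by rewrite ler_nat.
  by rewrite natrD /c invr_ge0; lra.
have piL := posdef_inv pL; have siL := posdef_sym piL.
have pE := expected_polar_inv_psd S; have sE := psd_sym pE.
have pcL : psd (Num.sqrt c *: invmx L) by apply: psdZ; [exact: sqrtr_ge0|exact: posdef_psd].
apply: sqrt_monotone => //.
apply/psdE; split.
  by rewrite linearB /= !trmx_mul sE (psd_sym pcL).
move=> u; rewrite mulmxBl frobBr -!mulmxA.
rewrite [frob u (_ *m (_ *m u))]frobC frob_mull (psd_sym pcL) -scalemxAl frobZl frobZr mulrA.
rewrite -expr2 sqr_sqrtr // [X in _ - X]frobC [X in _ - X]frob_mull sE.
set h := expected_polar_inv S *m u.
have [_ e1] := has_mean_polar_form S h u.
have [h2 e2] := safe_polar_inv_sqr_mean S u.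
rewrite subr_ge0; apply: le_trans e2.
have : mean P (fun w => 2 * frob h (safe_polar_inv S w *m u)) <=
   mean P (fun w => frob h h + frob (safe_polar_inv S w *m u) (safe_polar_inv S w *m u)).
  have [hh _] := has_mean_polar_form S h u.
  apply: mean_le; first exact: has_meanZ.
    by apply: has_meanD => //; exact: has_mean_cst.
  move=> w; have := frob_amgm h (safe_polar_inv S w *m u) ltr01.
  by rewrite invr1 !mul1r; lra.
rewrite meanD ?mean_cst //; last exact: has_mean_cst.
rewrite meanZ; last by have [] := has_mean_polar_form S h u.
by rewrite e1 -/h; lra.
Qed.

End Expected_polar_inverse.

(** * Differentiability from quadratic bounds *)

Section Matrix_calculus.
Context {R : realType} (m n : nat).
Implicit Types X Y H : 'M[R]_(m, n).

Lemma entry_le_norm H i j : `|H i j| <= `|H|.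
Proof.
have -> : `|H| = mx_norm H by [].
rewrite mx_normrE.
exact: (le_bigmax _ (fun ij : 'I_m * 'I_n => `|H ij.1 ij.2|) (i, j)).
Qed.

Lemma frob_le_norm H : frob H H <= (m * n)%:R * `|H| ^+ 2.
Proof.
rewrite frobE (@le_trans _ _ (\sum_(i < m) \sum_(j < n) `|H| ^+ 2)) //.
  apply: ler_sum => i _; apply: ler_sum => j _.
  rewrite -expr2 -[leLHS]real_normK ?num_real //.
  by apply: lerXn2r; rewrite ?nnegrE ?normr_ge0 //; exact: entry_le_norm.
by rewrite !sumr_const !card_ord -mulrnA mulnC -[leLHS]mulr_natl.
Qed.

Lemma norm_le_frob H c : 0 <= c -> frob H H <= c ^+ 2 -> `|H| <= c.
Proof.
move=> c0 h; have -> : `|H| = mx_norm H by [].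
rewrite mx_normrE; apply: bigmax_le => // -[i j] _ /=.
have := le_trans (frob_coef H i j) h.
rewrite -[X in X <= _](real_normK (num_real _)) => h1.
by rewrite -(ler_pXn2r (n := 2)) // ?nnegrE.
Qed.

Lemma frob_le_mul_norm X H : `|frob X H| <= (\sum_i \sum_j `|X i j|) * `|H|.
Proof.
rewrite frobE mulr_suml (le_trans (ler_norm_sum _ _ _)) //; apply: ler_sum => i _.
rewrite mulr_suml (le_trans (ler_norm_sum _ _ _)) //; apply: ler_sum => j _.
by rewrite normrM ler_wpM2l // entry_le_norm.
Qed.

Lemma near_dist_le X (e : R) : 0 < e -> \forall Y \near X, `|X - Y| <= e.
Proof.
move=> e0; have h : (id Y @[Y --> X] --> X)%classic by exact: cvg_id.
exact: (@cvgr_dist_le _ _ _ _ (nbhs_filter X) id X h).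
Qed.

Lemma frob_continuous X : continuous (frob X).
Proof.
move=> Y; apply: (@cvgrPdist_le _ _ _ (nbhs Y) (nbhs_filter Y) _ _).2 => e e0; set c := \sum_i \sum_j `|X i j|.
have c0 : 0 <= c by apply: sumr_ge0 => i _; exact: sumr_ge0.
have c1 : 0 < c + 1 by rewrite ltr_wpDl.
near=> Z; rewrite -frobBr (le_trans (frob_le_mul_norm _ _)) // -/c.
have : `|Y - Z| <= e / (c + 1).
  by near: Z; apply: near_dist_le; rewrite divr_gt0.
rewrite ler_pdivlMr // => h; apply: le_trans h; rewrite mulrC ler_wpM2l //.
by rewrite lerDl.
Unshelve. all: by end_near. Qed.

Lemma diff_frob (f : 'M[R]_(m, n) -> R) X H : differentiable f X ->
  'd f X H = frob (gradient f X) H.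
Proof.
move=> df; rewrite frobE {1}[H]matrix_sum_delta linear_sum; apply: eq_bigr => i _.
rewrite linear_sum; apply: eq_bigr => j _.
by rewrite linearZ /= mxE mulrC -deriveE.
Qed.

Section Quadratic_bound.
Variables (f : 'M[R]_(m, n) -> R) (G : 'M[R]_(m, n) -> 'M[R]_(m, n)) (C : R).
Hypothesis C0 : 0 < C.
Hypothesis fG : forall X H, 0 <= f (X + H) - f X - frob (G X) H <= C * frob H H.

(** The remainder is O(|H|^2). *)
Lemma quadratic_bound_diff X : differentiable f X /\ gradient f X = G X.
Proof.
have fl : linear (frob (G X)) by move=> a u v; rewrite frobDr frobZr.
pose flM := GRing.isLinear.Build _ _ _ _ _ fl.
pose df : {linear 'M[R]_(m, n) -> R} := HB.pack (frob (G X)) flM.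
have dfc : continuous df by exact: frob_continuous.
have dfo : f \o shift X = cst (f X) + df +o_ (0 : 'M[R]_(m, n)) id.
  apply/eqaddoP => e e0.
  have k0 : 0 < C * (m * n)%:R + 1 by rewrite ltr_wpDl // mulr_ge0 // ltW.
  apply: (@filterS _ (nbhs (0 : 'M[R]_(m, n))) (nbhs_filter _) _ _ _ (near_dist_le 0 (divr_gt0 e0 k0))) => H.
  rewrite sub0r normrN ler_pdivlMr // => h.
  have -> : (f \o shift X - (cst (f X) + df)) H = f (X + H) - f X - frob (G X) H.
    by rewrite -[LHS]/(f (H + X) - (f X + frob (G X) H)) [H + X]addrC opprD addrA.
  have /andP[h0 h1] := fG X H; rewrite ger0_norm //; apply: (le_trans h1).
  apply: (@le_trans _ _ (C * ((m * n)%:R * `|H| ^+ 2))).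
    by rewrite ler_wpM2l ?(ltW C0) // frob_le_norm.
  rewrite expr2 !mulrA ler_wpM2r //; apply: le_trans h.
  by rewrite mulrC ler_wpM2l // lerDl.
have dE := diff_unique dfc dfo.
have df' : differentiable f X by apply/diff_locallyP; rewrite dE.
split=> //; apply/matrixP => i j; rewrite mxE deriveE // dE.
exact: frob_delta.
Qed.

(** Comparing the two linear lower bounds at X and Y with the quadratic upper
    bound at Y + H, and optimising over H, bounds the variation of G. *)
Lemma quadratic_bound_lipschitz X Y :
  frob (G X - G Y) (G X - G Y) <= (2 * C) ^+ 2 * frob (Y - X) (Y - X).
Proof.
pose D := G X - G Y; pose H := (2 * C)^-1 *: D.
have /andP[h1 _] := fG X (Y - X + H); have /andP[_ h2] := fG Y H.
have /andP[_ h3] := fG X (Y - X).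
rewrite addrA [X + (Y - X)]addrC subrK in h1.
rewrite [X + (Y - X)]addrC subrK in h3; rewrite frobDr in h1.
have : frob D H <= C * frob H H + C * frob (Y - X) (Y - X).
  by rewrite /D frobBl; lra.
rewrite /H !frobZl !frobZr -/D => h; have C2 : 0 < 2 * C by rewrite mulr_gt0.
have : (2 * C)^-1 * frob D D / 2 <= C * frob (Y - X) (Y - X).
  have e : C * ((2 * C)^-1 * ((2 * C)^-1 * frob D D)) = (2 * C)^-1 * frob D D / 2.
    by field; rewrite gt_eqF.
  by move: h; rewrite e; lra.
rewrite ler_pdivrMr // [X in X <= _]mulrC ler_pdivrMr // => h4.
by apply: (le_trans h4); rewrite le_eqVlt; apply/orP; left; apply/eqP; ring.
Qed.

Lemma quadratic_bound_C1 : continuously_differentiable f.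
Proof.
split=> [X|]; first by have [] := quadratic_bound_diff X.
have -> : gradient f = G by apply/funext => X; have [] := quadratic_bound_diff X.
move=> X; apply: (@cvgrPdist_le _ _ _ (nbhs X) (nbhs_filter X) _ _).2 => e e0.
pose k := 2 * C * (m * n).+1%:R.
have k0 : 0 < k by rewrite !mulr_gt0.
near=> Y; apply: norm_le_frob; first exact: ltW.
apply: (le_trans (quadratic_bound_lipschitz X Y)).
have h : `|X - Y| <= e / k.
  by near: Y; apply: near_dist_le; rewrite divr_gt0.
rewrite ler_pdivlMr // in h.
have -> : frob (Y - X) (Y - X) = frob (X - Y) (X - Y) by rewrite -opprB frobNl frobNr opprK.
apply: (@le_trans _ _ ((2 * C) ^+ 2 * ((m * n).+1%:R ^+ 2 * `|X - Y| ^+ 2))).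
  rewrite ler_wpM2l ?sqr_ge0 // (le_trans (frob_le_norm _)) // ler_wpM2r ?sqr_ge0 //.
  by rewrite -natrX ler_nat (leq_trans (leqnSn _)) // -[X in (X <= _)%N]muln1 leq_mul.
rewrite -!exprMn; apply: lerXn2r; rewrite ?nnegrE ?(ltW e0) //.
  by rewrite !mulr_ge0 // ltW.
by rewrite (le_trans _ h) // le_eqVlt; apply/orP; left; apply/eqP; rewrite /k; ring.
Unshelve. all: by end_near. Qed.

End Quadratic_bound.

(** Directional derivatives of a function that is 1-Lipschitz for the nuclear
    norm are bounded by the nuclear norm; rank-one directions then test the
    operator norm of the gradient. *)
Lemma lipschitz_gradient (f : 'M[R]_(m, n) -> R) X :
  (forall Y H, f (Y + H) - f Y <= nuclear_norm H) -> differentiable f X ->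
  opnorm (gradient f X) <= 1.
Proof.
move=> fL df; set G := gradient f X.
have nZ (t : R) H : 0 <= t -> nuclear_norm (t *: H) <= t * nuclear_norm H.
  move=> t0; apply: nuclear_le => U hU; rewrite frobZl ler_wpM2l //.
  exact: nuclear_dual_le.
have GH H : frob G H <= nuclear_norm H.
  rewrite -diff_frob // -deriveE //.
  have c := diff_derivable (v := H) df.
  apply: (cvgr_to_le c); near=> t; have t0 : t != 0 by near: t; exact: nbhs_dnbhs_neq.
  rewrite /= [t *: H + X]addrC /GRing.scale /=.
  case/orP: (lt_total t0) => ht.
    have ti : 0 < - t by rewrite oppr_gt0.
    have := le_trans (fL (X + t *: H) (- t *: H)) (nZ _ H (ltW ti)).
    rewrite -addrA -scalerDl subrr scale0r addr0 => h.
    rewrite -[t^-1]opprK -invrN mulNr -mulrN opprB mulrC ler_pdivrMr // mulrC.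
    exact: h.
  have h := le_trans (fL X (t *: H)) (nZ _ H (ltW ht)).
  by rewrite mulrC ler_pdivrMr // mulrC.
apply/opnorm1P => v.
have h := GH (G *m v *m v^T).
have e : frob G (G *m v *m v^T) = frob (G *m v) (G *m v).
  by rewrite frobC frob_mulr trmxK.
rewrite e in h.
have : nuclear_norm (G *m v *m v^T) <= (frob (G *m v) (G *m v) + frob v v) / 2.
  apply: nuclear_le => U hU.
  have -> : frob (G *m v *m v^T) U = frob (G *m v) (U *m v) by rewrite frob_mulr trmxK.
  have := frob_amgm (G *m v) (U *m v) ltr01; rewrite invr1 !mul1r => h1.
  apply: (le_trans h1); rewrite ler_pM2r ?invr_gt0 // lerD2l.
  by move/opnorm1P: hU; apply.
lra.
Unshelve. all: by end_near. Qed.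

End Matrix_calculus.

(** * The smoothed nuclear norm *)

Section Smoothing.
Context {R : realType} {d : measure_display} {T : measurableType d} (P : probability T R).
Variables (m n : nat) (A : T -> 'M[R]_(m, n)).
Hypothesis gA : gaussian_law P A.

Definition smoothing (L : 'M[R]_m) (S : 'M[R]_(m, n)) : R :=
  mean P (fun w => nuclear_norm (S + L *m A w)).

Lemma smoothing_lipschitz L S H : smoothing L (S + H) - smoothing L S <= nuclear_norm H.
Proof.
rewrite lerBlDl -[nuclear_norm H](mean_cst P) -meanD; first last.
- exact: has_mean_cst.
- exact: has_mean_nuclear.
apply: mean_le; first exact: has_mean_nuclear.
  by apply: has_meanD; [exact: has_mean_nuclear|exact: has_mean_cst].
by move=> w; rewrite addrAC; exact: nuclear_triangle.
Qed.

(** The mean of <S + L A, U> is <S, U>; take U dual to S. *)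
Lemma smoothing_ge_nuclear L S : nuclear_norm S <= smoothing L S.
Proof.
have [U [hU <-]] := nuclear_dual_ex S.
have [hl h0] := gaussian_linear_mean gA (L^T *m U).
have -> : frob S U = mean P (fun w => frob S U + frob (L^T *m U) (A w)).
  by rewrite meanD ?mean_cst ?h0 ?addr0 //; exact: has_mean_cst.
apply: mean_le; [by apply: has_meanD => //; exact: has_mean_cst|exact: has_mean_nuclear|].
move=> w; rewrite -[frob (L^T *m U) _]frobC -frob_mull -frobDl; exact: nuclear_dual_le.
Qed.

Lemma smoothing0 S : smoothing 0 S = nuclear_norm S.
Proof.
rewrite /smoothing -[RHS](mean_cst P); congr mean; apply/funext => w.
by rewrite mul0mx addr0.
Qed.

(** The increment is at most the mean of the nuclear norm of (L2 - L1) A, and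
    for psd D that of D A is at most sqrt n * tr D by the variational bound and
    E <A, D A> = n tr D. *)
Lemma smoothing_stability L1 L2 S : (0 < n)%N -> psd (L2 - L1) ->
  smoothing L2 S - smoothing L1 S <= Num.sqrt n%:R * \tr (L2 - L1).
Proof.
move=> n0 pD; set D := L2 - L1; have sn0 : 0 < Num.sqrt n%:R :> R by rewrite sqrtr_gt0 ltr0n.
pose c : R := (Num.sqrt n%:R)^-1; have c0 : 0 < c by rewrite invr_gt0.
have [hq eq] := gaussian_quadratic_mean gA D.
have hb : has_mean P (fun w => 2^-1 * (c * frob (A w) (D *m A w) + c^-1 * \tr D)).
  by apply: has_meanZ; apply: has_meanD; [exact: has_meanZ|exact: has_mean_cst].
have -> : Num.sqrt n%:R * \tr D = mean P (fun w => 2^-1 * (c * frob (A w) (D *m A w) + c^-1 * \tr D)).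
  rewrite meanZ; last by apply: has_meanD; [exact: has_meanZ|exact: has_mean_cst].
  rewrite meanD; [|exact: has_meanZ|exact: has_mean_cst].
  rewrite meanZ // mean_cst eq /c invrK mulrA.
  have -> : (Num.sqrt n%:R)^-1 * n%:R = Num.sqrt n%:R :> R.
    by rewrite -[X in _ * X](sqr_sqrtr (ler0n R n)) expr2 mulKf // gt_eqF.
  lra.
rewrite lerBlDl -meanD //; last exact: has_mean_nuclear.
apply: mean_le; [exact: has_mean_nuclear|by apply: has_meanD => //; exact: has_mean_nuclear|].
move=> w; have -> : S + L2 *m A w = S + L1 *m A w + D *m A w.
  by rewrite -addrA -mulmxDl (_ : L1 + D = L2) // /D addrC subrK.
apply: (le_trans (nuclear_triangle _ _)); rewrite lerD2l mulrC; exact: nuclear_amgm.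
Qed.

Section Positive_definite.
Hypothesis mn : (m + 2 <= n)%N.
Variable L : 'M[R]_m.
Hypothesis pL : posdef L.

Let X S w := S + L *m A w.
Let N S w := safe_polar_inv A L S w.

Let U S w := N S w *m X S w.

Lemma safe_polar_opnorm S w : opnorm (U S w) <= 1.
Proof.
have [h|h] := pselect (singular_event A L S w).
  by rewrite /U /N /safe_polar_inv h eqxx mul0mx opnorm0.
by rewrite /U /N safe_polar_invE //; apply: polar_opnorm; exact: nonsingular_gram.
Qed.

Lemma has_mean_safe_polar S i j : has_mean P (fun w => U S w i j).
Proof.
apply: (@has_mean_bounded _ _ _ _ _ (1 + n%:R)).
  apply: (@measurable_mulmx _ _ _ m m n (N S) (X S)).
    exact: (measurable_safe_polar_inv gA).
  exact: (measurable_affine_gaussian gA).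
move=> w; have h := le_trans (frob_coef _ i j) (opnorm1_frob (safe_polar_opnorm S w)).
have := sqr_ge0 (1 - `|U S w i j|); have := normr_ge0 (U S w i j).
move: h; rewrite -[X in X <= _](real_normK (num_real _)) !expr2; nra.
Qed.

Definition expected_polar S : 'M[R]_(m, n) :=
  \matrix_(i, j) mean P (fun w => (safe_polar_inv A L S w *m (S + L *m A w)) i j).

Lemma has_mean_polar_linear S H :
  has_mean P (fun w => frob (U S w) H) /\ mean P (fun w => frob (U S w) H) = frob (expected_polar S) H.
Proof.
have -> : (fun w => frob (U S w) H) = fun w => \sum_i \sum_j H i j * U S w i j.
  apply/funext => w; rewrite frobE; apply: eq_bigr => i _; apply: eq_bigr => j _.
  by rewrite mulrC.
have h i j : has_mean P (fun w => H i j * U S w i j).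
  by apply: has_meanZ; exact: has_mean_safe_polar.
have h' i : has_mean P (fun w => \sum_j H i j * U S w i j) by exact: has_mean_sum.
split; first exact: has_mean_sum.
rewrite mean_sum // frobE; apply: eq_bigr => i _; rewrite mean_sum //; apply: eq_bigr => j _.
by rewrite meanZ ?[expected_polar _ _ _]mxE 1?mulrC //; exact: has_mean_safe_polar.
Qed.

Let c : R := (n%:R - m%:R - 1)^-1.

(** Away from the null set of singular matrices the nuclear norm lies between
    its tangent and its tangent plus a quadratic form in the inverse polar
    matrix; the bounds are the means of these. *)
Lemma smoothing_quadratic S H :
  0 <= smoothing L (S + H) - smoothing L S - frob (expected_polar S) H <=
    Num.sqrt c / 2 * frob H (invmx L *m H).
Proof.
have mN := singular_event_measurable gA L S.
have N0 := singular_event_null gA mn pL S.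
have hS := has_mean_nuclear gA S L; have hSH := has_mean_nuclear gA (S + H) L.
have [hU eU] := has_mean_polar_linear S H.
have [hN eN] := has_mean_polar_form gA mn pL S H H.
have XH w : S + H + L *m A w = X S w + H by rewrite addrAC.
rewrite -eU -!meanB //; last exact: has_meanB.
apply/andP; split.
  rewrite -(mean_cst P 0); apply: (mean_le_off_null mN N0); first exact: has_mean_cst.
    by apply: has_meanB => //; exact: has_meanB.
  move=> w nw; have h := nuclear_subgradient (nonsingular_gram nw) (X S w + H).
  rewrite XH; move: h; rewrite -safe_polar_invE // [X S w + H]addrC addrK -/(U S w) -/(X S w).
  by rewrite [H + _]addrC; lra.
apply: (@le_trans _ _ (mean P (fun w => 2^-1 * frob H (N S w *m H)))).
  apply: (mean_le_off_null mN N0).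
  - by apply: has_meanB => //; exact: has_meanB.
  - exact: has_meanZ.
  move=> w nw; have h := nuclear_bregman (nonsingular_gram nw) (X S w + H).
  rewrite XH; move: h; rewrite -safe_polar_invE // [X S w + H]addrC addrK -/(U S w) -/(X S w).
  by rewrite [H + _]addrC -/(N S w); lra.
rewrite meanZ // eN mulrC [leRHS]mulrAC ler_pM2r ?invr_gt0 //.
rewrite -subr_ge0 -frobZr -frobBr scalemxAl -mulmxBl; apply: psd_frob.
exact: expected_polar_inv_le.
Qed.

Lemma smoothing_C1 : continuously_differentiable (smoothing L) /\
  gradient (smoothing L) = expected_polar.
Proof.
pose K := frob (invmx L) (invmx L).
have K0 : 0 <= K by exact: frob_ge0.
have s0 : 0 <= Num.sqrt c by exact: sqrtr_ge0.
pose C := Num.sqrt c / 2 * ((1 + K) / 2) + 1.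
have C0 : 0 < C by rewrite ltr_wpDl // !mulr_ge0 // ?invr_ge0 // addr_ge0.
have h S H : 0 <= smoothing L (S + H) - smoothing L S - frob (expected_polar S) H <= C * frob H H.
  have /andP[-> h] := smoothing_quadratic S H; apply: (le_trans h).
  have h1 := frob_amgm H (invmx L *m H) ltr01.
  have h2 := frob_mul_le (invmx L) H; have H0 := frob_ge0 H.
  rewrite invr1 !mul1r in h1.
  have h3 : frob H (invmx L *m H) <= (1 + K) / 2 * frob H H.
    by move: h2; rewrite -/K => h2; move: h1 h2; set x := frob H H; set y := frob _ _; lra.
  apply: (@le_trans _ _ (Num.sqrt c / 2 * ((1 + K) / 2 * frob H H))).
    by apply: ler_wpM2l => //; rewrite divr_ge0.
  by rewrite mulrA; apply: ler_wpM2r => //; rewrite /C lerDl.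
split; first exact: (quadratic_bound_C1 C0 h).
by apply/funext => S; have [] := quadratic_bound_diff C0 h S.
Qed.

Lemma smoothing_bregman S Y :
  bregman (smoothing L) Y S <= Num.sqrt c / 2 * \tr ((S - Y)^T *m invmx L *m (S - Y)).
Proof.
have [_ gE] := smoothing_C1; rewrite /bregman gE.
have /andP[_] := smoothing_quadratic S (Y - S).
rewrite [S + (Y - S)]addrC subrK => h; apply: (le_trans h).
rewrite -mulmxA -/(frob (S - Y) (invmx L *m (S - Y))).
by rewrite -[S - Y]opprB mulmxN frobNl frobNr opprK.
Qed.

End Positive_definite.

End Smoothing.

(** * Admissibility *)

Section Null_set_integral.
Context {R : realType} {d : measure_display} {T : measurableType d}.

Lemma integral_eq_off_null (P : {measure set T -> \bar R}) (N : set T) (f g : T -> \bar R) :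
  measurable N -> P N = 0%E -> (forall w, ~ N w -> f w = g w) ->
  (\int[P]_w f w = \int[P]_w g w)%E.
Proof.
move=> mN N0 fg; rewrite integralE [RHS]integralE; congr (_ - _)%E.
  by apply/eqP; rewrite eq_le; apply/andP; split; apply: (le_integral_off_null mN N0) => // w /fg h;
    rewrite !funeposE h.
by apply/eqP; rewrite eq_le; apply/andP; split; apply: (le_integral_off_null mN N0) => // w /fg h;
  rewrite !funenegE h.
Qed.

End Null_set_integral.

Section Admissible.
Context {R : realType} {d : measure_display} {T : measurableType d} (P : probability T R).
Variables (m n : nat) (Z : 'I_m -> 'I_n -> {RV P >-> R}).
Hypothesis hZ : std_gaussian_matrix Z.
Hypothesis mn : (m + 2 <= n)%N.

Let A : T -> 'M[R]_(m, n) := rmatrix Z.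
Let gA : gaussian_law P A := std_gaussian_law hZ.

Lemma gaussian_smoothingE L : gaussian_smoothing Z L = smoothing P A L.
Proof. by apply/funext => S; rewrite /gaussian_smoothing unlock. Qed.

(** The maximiser is unique, and equal to the polar factor, off the null set of
    singular matrices; this determines its mean although the maximiser selected
    on that null set need not depend measurably on w. *)
Lemma expectation_op_argmax L S : posdef L ->
  expectation_mx P (fun w => op_argmax (S + L *m A w)) = expected_polar P A L S.
Proof.
move=> pL; apply/matrixP => i j; rewrite !mxE unlock /mean /Rintegral; congr fine.
apply: (integral_eq_off_null (singular_event_measurable gA L S) (singular_event_null gA mn pL S)).
move=> w nw; rewrite safe_polar_invE // op_argmax_polar //; exact: (nonsingular_gram nw).
Qed.

Lemma gaussian_smoothing_admissible :
  admissible_smoothing (Num.sqrt m%:R + Num.sqrt n%:R) (Num.sqrt (n%:R - m%:R - 1))^-1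
    (gaussian_smoothing Z).
Proof.
have n0 : (0 < n)%N by apply: leq_trans mn; rewrite addn2.
split.
- move=> L X _; rewrite gaussian_smoothingE => dX.
  by apply: lipschitz_gradient => // Y H; exact: smoothing_lipschitz.
- by move=> L X _; rewrite gaussian_smoothingE; exact: smoothing_ge_nuclear.
- by move=> X; rewrite gaussian_smoothingE; exact: smoothing0.
- move=> L1 L2 _ _ h12; rewrite !gaussian_smoothingE; apply: ge_ereal_sup => _ [X _ <-].
  rewrite lee_fin (le_trans (smoothing_stability gA X n0 h12)) // -linearB /=.
  by apply: ler_wpM2r; [exact: psd_tr_ge0|rewrite lerDr sqrtr_ge0].
- move=> L pL; rewrite gaussian_smoothingE; split.
    by have [] := smoothing_C1 gA mn pL.
  move=> X Y; have := smoothing_bregman gA mn pL X Y.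
  have : (m + 2)%:R <= n%:R :> R by rewrite ler_nat.
  rewrite natrD => h; rewrite sqrtrV //; lra.
Qed.

End Admissible.

(** * Trace inequalities for the regularisers *)

Section Trace_inequalities.
Context {R : realType}.

Lemma opnorm_gram_le m n (B : 'M[R]_(m, n)) G : 0 <= G -> opnorm B <= G ->
  psd ((G ^+ 2)%:M - B *m B^T).
Proof.
move=> G0 hB; apply/psdE; split.
  by rewrite linearB /= tr_scalar_mx trmx_mul trmxK.
move=> v; rewrite mulmxBl frobBr mul_scalar_mx frobZr subr_ge0 -mulmxA.
rewrite [frob v (B *m _)]frobC frob_mull.
by have /(opnormP _ G0) := opnorm_tr G0 hB; apply.
Qed.

(** Expand tr ((L' - L) L'^-1 (L' - L)) >= 0. *)
Lemma trace_increment m n (L L' : 'M[R]_m) (B : 'M[R]_(m, n)) : psd L -> posdef L' ->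
  L' *m L' = L *m L + B *m B^T -> frob B (invmx L' *m B) <= 2 * (\tr L' - \tr L).
Proof.
move=> pL pL' e; have uL := posdef_unit pL'; have sL' := posdef_sym pL'; have sL := psd_sym pL.
have := psd_frob (L' - L) (posdef_psd (posdef_inv pL')).
rewrite mulmxBr mulVmx // frobBr !frobBl.
have -> : frob L' 1%:M = \tr L' by rewrite frobC trace_frob.
have -> : frob L 1%:M = \tr L by rewrite frobC trace_frob.
have -> : frob L' (invmx L' *m L) = \tr L.
  by rewrite frobC frob_mull trmx_inv sL' mulVmx // frobC trace_frob.
have -> : frob B (invmx L' *m B) = \tr L' - frob L (invmx L' *m L).
  have BB : B *m B^T = L' *m L' - L *m L by rewrite e addrC addKr.
  rewrite frobC frob_mulr BB frobBr; congr (_ - _).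
    by rewrite frobC frob_mull sL' mulmxV // frobC trace_frob.
  by rewrite [RHS]frobC frob_mulr sL.
lra.
Qed.

(** Square roots turn L'^2 <= c^2 L^2 into L' <= c L, and inversion reverses
    it. *)
Lemma inv_le_scale m (L L' : 'M[R]_m) (c : R) : 0 < c -> posdef L -> posdef L' ->
  psd ((c ^+ 2) *: (L *m L) - L' *m L') -> psd (c *: invmx L' - invmx L).
Proof.
move=> c0 pL pL' h; have uL := posdef_unit pL.
have pc : psd (c *: L) by apply: psdZ; [exact: ltW|exact: posdef_psd].
have : psd (c *: L - L').
  apply: sqrt_monotone => //; first exact: posdef_psd.
  by rewrite -scalemxAl -scalemxAr scalerA -expr2.
move=> /(posdef_inv_antitone pL') /(psdZ (ltW c0)).
rewrite invmxZ; last by rewrite unitmxZ // unitfE gt_eqF.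
by rewrite scalerBr scalerA divff ?gt_eqF // scale1r.
Qed.

(** nuclear_variational at W = L, since tr (L^-1 B B^T) <= tr (L^-1 L^2) = tr
    L. *)
Lemma nuclear_le_trace m n (L : 'M[R]_m) (B : 'M[R]_(m, n)) : posdef L ->
  psd (L *m L - B *m B^T) -> nuclear_norm B <= \tr L.
Proof.
move=> pL h; have uL := posdef_unit pL; have sL := posdef_sym pL.
apply: (le_trans (nuclear_variational B pL)).
have : 0 <= frob (invmx (psd_sqrt L)) ((L *m L - B *m B^T) *m invmx (psd_sqrt L)) by exact: psd_frob.
have pr := psd_sqrt_posdef pL; have ur := posdef_unit pr; have sr := posdef_sym pr.
have [_ rr] := psd_sqrtP (posdef_psd pL).
have irr : invmx (psd_sqrt L) *m invmx (psd_sqrt L) = invmx L.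
  have h1 : psd_sqrt L *m psd_sqrt L *m (invmx (psd_sqrt L) *m invmx (psd_sqrt L)) = 1%:M.
    by rewrite -mulmxA [psd_sqrt L *m (invmx _ *m _)]mulKVmx // mulmxV.
  by rewrite rr in h1; rewrite -[LHS](mulKmx uL) h1 mulmx1.
rewrite frobC frob_mulr trmx_inv sr irr frobBl.
rewrite [frob (L *m L) _]frob_mull sL mulmxV // frobC -trace_frob.
have -> : frob (B *m B^T) (invmx L) = frob B (invmx L *m B) by rewrite frob_mulr trmxK.
lra.
Qed.

(** Compare the squares: (sqrt M + G)^2 = M + G^2 + 2 G sqrt M. *)
Lemma psd_sqrt_shift_le m (M : 'M[R]_m) G : psd M -> 0 <= G ->
  psd (psd_sqrt M + G%:M - psd_sqrt ((G ^+ 2)%:M + M)).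
Proof.
move=> pM G0; have [ps ss] := psd_sqrtP pM.
have pG : psd ((G ^+ 2)%:M + M) by apply: psdD => //; apply: psd_scalar; exact: sqr_ge0.
have [ps' ss'] := psd_sqrtP pG.
apply: sqrt_monotone => //; first by apply: psdD => //; exact: psd_scalar.
rewrite ss' mulmxDl !mulmxDr ss mul_scalar_mx mul_mx_scalar mul_scalar_mx scale_scalar_mx -expr2.
have -> : M + G *: psd_sqrt M + (G *: psd_sqrt M + (G ^+ 2)%:M) - ((G ^+ 2)%:M + M) =
    (2 * G) *: psd_sqrt M by apply/matrixP => i j; rewrite !mxE; ring.
by apply: psdZ => //; rewrite mulr_ge0.
Qed.

Lemma frob_opnorm_ge m n (S U : 'M[R]_(m, n)) D : 0 < D -> opnorm U <= D ->
  - (D * nuclear_norm S) <= frob S U.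
Proof.
move=> D0 hU; have h : opnorm (- D^-1 *: U) <= 1.
  apply/opnorm1P => v; rewrite -scalemxAl frobZl frobZr mulrA -expr2 sqrrN.
  rewrite exprVn mulrC ler_pdivrMr ?exprn_gt0 // mulrC.
  by move/(opnormP _ (ltW D0)): hU; apply.
have := nuclear_dual_le S h; rewrite frobZr mulNr -mulrN => h1.
rewrite lerNl mulrC -ler_pdivrMr //; by rewrite mulrC.
Qed.

End Trace_inequalities.

(** * The regret bound *)

Section Regret.
Context {R : realType} {d : measure_display} {T : measurableType d} (P : probability T R).
Variables (m n : nat) (A : T -> 'M[R]_(m, n)).
Hypothesis gA : gaussian_law P A.
Hypothesis mn : (m + 2 <= n)%N.
Variables (D G eta : R) (N : nat) (Gs Xs : nat -> 'M[R]_(m, n)).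
Hypotheses (D0 : 0 < D) (G0 : 0 < G) (eta0 : 0 < eta)
  (hG : forall t, (1 <= t <= N)%N -> opnorm (Gs t) <= G).

Let M t := gram_sum Gs t.
Let S t := grad_sum Gs t.
Let L t := psd_sqrt ((G ^+ 2)%:M + M t).
Let F t := smoothing P A (eta^-1 *: L t) (S t).
Let E t := expected_polar P A (eta^-1 *: L t) (S t).
Let beta : R := Num.sqrt (n%:R - m%:R - 1)^-1.

Let MS t : M t.+1 = M t + Gs t.+1 *m (Gs t.+1)^T.
Proof. by rewrite /M /gram_sum big_nat_recr. Qed.

Let SS t : S t.+1 = S t + Gs t.+1.
Proof. by rewrite /S /grad_sum big_nat_recr. Qed.

Lemma gram_sum_psd t : psd (gram_sum Gs t).
Proof.
elim: t => [|t IH]; first by rewrite /gram_sum big_geq //; exact: psd0.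
by rewrite [gram_sum _ _]MS; apply: psdD => //; exact: psd_gramr.
Qed.

Let pGM t : posdef ((G ^+ 2)%:M + M t).
Proof. by apply: posdefDpsd; [apply: posdef_scalar; exact: exprn_gt0|exact: gram_sum_psd]. Qed.

Let pL t : posdef (L t). Proof. exact: psd_sqrt_posdef. Qed.

Let LL t : L t *m L t = (G ^+ 2)%:M + M t.
Proof. by have [] := psd_sqrtP (posdef_psd (pGM t)). Qed.

Let L_le t : psd (L t.+1 - L t).
Proof.
apply: sqrt_monotone; try exact: posdef_psd.
by rewrite !LL MS addrA [X in X - _]addrC addrK; exact: psd_gramr.
Qed.

Lemma regularizer_posdef t : posdef (eta^-1 *: psd_sqrt ((G ^+ 2)%:M + gram_sum Gs t)).
Proof.
rewrite -/(M t) -/(L t); have e0 : 0 < eta^-1 by rewrite invr_gt0.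
apply: psd_unit_posdef; first by apply: psdZ; [exact: ltW|exact: (posdef_psd (pL t))].
by rewrite unitmxZ ?posdef_unit // unitfE gt_eqF.
Qed.

Let pK t : posdef (eta^-1 *: L t) := regularizer_posdef t.

Let n0 : (0 < n)%N. Proof. by apply: leq_trans mn; rewrite addn2. Qed.

Let sqrt2_sqr : Num.sqrt 2 ^+ 2 = 2 :> R. Proof. by rewrite sqr_sqrtr. Qed.

Let sqrt2_gt0 : 0 < Num.sqrt 2 :> R. Proof. by rewrite sqrtr_gt0. Qed.

(** With B = G_(t+1): B B^T <= G^2 <= L_t^2, so L_(t+1)^2 <= 2 L_t^2, and
    replacing L_(t+1)^-1 by L_t^-1 in trace_increment costs a factor sqrt 2. *)
Lemma trace_increment_lag t : (t < N)%N ->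
  frob (Gs t.+1) (invmx (L t) *m Gs t.+1) <= 2 * Num.sqrt 2 * (\tr (L t.+1) - \tr (L t)).
Proof.
move=> tN; set B := Gs t.+1.
have e : L t.+1 *m L t.+1 = L t *m L t + B *m B^T by rewrite !LL MS addrA.
have h1 := trace_increment (posdef_psd (pL t)) (pL t.+1) e.
have h2 : psd (Num.sqrt 2 *: invmx (L t.+1) - invmx (L t)).
  apply: inv_le_scale => //; rewrite sqrt2_sqr e LL.
  have -> : 2 *: ((G ^+ 2)%:M + M t) - ((G ^+ 2)%:M + M t + B *m B^T) =
      M t + ((G ^+ 2)%:M - B *m B^T) by apply/matrixP => i j; rewrite !mxE; ring.
  apply: psdD; first exact: gram_sum_psd.
  by apply: opnorm_gram_le; [exact: ltW|apply: hG; rewrite tN].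
have := psd_frob B h2; rewrite mulmxBl frobBr -scalemxAl frobZr subr_ge0 => h3.
apply: (le_trans h3); rewrite mulrAC [leRHS]mulrC.
by rewrite ler_pM2l.
Qed.

(* The first summand is the price per unit of trace of changing the regulariser,
   the second that of the Bregman divergence. *)
Let ratio := Num.sqrt n%:R / eta + Num.sqrt 2 * (beta * eta).

(** Passing from L_t to L_(t+1) at the point S_(t+1) is controlled by stability,
    passing from S_t to S_(t+1) at L_t by the quadratic bound. *)
Lemma potential_step t : (t < N)%N ->
  F t.+1 - F t - frob (E t) (Gs t.+1) <= ratio * (\tr (L t.+1) - \tr (L t)).
Proof.
move=> tN; set B := Gs t.+1.
have hL : psd (eta^-1 *: L t.+1 - eta^-1 *: L t).
  by rewrite -scalerBr; apply: psdZ => //; rewrite invr_ge0 ltW.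
have h1 := smoothing_stability gA (S t.+1) n0 hL.
have /andP[_ h2] := smoothing_quadratic gA mn (pK t) (S t) B.
have h3 := trace_increment_lag tN.
rewrite -scalerBr linearZ linearB /= in h1.
have iK : invmx (eta^-1 *: L t) = eta *: invmx (L t).
  by rewrite invmxZ ?invrK // unitmxZ ?posdef_unit // unitfE invr_eq0 gt_eqF.
rewrite -SS -/beta iK -scalemxAl frobZr in h2.
have be : 0 <= beta / 2 * eta by rewrite !mulr_ge0 ?sqrtr_ge0 // ltW.
have h4 := ler_wpM2l be h3.
move: h1 h2 h4; rewrite -/(F t.+1) -/(F t) -/(E t) -/B /ratio.
move: (smoothing _ _ _ (S t.+1)) (F t.+1) (F t) (frob (E t) B) (frob B _) (\tr (L t.+1) - \tr (L t)).
move=> x f1 f0 e y z.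
have -> : (Num.sqrt n%:R / eta + Num.sqrt 2 * (beta * eta)) * z =
  Num.sqrt n%:R * (eta^-1 * z) + Num.sqrt 2 * (beta * eta) * z by rewrite mulrDl [X in _ = X + _]mulrA.
have -> : beta / 2 * eta * y = beta / 2 * (eta * y) by rewrite mulrA.
have -> : beta / 2 * eta * (2 * Num.sqrt 2 * z) = Num.sqrt 2 * (beta * eta) * z by field.
lra.
Qed.

Variable K : R.
Hypotheses (K0 : ratio <= K) (K1 : 1 + Num.sqrt n%:R / eta <= K).

(** Telescope potential_step. The first increment starts at |S_1|_nuc, which is
    at most tr L_1; this is what the second constraint on K is for. *)
Lemma potential_bound t : (t < N)%N ->
  F t.+1 - \sum_(1 <= s < t.+1) frob (E s) (Gs s.+1) <= K * \tr (L t.+1).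
Proof.
elim: t => [|t IH] tN.
  rewrite big_geq // subr0.
  have h0 : psd (eta^-1 *: L 1 - 0).
    by rewrite subr0; exact: posdef_psd.
  have := smoothing_stability gA (S 1) n0 h0; rewrite smoothing0 subr0 linearZ /= -/(F 1) => h1.
  have h2 : nuclear_norm (S 1) <= \tr (L 1).
    apply: nuclear_le_trace => //; rewrite LL SS MS /S /M /grad_sum /gram_sum !big_geq // !add0r addrK.
    by apply: psd_scalar; exact: sqr_ge0.
  have tr0 : 0 <= \tr (L 1) by apply: psd_tr_ge0; exact: posdef_psd.
  have h3 := ler_wpM2r tr0 K1; move: h3; rewrite mulrDl mul1r -mulrA; lra.
have h1 := potential_step tN; have h2 := IH (ltnW tN).
rewrite big_nat_recr //=.
have hz : 0 <= \tr (L t.+2) - \tr (L t.+1).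
  by rewrite -linearB /=; apply: psd_tr_ge0.
move: (ler_wpM2r hz K0) h1 h2.
move: (F t.+2) (F t.+1) (frob _ _) (\sum_(1 <= _ < _) _) (\tr (L t.+2)) (\tr (L t.+1)) => f2 f1 e u a b.
by rewrite [K * (a - b)]mulrBr; move: (ratio * _) => r; lra.
Qed.

Hypotheses (X1 : Xs 1 = 0) (XS : forall t, (1 <= t <= N)%N -> Xs t.+1 = - D *: E t).

(** The plays are - D times the gradients E t. By duality the infimum over the
    ball is at least - D |S_N|_nuc, and |S_N|_nuc <= F N by dominance; the rest
    is potential_bound. *)
Lemma regret_potential :
  regret D Gs Xs N <= D * K * (\tr (psd_sqrt (gram_sum Gs N)) + m%:R * G).
Proof.
have KG : 0 <= K by apply: le_trans K1; rewrite addr_ge0 // divr_ge0 ?sqrtr_ge0 // ltW.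
have trM : 0 <= \tr (psd_sqrt (M N)).
  by apply: psd_tr_ge0; have [] := psd_sqrtP (gram_sum_psd N).
have infge : - (D * nuclear_norm (S N)) <=
    inf [set \sum_(1 <= t < N.+1) frob (Gs t) U | U in [set U : 'M[R]_(m, n) | opnorm U <= D]].
  apply: lb_le_inf.
    by exists (\sum_(1 <= t < N.+1) frob (Gs t) 0); exists 0 => //=; apply/(opnormP _ (ltW D0)) => v;
      rewrite mul0mx frob0l mulr_ge0 ?sqr_ge0 ?frob_ge0.
  by move=> _ [U hU <-]; rewrite -frob_suml; exact: frob_opnorm_ge.
suff main : \sum_(1 <= t < N.+1) frob (Gs t) (Xs t) + D * nuclear_norm (S N) <=
    D * K * (\tr (psd_sqrt (M N)) + m%:R * G).
  by move: main infge; rewrite /regret; lra.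
have [N0|Npos] := posnP N.
  have S0 : S N = 0 by rewrite N0 /S /grad_sum big_geq.
  have n00 : nuclear_norm (S N) = 0.
    apply/eqP; rewrite eq_le nuclear_ge0 andbT; apply: nuclear_le => U _.
    by rewrite S0 frob0l.
  rewrite n00 mulr0 addr0 [X in \sum_(1 <= t < X.+1) _]N0 big_geq //.
  by rewrite !mulr_ge0 // ?(ltW D0) // addr_ge0 // mulr_ge0 // ltW.
have [N' NE] : exists N', N = N'.+1 by exists N.-1; rewrite prednK.
have tN : (N' < N)%N by rewrite NE.
have sumE : \sum_(1 <= t < N.+1) frob (Gs t) (Xs t) =
    - (D * \sum_(1 <= t < N) frob (E t) (Gs t.+1)).
  rewrite big_nat_recl // X1 frob0r add0r mulr_sumr -sumrN.
  apply: eq_big_nat => t /andP[t1 tn]; rewrite XS ?t1 ?(ltnW tn) //.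
  by rewrite frobZr mulNr frobC.
have h1 := potential_bound tN; rewrite -NE in h1.
have h2 : nuclear_norm (S N) <= F N by exact: smoothing_ge_nuclear.
have h3 : \tr (L N) <= \tr (psd_sqrt (M N)) + m%:R * G.
  have := psd_tr_ge0 (psd_sqrt_shift_le (gram_sum_psd N) (ltW G0)).
  by rewrite linearB linearD /= mxtrace_scalar -/(M N) -/(L N) subr_ge0 mulr_natl.
have h4 := ler_wpM2l KG h3.
rewrite sumE addrC -mulrBr -mulrA ler_pM2l //; lra.
Qed.

End Regret.

(** With alpha between q = sqrt n and 2 q and kappa = sqrt (q beta), the point
    beta eta lies in [kappa, sqrt 2 kappa]; both constants are below
    2 sqrt 2 kappa there. *)
Lemma regret_constants {R : realType} (q alpha beta eta kappa : R) :
  0 < q -> q <= alpha <= 2 * q -> 0 < beta -> 0 < eta -> beta * eta ^+ 2 = alpha ->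
  1 <= kappa -> kappa ^+ 2 = q * beta ->
  q / eta + Num.sqrt 2 * (beta * eta) <= 2 * Num.sqrt 2 * kappa /\
  1 + q / eta <= 2 * Num.sqrt 2 * kappa.
Proof.
move=> q0 /andP[a1 a2] b0 e0 ae k1 kq.
have [s [-> s2 s0]] : exists s : R, [/\ Num.sqrt 2 = s, s ^+ 2 = 2 & 0 <= s].
  by exists (Num.sqrt 2); rewrite sqr_sqrtr // sqrtr_ge0.
have s1 : 1 <= s by move: s2; rewrite expr2; nra.
pose y := beta * eta; have y0 : 0 < y by exact: mulr_gt0.
have yy : y ^+ 2 = alpha * beta by rewrite /y -ae; ring.
have k0 : 0 <= kappa by lra.
have ky : kappa <= y.
  rewrite -(ler_pXn2r (n := 2)) // ?nnegrE ?(ltW y0) //.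
  by rewrite kq yy ler_pM2r.
have ys : y <= s * kappa.
  rewrite -(ler_pXn2r (n := 2)) // ?nnegrE ?(ltW y0) ?mulr_ge0 //.
  by rewrite [(s * kappa) ^+ 2]exprMn s2 kq yy mulrA ler_pM2r.
have qe : q / eta = kappa ^+ 2 / y.
  by rewrite kq /y; field; rewrite !gt_eqF.
have main : q / eta + s * y <= 2 * s * kappa.
  rewrite qe -lerBrDr ler_pdivrMr //.
  have h1 : (y - kappa) ^+ 2 <= ((s - 1) * kappa) ^+ 2.
    apply: lerXn2r; rewrite ?nnegrE ?subr_ge0 //; last by rewrite mulrBl mul1r lerD2r.
    by rewrite mulr_ge0 // subr_ge0.
  have h2 : s * ((s - 1) * kappa) ^+ 2 <= (s - 1) * kappa ^+ 2.
    have -> : s * ((s - 1) * kappa) ^+ 2 = (s ^+ 2 - s) * ((s - 1) * kappa ^+ 2) by ring.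
    rewrite s2 ler_piMl //; last by lra.
    by rewrite mulr_ge0 ?sqr_ge0 // subr_ge0.
  have h3 := ler_wpM2l s0 h1.
  have : s * (y - kappa) ^+ 2 <= (s - 1) * kappa ^+ 2 by exact: le_trans h3 h2.
  have -> : (y - kappa) ^+ 2 = y ^+ 2 - 2 * kappa * y + kappa ^+ 2 by ring.
  have -> : (2 * s * kappa - s * y) * y = 2 * s * (kappa * y) - s * y ^+ 2 by ring.
  have -> : s * (y ^+ 2 - 2 * kappa * y + kappa ^+ 2) =
    s * y ^+ 2 - 2 * s * (kappa * y) + s * kappa ^+ 2 by ring.
  rewrite mulrBl mul1r; lra.
split=> //; move: main; have : 1 <= s * y by rewrite -[X in X <= _]mulr1; apply: ler_pM => //; lra.
lra.
Qed.

Theorem theorem4p1 (R : realType) (m n : nat) (hm : (1 <= m)%N) (hn : (m + 2 <= n)%N)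
    (d : measure_display) (Omega : measurableType d) (P : probability Omega R)
    (Z : 'I_m -> 'I_n -> {RV P >-> R}) (hZ : std_gaussian_matrix Z) :
  let alpha : R := Num.sqrt m%:R + Num.sqrt n%:R in
  let beta : R := (Num.sqrt (n%:R - m%:R - 1))^-1 in
  admissible_smoothing alpha beta (gaussian_smoothing Z) /\
  forall (D G : R) (T : nat) (Gs Xs : nat -> 'M[R]_(m, n)),
    0 < D -> 0 < G ->
    (forall t : nat, (1 <= t <= T)%N -> opnorm (Gs t) <= G) ->
    let eta : R := Num.sqrt (alpha / beta) in
    let L (t : nat) : 'M[R]_m := psd_sqrt ((G ^+ 2)%:M + gram_sum Gs t) in
    Xs 1%N = 0 ->
    (forall t : nat, (1 <= t <= T)%N ->
       Xs t.+1 = - D *: expectation_mx P (fun w =>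
         op_argmax (grad_sum Gs t + eta^-1 *: (L t *m rmatrix Z w)))) ->
    regret D Gs Xs T <=
      2 * Num.sqrt 2 * D * (n%:R / (n%:R - m%:R - 1)) `^ (4^-1) *
      (\tr (psd_sqrt (gram_sum Gs T)) + m%:R * G).
Proof.
move=> alpha beta; split; first exact: gaussian_smoothing_admissible.
move=> D G T Gs Xs D0 G0 hG eta L X1 XS.
have gA := std_gaussian_law hZ.
have hmn : (m + 2)%:R <= n%:R :> R by rewrite ler_nat.
rewrite natrD in hmn.
have m0 : 0 <= m%:R :> R by exact: ler0n.
have k0 : 0 < n%:R - m%:R - 1 :> R by lra.
have n0 : 0 < n%:R :> R by lra.
pose q : R := Num.sqrt n%:R; have q0 : 0 < q by rewrite sqrtr_gt0.
have beta0 : 0 < beta by rewrite invr_gt0 sqrtr_gt0.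
have a1 : q <= alpha <= 2 * q.
  apply/andP; split; first by rewrite /alpha lerDr sqrtr_ge0.
  by rewrite /alpha mulrDl mul1r lerD2r ler_sqrt //; lra.
have alpha0 : 0 < alpha by apply: lt_le_trans q0 _; case/andP: a1.
have eta0 : 0 < eta by rewrite sqrtr_gt0 divr_gt0.
have ae : beta * eta ^+ 2 = alpha.
  by rewrite sqr_sqrtr ?divr_ge0 ?ltW // mulrC divfK // gt_eqF.
pose x : R := n%:R / (n%:R - m%:R - 1).
have x1 : 1 <= x by rewrite ler_pdivlMr // mul1r; lra.
pose kappa := x `^ (4^-1).
have kk : kappa ^+ 2 = Num.sqrt x.
  rewrite /kappa -powR_mulrn ?powR_ge0 // -powRrM.
  have -> : 4^-1 * 2%:R = 2^-1 :> R by field.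
  by rewrite powR12_sqrt //; lra.
have kq : kappa ^+ 2 = q * beta by rewrite kk sqrtrM ?(ltW n0) // sqrtrV // ltW.
have k1 : 1 <= kappa.
  rewrite -(ler_pXn2r (n := 2)) // ?nnegrE ?powR_ge0 // kk expr1n.
  by rewrite -sqrtr1 ler_sqrt //; lra.
have [K0 K1] := regret_constants q0 a1 beta0 eta0 ae k1 kq.
have bE : Num.sqrt (n%:R - m%:R - 1)^-1 = beta :> R by rewrite sqrtrV // ltW.
rewrite -bE in K0.
have XS' t : (1 <= t <= T)%N ->
    Xs t.+1 = - D *: expected_polar P (rmatrix Z) (eta^-1 *: L t) (grad_sum Gs t).
  move=> ht; rewrite XS // -(expectation_op_argmax hZ hn).
    by congr (_ *: expectation_mx _ _); apply/funext => w; rewrite scalemxAl.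
  by apply: regularizer_posdef.
have := regret_potential gA hn D0 G0 eta0 hG K0 K1 X1 XS'.
have -> : D * (2 * Num.sqrt 2 * kappa) = 2 * Num.sqrt 2 * D * kappa by ring.
by [].
Qed.
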